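(* Let $d$ be even, $d/2\le k_0\le d-1$, and let $r:\mathcal U\to\mathbb R$ be a function of class $\mathcal C^{d/2+k_0+5}$ on a neighborhood $\mathcal U$ of $0$ in $\mathbb C^2$ of the admissible form described in the context. Let $M=\{r=0\}$ and let $H$ be a local biholomorphism of $\mathbb C^2$ at $0$ such that $H(0)=0$, $H(M)\subset M$, and $H$ is tangent to the identity up to order $k_0-\frac d2+2$. Then $H$ coincides with the identity.
   Context: Admissible form: $$r(z,w)=-\mathrm{Re}\,w+P(z,\overline z)+\sum_{i+j=d+1}z^i\overline z^j r_{ij0}(z)+\sum_{l=1}^{d-1}\sum_{i+j=d-l}z^i\overline z^j(\mathrm{Im}\, w)^l r_{ijl}(z,\mathrm{Im}\, w)+\theta_1(\mathrm{Im}\, w),$$ where $P(z,\overline z)=\sum_{j=d-k_0}^{k_0}\alpha_jz^j\overline z^{d-j}$, $\alpha_j=\overline{\alpha_{d-j}}$, $\alpha_{k_0}\neq0$, is a subharmonic homogeneous polynomial with $\{z:P_{z\overline z}(z,\overline z)=0\}=\{0\}$, and $r_{ij0}$, $r_{ijl}$ (complex-valued) and $\theta_1$ (real-valued) are functions of class $\mathcal C^{k_0-d/2+5}$ near the origin with $\theta_1(\mathrm{Im}\, w)=O(|\mathrm{Im}\, w|^2)$. $H$ is tangent to the identity up to order $\ell$ if $H$ and the identity have the same $\ell$-jet at $0$, i.e. $H(z,w)-(z,w)$ consists of terms of order at least $\ell+1$ in $(z,w)$ at $0$. The inclusion $H(M)\subset M$ and the conclusion are understood for germs at $0$. *)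

(* Defs.v *)
From mathcomp Require Import all_boot all_order all_algebra.
From mathcomp Require Import all_classical all_reals all_analysis.
From mathcomp.real_closed Require Import complex.

Set Implicit Arguments.
Unset Strict Implicit.
Unset Printing Implicit Defensive.

Import Order.TTheory GRing.Theory Num.Theory.
Import numFieldNormedType.Exports.

Local Open Scope classical_set_scope.
Local Open Scope ring_scope.

(* [R[i]^o] is [R[i]] with its topology and its structure of normed module over
   itself; in particular [differentiable] and ['D_v] are complex-linear on
   it and on [C2 R]. *)
Notation CC R := (R[i]^o).
Notation C2 R := (CC R * CC R)%type.

Section Smoothness.
Context {R : realType}.

(* For [A] open and [V] finite-dimensional, existence and continuity on [A] of
   all the iterated directional derivatives of order at most [n] is the same
   as existence and continuity of the partial derivatives of order at most
   [n]. *)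
Fixpoint class_C {V : normedModType R} (n : nat) (A : set V) (f : V -> R)
    : Prop :=
  (forall x, A x -> {for x, continuous f}) /\
  (if n is m.+1 then
     forall v : V, (forall x, A x -> derivable f x v) /\ class_C m A ('D_v f)
   else True).

Definition class_C_near0 {V : normedModType R} (n : nat) (f : V -> R) : Prop :=
  exists2 A : set V, open_nbhs 0 A & class_C n A f.

Definition cplx (x : R * R) : R[i] := Complex x.1 x.2.

Definition cplx2 (x : (R * R) * (R * R)) : C2 R := (cplx x.1, cplx x.2).

Definition class_C_C2 (n : nat) (U : set (C2 R)) (r : C2 R -> R) : Prop :=
  class_C n [set x | U (cplx2 x)] (fun x => r (cplx2 x)).

Definition class_C_near0_C (n : nat) (f : R[i] -> R[i]) : Prop :=
  class_C_near0 n (fun x : R * R => complex.Re (f (cplx x))) /\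
  class_C_near0 n (fun x : R * R => complex.Im (f (cplx x))).

Definition class_C_near0_CR (n : nat) (f : R[i] -> R -> R[i]) : Prop :=
  class_C_near0 n (fun x : (R * R) * R => complex.Re (f (cplx x.1) x.2)) /\
  class_C_near0 n (fun x : (R * R) * R => complex.Im (f (cplx x.1) x.2)).

End Smoothness.

Section Plane.
Context {R : realType}.

Definition circle_point (a : R[i]) (rho t : R) : R[i] :=
  a + real_complex R rho * Complex (cos t) (sin t).

Definition subharmonic (u : CC R -> \bar R) : Prop :=
  [/\ forall z, (u z < +oo)%E,
      lower_semicontinuous (fun z => - u z)%E &
      forall (a : CC R) (rho : R), 0 < rho ->
        (u a <= ((2 * pi)^-1)%:E *
                \int[lebesgue_measure]_(t in `[0%R, (2 * pi : R)%R])
                   u (circle_point a rho t))%E].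

(* derivative at [z] of [f] along the real line through [z] directed by [v] *)
Definition real_dir_derive (v : R[i]) (f : R[i] -> R[i]) (z : R[i]) : R[i] :=
  let g (t : R) := f (z + real_complex R t * v) in
  Complex (derive1 (fun t : R => complex.Re (g t)) 0)
          (derive1 (fun t : R => complex.Im (g t)) 0).

Definition wirtinger_z (f : R[i] -> R[i]) (z : R[i]) : R[i] :=
  (real_dir_derive 1 f z - 'i%C * real_dir_derive 'i%C f z) / 2%:R.

Definition wirtinger_zbar (f : R[i] -> R[i]) (z : R[i]) : R[i] :=
  (real_dir_derive 1 f z + 'i%C * real_dir_derive 'i%C f z) / 2%:R.

End Plane.

Section AdmissibleForm.
Context {R : realType}.

Definition model_poly (d k0 : nat) (alpha : nat -> R[i]) (z : R[i]) : R[i] :=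
  \sum_(d - k0 <= j < k0.+1) alpha j * z ^+ j * conjc z ^+ (d - j).

(* The right-hand side of the defining equation, as a complex number. *)
Definition admissible_expr (d k0 : nat) (alpha : nat -> R[i])
    (r0 : nat -> nat -> R[i] -> R[i])
    (rl : nat -> nat -> nat -> R[i] -> R -> R[i])
    (theta1 : R -> R) (z w : R[i]) : R[i] :=
  - real_complex R (complex.Re w)
  + model_poly d k0 alpha z
  + \sum_(i < d.+2) \sum_(j < d.+2 | (i + j == d.+1)%N)
      z ^+ i * conjc z ^+ j * r0 i j z
  + \sum_(1 <= l < d) \sum_(i < d.+1) \sum_(j < d.+1 | (i + j == d - l)%N)
      z ^+ i * conjc z ^+ j * real_complex R (complex.Im w) ^+ l
      * rl i j l z (complex.Im w)
  + real_complex R (theta1 (complex.Im w)).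

(* The symmetry of [alpha] makes [model_poly d k0 alpha] real-valued.  The
   functions [r0 i j], [rl i j l], [theta1] only matter as germs at the origin,
   and so does the last equation. *)
Definition admissible (d k0 : nat) (r : C2 R -> R) : Prop :=
  exists (alpha : nat -> R[i])
         (r0 : nat -> nat -> R[i] -> R[i])
         (rl : nat -> nat -> nat -> R[i] -> R -> R[i])
         (theta1 : R -> R),
    let P := model_poly d k0 alpha in
    let m := (k0 - d./2 + 5)%N in
    [/\ (forall j, (d - k0 <= j <= k0)%N -> alpha j = conjc (alpha (d - j)%N)),
        alpha k0 != 0,
        subharmonic (fun z : CC R => (complex.Re (P z))%:E) &
        [set z | wirtinger_zbar (wirtinger_z P) z = 0] = [set 0]] /\
    [/\ (forall i j, (i + j = d.+1)%N -> class_C_near0_C m (r0 i j)),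
        (forall i j l, (1 <= l < d)%N -> (i + j = d - l)%N ->
           class_C_near0_CR m (rl i j l)),
        class_C_near0 m theta1,
        theta1 =O_ (0 : R) (fun t : R => `|t| ^+ 2) &
        \forall p \near (0 : C2 R),
          real_complex R (r p)
            = admissible_expr d k0 alpha r0 rl theta1 p.1 p.2].

End AdmissibleForm.

Section Holomorphic.
Context {R : realType}.

Definition holomorphic_on (A : set (C2 R)) (F : C2 R -> C2 R) : Prop :=
  forall p, A p -> differentiable F p.

Definition local_biholomorphism (H : C2 R -> C2 R) (p0 : C2 R) : Prop :=
  exists (A B : set (C2 R)) (G : C2 R -> C2 R),
    [/\ open_nbhs p0 A, open B, set_bij A B H,
        forall p, A p -> G (H p) = p &
        holomorphic_on A H /\ holomorphic_on B G].

Definition partial_zw (a b : nat) (F : C2 R -> C2 R) : C2 R -> C2 R :=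
  iter a (fun G => 'D_((1, 0) : C2 R) G)
    (iter b (fun G => 'D_((0, 1) : C2 R) G) F).

(* For maps holomorphic near [p], whose partial derivatives involving
   a conjugate variable vanish identically. *)
Definition same_jet (l : nat) (F G : C2 R -> C2 R) (p : C2 R) : Prop :=
  forall a b, (a + b <= l)%N -> partial_zw a b F p = partial_zw a b G p.

Definition tangent_to_id (l : nat) (H : C2 R -> C2 R) : Prop :=
  same_jet l H idfun 0.

End Holomorphic.

(* Main.v *)
Require Import Defs.
From mathcomp Require Import all_boot all_order all_algebra.
From mathcomp Require Import all_classical all_reals all_analysis.
From mathcomp.real_closed Require Import complex.
From mathcomp Require Import ring lra zify.
Import Order.TTheory GRing.Theory Num.Theory.
Import numFieldNormedType.Exports.
Import Normc.
Local Open Scope classical_set_scope.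
Local Open Scope ring_scope.
Local Open Scope complex_scope.

Set Implicit Arguments.
Unset Strict Implicit.
Unset Printing Implicit Defensive.

(** Why the theorem holds.  Give z the weight 1 and w the weight d, so that M is
the graph Re w = P(z) up to terms of weight larger than d, and write
H = id + (F, G).  A monomial z^m w^n of G gets the weight m + d n, and a
monomial z^m w^n of F the weight m + d n + d - 1, because F enters the equation
through the derivative of P, which is homogeneous of degree d - 1.  The heart of
the proof is that no weight nu can be the first one to occur in (F, G).

Let nu be given, let F and G have no term of weight smaller than nu, and let F_nu
and G_nu be their parts of weight nu.  The points
(eps z, eps^d (P(z) + o(1) + i s)) lie on M; writing that their images lie on M,
dividing by eps^nu and letting eps tend to 0 leaves
[Re G_nu(z, w) = Re (D(z) F_nu(z, w))] for w = P(z) + i s and all z, s, where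
h -> Re (D(z) h) is the differential of P at z ([leading_identity]).  The other terms of the defining
function disappear since they vary slowly at this scale
([defining_remainder_small]).

This identity is pure algebra.  For |z| = 1 put T = z^2 and X = z^d w.
Then z^d P(z) is a polynomial p in T, and z^d times the conjugate of w is
2p(T) - X, so the identity becomes a relation
[sum_n A_n(T) X^n + B_n(T) (2 p(T) - X)^n = 0] between polynomials in two
independent variables.  Setting T = 0, comparing degrees in T, and setting X = 0
and X = 2p(T) shows that all the coefficients vanish
([power_identity_coefs_eq0], [weight_coef_eq0]).  Tangency to the identity is
used there: F and G have no term of degree at most 2, which excludes the
infinitesimal automorphisms of the model Re w = P(z), such as the dilations,
that have small weight.

Induction on nu then gives the vanishing of all the Taylor coefficients of F
and G ([all_coefs_eq0]), and a map that is holomorphic is determined near 0 by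
its Taylor coefficients.  The facts about holomorphic functions of two variables
that this requires are derived from Goursat's theorem: Cauchy's formula on a
square gives Taylor expansions in one variable ([cauchy_taylor]), and applying
it in each variable gives one in two variables ([cauchy_taylor2]) whose error
constant does not depend on the order of truncation.  This uniformity is
what turns vanishing coefficients into a vanishing function
([expands0_eq0]).  Cauchy's estimate identifies the coefficients of order at
most 2 with the derivatives in the definition of tangency ([tangent_coefs]). *)

(** * An identity between powers of X and of c - X *)

Lemma coef_subX_exp (A : comNzRingType) (c : A) (n j : nat) :
  ((c%:P - 'X) ^+ n)`_j = (-1) ^+ j * c ^+ (n - j) *+ 'C(n, j).
Proof.
rewrite exprDn coef_sum.
have E (i : 'I_n.+1) : true -> (c%:P ^+ (n - i) * (- 'X) ^+ i *+ 'C(n, i))`_j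
  = ((-1) ^+ i * c ^+ (n - i) *+ 'C(n, i)) * (i == j :> nat)%:R.
  move=> _; rewrite coefMn (exprNn 'X) -polyC_exp coefCM.
  rewrite -(rmorph_sign (@polyC A)).
  by rewrite coefCM coefXn mulrA (mulrC (c ^+ _)) eq_sym mulrnAl.
rewrite (eq_bigr _ E); case: (ltnP j n.+1) => jn.
  rewrite (bigD1 (Ordinal jn)) //= eqxx mulr1 big1 ?addr0 // => i.
  by rewrite -val_eqE /= => /negPf ->; rewrite mulr0.
rewrite bin_small ?mulr0n // big1 // => i _.
by rewrite (ltn_eqF (leq_trans (ltn_ord i) jn)) mulr0.
Qed.

(** Here c is twice the polynomial of the model on the unit circle, p1 and q
    come from its derivative and the conjugate of that derivative, f and g are
    the coefficients of weight nu of the two components of the map, and fb, gb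
    their conjugates.  All that matters about conjugation is that it preserves
    being zero.  The weights of the coefficients of index n leave the exponents
    nu - (d n + d - 1) and nu - d n for z, and [f_order], [g_order] say that
    the monomials have degree at least 3. *)
Section Vanish.
Variables (C : numDomainType) (d nu k0 : nat).
Variables (c p1 q : {poly C}) (f fb g gb : nat -> C).
Hypotheses (k0_gt0 : (0 < k0)%N) (k0d : (k0 < d)%N) (d2 : (1 < d)%N).
Hypotheses (size_c : size c = k0.+1) (size_p1 : size p1 = k0).
Hypotheses (size_q : (size q <= k0.+1)%N) (q_neq0 : q != 0).
Hypotheses (c0 : c.[0] = 0) (q0 : q.[0] = 0).
Hypothesis fb0 : forall n, (fb n == 0) = (f n == 0).
Hypothesis gb0 : forall n, (gb n == 0) = (g n == 0).
Hypothesis f_dom : forall n, f n != 0 -> (d * n + d.-1 <= nu)%N.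
Hypothesis g_dom : forall n, g n != 0 -> (d * n <= nu)%N.
Hypothesis f_order : forall n, f n != 0 -> (3 <= nu - (d * n + d.-1) + n)%N.
Hypothesis g_order : forall n, g n != 0 -> (3 <= nu - d * n + n)%N.

Let A n : {poly C} :=
  g n *: 'X^(nu - d * n) - f n *: (p1 * 'X^(nu - (d * n + d.-1))).
Let B n : {poly C} := (gb n)%:P - fb n *: q.

Hypothesis QE :
  \sum_(n < nu.+1) ((A n)%:P * 'X^n + (B n)%:P * (c%:P - 'X) ^+ n) = 0.

Let cn0 : c != 0. Proof. by rewrite -size_poly_eq0 size_c. Qed.
Let p1n0 : p1 != 0. Proof. by rewrite -size_poly_eq0 size_p1 -lt0n. Qed.

Let f_out n : (nu < n)%N -> f n = 0.
Proof.
move=> h; apply/eqP; apply: contraLR h => /f_dom h; rewrite -leqNgt.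
by apply: leq_trans h; apply: leq_trans (leq_addr _ _); rewrite leq_pmull //; lia.
Qed.

Let g_out n : (nu < n)%N -> g n = 0.
Proof.
move=> h; apply/eqP; apply: contraLR h => /g_dom h; rewrite -leqNgt.
by apply: leq_trans h; rewrite leq_pmull //; lia.
Qed.

Let fb_0 n : f n = 0 -> fb n = 0.
Proof. by move=> e; apply/eqP; rewrite fb0 e. Qed.
Let gb_0 n : g n = 0 -> gb n = 0.
Proof. by move=> e; apply/eqP; rewrite gb0 e. Qed.
Let A_0 n : f n = 0 -> g n = 0 -> A n = 0.
Proof. by move=> e e'; rewrite /A e e' !scale0r subrr. Qed.
Let B_0 n : f n = 0 -> g n = 0 -> B n = 0.
Proof. by move=> e e'; rewrite /B fb_0 ?gb_0 // scale0r subrr. Qed.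

Let coefQ j : (j <= nu)%N -> A j + \sum_(n < nu.+1)
  B n * ((-1) ^+ j * c ^+ (n - j) *+ 'C(n, j)) = 0.
Proof.
move=> jn; have := congr1 (fun P : {poly {poly C}} => P`_j) QE.
rewrite coef0 coef_sum.
under eq_bigr do rewrite coefD !coefCM coefXn coef_subX_exp.
rewrite big_split /=; move=> h; rewrite -[RHS]h; congr (_ + _).
rewrite (bigD1 (Ordinal (jn : (j < nu.+1)%N))) //= eqxx mulr1 big1 ?addr0 // => i.
by rewrite -val_eqE /= eq_sym => /negPf ->; rewrite mulr0.
Qed.

(** Since c and q vanish at 0, only the term of index j survives in the sum
    over n. *)
Let coefQ0 j : (j <= nu)%N -> (A j).[0] + gb j * (-1) ^+ j = 0.
Proof.
move=> jn; have := congr1 (fun P : {poly C} => P.[0]) (coefQ jn).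
rewrite horner0 hornerD horner_sum => h; rewrite -[RHS]h; congr (_ + _).
rewrite (bigD1 (Ordinal (jn : (j < nu.+1)%N))) //= big1 ?addr0.
  rewrite subnn binn mulr1n expr0 mulr1 /B hornerM !hornerE q0 mulr0 subr0.
  by rewrite ?horner_exp ?hornerN ?hornerC.
move=> i; rewrite -val_eqE /= => ij; rewrite hornerM hornerMn.
case: (ltngtP i j) ij => // ij _; first by rewrite bin_small // mulr0n mulr0.
by rewrite hornerM (horner_exp c) c0 expr0n subn_eq0 leqNgt ij /= mulr0 mul0rn mulr0.
Qed.

(** At 0 both terms of A j vanish, unless one of their exponents is 0. *)
Let g_kill j : (nu != d * j)%N -> (nu != d * j + d.-1)%N -> g j = 0.
Proof.
move=> h1 h2; case: (leqP j nu) => [jn|/g_out //].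
apply/eqP; rewrite -gb0; apply/eqP.
have := coefQ0 jn; rewrite /A hornerD hornerN !hornerZ hornerM !hornerXn.
have -> : g j * 0 ^+ (nu - d * j) = 0.
  have [->|/eqP/g_dom h] := g j =P 0; first by rewrite mul0r.
  by rewrite expr0n subn_eq0 leqNgt ltn_neqAle eq_sym h1 h mulr0.
have -> : f j * (p1.[0] * 0 ^+ (nu - (d * j + d.-1))) = 0.
  have [->|/eqP/f_dom h] := f j =P 0; first by rewrite mul0r.
  by rewrite expr0n subn_eq0 leqNgt ltn_neqAle eq_sym h2 h !mulr0.
rewrite subrr add0r => /eqP; rewrite mulf_eq0 signr_eq0 orbF => /eqP ->.
by [].
Qed.

(** The polynomial A j has size exactly k0 + (nu - (d j + d - 1)) when f j is
    not 0; the two assumptions make every other term of [coefQ] smaller. *)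
Let low_kill j : g j = 0 ->
  (forall n, (j <= n)%N -> f n != 0 ->
     ((n - j) * k0 + 1 < nu - (d * j + d.-1))%N) ->
  (forall n, (j < n)%N -> g n != 0 ->
     ((n - j) * k0 + 1 < nu - (d * j + d.-1) + k0)%N) ->
  f j = 0.
Proof.
move=> gj0 hf hg; apply/eqP/negP => /negP fj.
have jn : (j <= nu)%N.
  by rewrite leqNgt; apply: contra fj => /f_out ->.
have := coefQ jn; rewrite /A gj0 scale0r add0r => /eqP.
rewrite addrC subr_eq0 => /eqP /(congr1 (fun P : {poly C} => size P)).
have fjn := hf _ (leqnn j) fj; rewrite subnn mul0n in fjn.
rewrite size_scale // size_Mmonic ?monicXn // size_polyXn size_p1 => E.
have : (size (\sum_(n < nu.+1) B n * ((-1) ^+ j * c ^+ (n - j) *+ 'C(n, j)))%R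
   <= (k0 + (nu - (d * j + d.-1)).+1).-2)%N.
  apply: leq_trans (size_sum _ _ _) _; apply/bigmax_leqP => n _.
  case: (ltnP n j) => nj; first by rewrite bin_small // mulr0n mulr0 size_poly0.
  have scn : (size ((-1) ^+ j * c ^+ (n - j) *+ 'C(n, j))%R <= ((n - j) * k0).+1)%N.
    rewrite -scaler_nat; apply: leq_trans (size_scale_leq _ _) _.
    rewrite -(rmorph_sign (@polyC C)) mul_polyC; apply: leq_trans (size_scale_leq _ _) _.
    by apply: leq_trans (size_poly_exp_leq _ _) _; rewrite size_c mulnC.
  have := hf n nj.
  have := hg n; set a := (nu - _)%N in fjn *.
  rewrite /B; have [fn0|/eqP fn] := f n =P 0.
    rewrite fb_0 // scale0r subr0 mul_polyC.
    have [gn0|/eqP gn] := g n =P 0.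
      by rewrite gb_0 // scale0r size_poly0.
    move=> h _; apply: leq_trans (size_scale_leq _ _) _; apply: leq_trans scn _.
    have jn' : (j < n)%N.
      by rewrite ltn_neqAle nj andbT; apply: contraNneq gn => <-; rewrite gj0.
    by have := h jn' isT; lia.
  move=> _ /(_ isT) h; apply: leq_trans (size_polyMleq _ _) _.
  have : (size ((gb n)%:P - fb n *: q)%R <= k0.+1)%N.
    apply: leq_trans (size_polyD _ _) _; rewrite geq_max size_polyN.
    rewrite (leq_trans (size_polyC_leq1 _)) //=.
    by apply: leq_trans (size_scale_leq _ _) _.
  move: scn h; clear; move: (size _) (size _) ((n - j) * k0)%N => x y z; lia.
rewrite E; lia.
Qed.

Let two_terms N : (N < nu)%N ->
    (forall n, n != N -> n != N.+1 -> f n = 0 /\ g n = 0) ->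
  (A N.+1)%:P * 'X^(N.+1) + (B N.+1)%:P * (c%:P - 'X) ^+ N.+1
  + ((A N)%:P * 'X^N + (B N)%:P * (c%:P - 'X) ^+ N) = 0.
Proof.
move=> Nnu fg; rewrite -[RHS]QE.
rewrite (bigD1 (Ordinal (Nnu : (N.+1 < nu.+1)%N))) //=; congr (_ + _).
rewrite (bigD1 (Ordinal (leqW Nnu))) /=; last by rewrite -val_eqE /= ltn_eqF.
rewrite big1 ?addr0 // => i; rewrite -!val_eqE /= => /andP[h1 h2].
by have [h3 h4] := fg i h2 h1; rewrite A_0 ?B_0 // !polyC0 !mul0r addr0.
Qed.

(** When only two consecutive indices are left, X = 0 and X = c each cancel
    one of the two families of powers. *)
Let two_eval N : (N < nu)%N -> (0 < N)%N ->
    (forall n, n != N -> n != N.+1 -> f n = 0 /\ g n = 0) ->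
  A N = - (A N.+1 * c) /\ B N = - (B N.+1 * c).
Proof.
move=> Nnu N0 fg; have H := two_terms Nnu fg.
have /(congr1 (fun P : {poly {poly C}} => P.[c])) := H.
rewrite !(hornerD, hornerM, hornerXn, hornerC, horner_exp, hornerN, hornerX, horner0).
have /(congr1 (fun P : {poly {poly C}} => P.[0])) := H.
rewrite !(hornerD, hornerM, hornerXn, hornerC, horner_exp, hornerN, hornerX, horner0).
rewrite subrr subr0 !expr0n /= (gtn_eqF N0) !mulr0 !add0r !addr0.
rewrite !exprS !mulrA -!mulrDl => /eqP h1 /eqP h2; move: h1 h2.
rewrite !mulf_eq0 !expf_eq0 !(negPf cn0) !andbF !orbF !addr_eq0.
by move=> /eqP -> /eqP ->; rewrite !opprK.
Qed.

(** The exponents of X in weight nu depend on the residue of nu modulo d.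
    If d divides neither nu nor nu + 1, then [g_kill] and [low_kill] suffice.
    Otherwise two consecutive indices survive these lemmas and [two_eval] has
    to be used; the order conditions are needed when these indices are
    small. *)
Lemma power_identity_coefs_eq0 : forall n, f n = 0 /\ g n = 0.
Proof.
have [e dE] : exists e, d = (k0 + e.+1)%N by exists (d - k0).-1; lia.
(* nu = d N: the indices left are N for g and N - 1 for f. *)
case: (boolP (d %| nu)%N) => [/dvdnP[N nuE]|ndvd].
  have gk j : j != N -> g j = 0.
    move=> jN; apply: g_kill; rewrite nuE mulnC; first by rewrite eqn_pmul2l; [rewrite eq_sym|lia].
    apply/eqP => /(congr1 (fun x => x %% d)%N); rewrite modnMr mulnC modnMDl modn_small; lia.
  have fN n : f n != 0 -> exists t, N = (n + t.+1)%N.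
    move=> /f_dom; rewrite nuE mulnC => h; exists (N - n).-1.
    suff : (n < N)%N by lia.
    by rewrite ltnNge; apply/negP => /(leq_mul (leqnn d)); lia.
  have fk j : (j.+1 != N)%N -> f j = 0.
    move=> jN; have [->//|/eqP fj] := f j =P 0.
    have [s sE] := fN _ fj.
    apply: low_kill; first by apply: gk; lia.
      move=> n jn fn; have [t tE] := fN _ fn.
      have [m nE] : exists m, n = (j + m)%N by exists (n - j)%N; lia.
      by rewrite nuE tE nE dE; case: m nE => [|m] nE; nia.
    move=> n jn gn; have {gn} En : n = N by apply/eqP; apply: contraNT gn => /gk ->.
    rewrite nuE En sE dE; case: s sE => [|s] sE; nia.
  (* For N < 3 these monomials, w^N and z w^(N-1), have degree at most 2. *)
  have [N3|N3] := ltnP N 3.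
    have gN : g N = 0.
      by have [//|/eqP/g_order] := g N =P 0; rewrite nuE mulnC subnn; lia.
    have fN1 n : N = n.+1 -> f n = 0.
      move=> NE; have [//|/eqP/f_order] := f n =P 0.
      by rewrite nuE NE mulnC mulnS; lia.
    move=> n; split.
      by have [/esym/fN1|/eqP/fk] := n.+1 =P N.
    by have [->|/eqP/gk] := n =P N.
  (* The two relations of [two_eval] make X (c - X) a factor of the identity; X = c
     in the quotient kills A N, hence g N, then A (N - 1) = - A N * c kills f (N - 1). *)
  have [M NE] : exists M, N = M.+3 by exists (N - 3)%N; lia.
  have fg n : n != M.+2 -> n != M.+3 -> f n = 0 /\ g n = 0.
    by move=> h1 h2; split; [apply: fk; rewrite NE|apply: gk; rewrite NE].
  have lnu : (M.+2 < nu)%N by rewrite nuE NE; nia.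
  have [EA EB] := two_eval lnu isT fg.
  have := two_terms lnu fg; rewrite EA EB => H.
  have {}H : 'X * (c%:P - 'X) *
      ((A M.+3)%:P * 'X^(M.+1) + (B M.+3)%:P * (c%:P - 'X) ^+ M.+1) = 0.
    by rewrite -[RHS]oppr0 -[in RHS]H !polyCN !polyCM !exprS; ring.
  have {}H : (A M.+3)%:P * 'X^(M.+1) + (B M.+3)%:P * (c%:P - 'X) ^+ M.+1 = 0.
    apply/eqP; move/eqP: H; rewrite !mulf_eq0 polyX_eq0 /= orbC.
    by rewrite -opprB oppr_eq0 polyXsubC_eq0 orbF.
  have /(congr1 (fun P : {poly {poly C}} => P.[c])) := H.
  rewrite !(hornerD, hornerM, hornerXn, hornerC, horner_exp, hornerN, hornerX, horner0).
  rewrite subrr expr0n mulr0 addr0 => /eqP; rewrite mulf_eq0 expf_eq0 (negPf cn0) orbF => /eqP AN.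
  have f3 : f M.+3 = 0 by apply: fk; lia.
  have g3 : g M.+3 = 0.
    move: AN; rewrite /A f3 scale0r subr0 => /eqP.
    by rewrite scale_poly_eq0 (negPf (monic_neq0 (monicXn _ _))) orbF => /eqP.
  have g2 : g M.+2 = 0 by apply: gk; lia.
  have f2 : f M.+2 = 0.
    move: EA; rewrite AN mul0r oppr0 /A g2 scale0r sub0r => /eqP.
    rewrite oppr_eq0 scale_poly_eq0 mulf_eq0 (negPf p1n0).
    by rewrite (negPf (monic_neq0 (monicXn _ _))) !orbF => /eqP.
  move=> n; have [->|/eqP n2] := n =P M.+2; first by rewrite f2 g2.
  by have [->|/eqP n3] := n =P M.+3; [rewrite f3 g3|apply: fg].
(* nu = d N + d - 1: the indices left are N for g, and N and N - 1 for f. *)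
case: (boolP (d %| nu.+1)%N) => [/dvdnP[[|N] //]|ndvd1].
  rewrite mulSn addnC mulnC => nuE'; have {nuE'} nuE : nu = (d * N + d.-1)%N by lia.
  have gk j : j != N -> g j = 0.
    move=> jN; apply: g_kill; rewrite nuE; last by rewrite eqn_add2r eqn_pmul2l; [rewrite eq_sym|lia].
    apply/eqP => /(congr1 (fun x => x %% d)%N); rewrite modnMr mulnC modnMDl modn_small; lia.
  have fN n : f n != 0 -> exists t, N = (n + t)%N.
    move=> /f_dom; rewrite nuE leq_add2r leq_pmul2l; last lia.
    by move=> h; exists (N - n)%N; lia.
  have fk j : (j != N)%N -> (j.+1 != N)%N -> f j = 0.
    move=> jN0 jN; have [->//|/eqP fj] := f j =P 0.
    have [s sE] := fN _ fj.
    have [s' ss'] : exists s', s = s'.+2 by exists (s - 2)%N; lia.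
    subst s.
    apply: low_kill; first by apply: gk; lia.
      move=> n jn fn; have [t tE] := fN _ fn.
      have [m nE] : exists m, n = (j + m)%N by exists (n - j)%N; lia.
      rewrite nuE tE nE dE; case: m nE => [|[|m]] nE; [|case: t tE => [|t] tE|]; nia.
    move=> n jn gn; have {gn} En : n = N by apply/eqP; apply: contraNT gn => /gk ->.
    rewrite nuE En sE dE; nia.
  have fN0 : f N = 0.
    have [N3|N3] := ltnP N 3.
      by have [//|/eqP/f_order] := f N =P 0; rewrite nuE subnn; lia.
    have [M NE] : exists M, N = M.+3 by exists (N - 3)%N; lia.
    have fg n : n != M.+2 -> n != M.+3 -> f n = 0 /\ g n = 0.
      by move=> h1 h2; split; [apply: fk; rewrite NE|apply: gk; rewrite NE].
    have lnu : (M.+2 < nu)%N by rewrite nuE NE; nia.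
    have [_ EB] := two_eval lnu isT fg.
    have g2 : g M.+2 = 0 by apply: gk; lia.
    move: EB; rewrite /B -NE gb_0 // sub0r => /eqP; rewrite eqr_opp => /eqP EB.
    (* q is not constant and divides a multiple of c, so the cofactor has a smaller
       degree than c, which forces fb N = 0. *)
    have {}EB : gb N *: c = (fb M.+2 *: 1 + fb N *: c) * q.
      have := congr1 (fun x => x + fb N *: q * c) EB.
      rewrite mulrBl subrK mul_polyC => <-.
      by rewrite mulrDl -!scalerAl mul1r [q * c]mulrC.
    have [//|/eqP fn] := f N =P 0; exfalso.
    have sfc : size (fb M.+2 *: 1 + fb N *: c) = k0.+1.
      have sN : size (fb N *: c) = k0.+1 by rewrite size_scale ?fb0.
      rewrite addrC size_polyDl sN //.
      by rewrite (leq_ltn_trans (size_scale_leq _ _)) // size_poly1.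
    have fcn0 : fb M.+2 *: 1 + fb N *: c != 0 by rewrite -size_poly_eq0 sfc.
    have sq : (1 < size q)%N.
      rewrite ltnNge; apply/negP => /size1_polyC qE; move: q0 q_neq0.
      by rewrite qE hornerC => ->; rewrite eqxx.
    have := size_mul fcn0 q_neq0; rewrite -EB sfc => h.
    have := size_scale_leq (gb N) c; by rewrite h size_c; move: sq k0_gt0; clear; move: (size q) => x; lia.
  have gN0 : g N = 0.
    have Nnu : (N <= nu)%N by rewrite nuE; nia.
    have := coefQ0 Nnu; rewrite /A fN0 scale0r subr0 hornerZ hornerXn expr0n nuE.
    rewrite addKn (_ : d.-1 == 0 = false)%N; last lia.
    rewrite mulr0 add0r => /eqP; rewrite mulf_eq0 signr_eq0 orbF gb0 => /eqP //.
  have g0 n : g n = 0 by have [->|/eqP/gk] := n =P N.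
  have f0 j : f j = 0.
    have [->//|/eqP jN] := j =P N; have [jN1|/eqP jN1] := j.+1 =P N; last exact: fk.
    apply: low_kill => // n jn; last by rewrite g0 eqxx.
    have [->|/eqP nN] := n =P N; first by rewrite fN0 eqxx.
    have [nj|/eqP nN1] := n.+1 =P N; last by rewrite fk ?eqxx.
    have -> : n = j by lia.
    move=> _; rewrite nuE subnn -jN1 mulnS; lia.
  by [].
(* d divides neither nu nor nu + 1. *)
have g0 j : g j = 0.
  apply: g_kill; first by apply: contra ndvd => /eqP ->; rewrite dvdn_mulr.
  apply: contra ndvd1 => /eqP ->; rewrite -addnS prednK ?dvdn_addr ?dvdn_mulr //; lia.
move=> j; split => //; apply: low_kill => // n jn; last by rewrite g0 eqxx.
move=> /f_dom h.
have h1 : (nu != d * n + d.-1)%N.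
  apply: contra ndvd1 => /eqP ->; rewrite -addnS prednK ?dvdn_addr ?dvdn_mulr //; lia.
have h2 : (nu != d * n + d)%N.
  by apply: contra ndvd => /eqP ->; rewrite dvdn_addr ?dvdn_mulr.
have [m nE] : exists m, n = (j + m)%N by exists (n - j)%N; lia.
subst n; rewrite addKn.
have : (d * j + d.-1 + d * m + 2 <= nu)%N by move: h h1 h2; rewrite mulnDr; lia.
have : (m * k0 <= d * m)%N by rewrite mulnC leq_mul // ltnW.
lia.
Qed.
End Vanish.

(** * Integrals of continuous functions over segments *)

Section RealIntegral.
Context {R : realType}.
Notation mu := (@lebesgue_measure R).
Implicit Types (f g : R -> R) (a b c t : R).

Definition rint f a b : R := \int[mu]_(t in `[a, b]) f t.

Definition cont_on f a b := forall t, a <= t <= b -> {for t, continuous f}.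

Lemma cont_on_integrable f a b : cont_on f a b -> mu.-integrable `[a, b] (EFin \o f).
Proof.
move=> cf; apply: continuous_compact_integrable; first exact: segment_compact.
by apply: continuous_in_subspaceT => t; rewrite inE /= in_itv /=; exact: cf.
Qed.

Lemma cont_onS f a b a' b' : a <= a' -> b' <= b -> cont_on f a b -> cont_on f a' b'.
Proof. by move=> aa bb cf t /andP[h1 h2]; apply: cf; rewrite (le_trans aa h1) (le_trans h2 bb). Qed.

Lemma eq_rint f g a b : (forall t, a <= t <= b -> f t = g t) -> rint f a b = rint g a b.
Proof.
move=> fg; apply: eq_Rintegral => t; rewrite inE /= in_itv /=; exact: fg.
Qed.

Lemma rintD f g a b : cont_on f a b -> cont_on g a b ->
  rint (fun t => f t + g t) a b = rint f a b + rint g a b.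
Proof. by move=> cf cg; rewrite /rint RintegralD //; exact: cont_on_integrable. Qed.

Lemma rintZ k f a b : cont_on f a b ->
  rint (fun t => k * f t) a b = k * rint f a b.
Proof. by move=> cf; rewrite /rint RintegralZl //; exact: cont_on_integrable. Qed.

Lemma rint_cst k a b : a <= b -> rint (fun=> k) a b = k * (b - a).
Proof.
move=> ab; rewrite /rint Rintegral_cst //= lebesgue_measure_itv /= lte_fin.
by case: ltgtP ab => // -> _; rewrite subrr.
Qed.

Lemma rint_split f a c b : a <= c -> c <= b -> cont_on f a b ->
  rint f a b = rint f a c + rint f c b.
Proof.
move=> ac cb cf.
have icb : mu.-integrable `]c, b] (EFin \o f).
  apply: (integrableS _ _ _ (cont_on_integrable (cont_onS ac (lexx b) cf))) => //.
  by apply: subset_itvr; rewrite bnd_simp.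
rewrite /rint -(Rintegral_itv_obnd_cbnd icb).
rewrite -(@Rintegral_itvB _ f (BLeft a) (BRight b) c) ?bnd_simp //.
  by rewrite addrC subrK.
exact: cont_on_integrable.
Qed.

Lemma le_rint f g a b : cont_on f a b -> cont_on g a b ->
  (forall t, a <= t <= b -> f t <= g t) -> rint f a b <= rint g a b.
Proof.
move=> cf cg fg; apply: le_Rintegral => //; exact: cont_on_integrable.
Qed.

Lemma cont_on_cst k a b : cont_on (fun=> k) a b.
Proof. by move=> t _; exact: cst_continuous. Qed.

Lemma rint_bound f a b M : a <= b -> cont_on f a b ->
  (forall t, a <= t <= b -> `|f t| <= M) -> `|rint f a b| <= M * (b - a).
Proof.
move=> ab cf fM; rewrite ler_norml -mulNr -!rint_cst //.
have cc k : cont_on (fun=> k) a b by exact: cont_on_cst.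
apply/andP; split; apply: le_rint => // t /fM; rewrite ler_norml => /andP[] //.
Qed.

(** Translates explicit estimates, the form in which all derivatives are
    handled below, into the derivative for which the fundamental theorem of
    calculus is stated. *)
Lemma is_derive1_eps f t (l : R) :
  (forall e, 0 < e -> exists2 d, 0 < d & forall h, `|h| < d ->
      `|f (t + h) - f t - h * l| <= e * `|h|) -> is_derive t 1 f l.
Proof.
move=> H.
have C : (fun h => h^-1 *: (f (h *: 1 + t) - f t)) @ 0^' --> l.
  apply/cvgrPdist_le => e e0; have [d d0 dP] := H e e0.
  near=> h.
  have h0 : h != 0 by near: h; exact: nbhs_dnbhs_neq.
  have hd : `|h| < d by near: h; apply: dnbhs0_lt.
  have {dP} dP := dP h hd; rewrite distrC /GRing.scale /= mulr1 [h + t]addrC.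
  have -> : h^-1 * (f (t + h) - f t) - l = h^-1 * (f (t + h) - f t - h * l).
    by rewrite [RHS]mulrBr mulrA mulVf // mul1r.
  by rewrite normrM normfV mulrC ler_pdivrMr ?normr_gt0.
apply: DeriveDef; first by apply/cvg_ex; exists l.
exact/cvg_lim.
Unshelve. all: by end_near. Qed.

Lemma rint_FTC F f a b : a <= b -> cont_on f a b ->
  (forall t, a <= t <= b -> is_derive t 1 F (f t)) ->
  rint f a b = F b - F a.
Proof.
rewrite le_eqVlt => /predU1P[->|ab] cf dF.
  by rewrite /rint set_itv1 Rintegral_set1 subrr.
have cF : cont_on F a b.
  move=> t /dF Ft; apply: differentiable_continuous; apply/derivable1_diffP.
  exact: (@ex_derive _ _ _ _ _ _ _ Ft).
rewrite /rint /Rintegral (@continuous_FTC2 _ f F a b) //.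
- by apply: continuous_in_subspaceT => t; rewrite inE /= in_itv /=; exact: cf.
- split.
  + move=> t; rewrite in_itv /= => /andP[t1 t2].
    have := dF t; rewrite (ltW t1) (ltW t2) => /(_ isT) Ft.
    exact: (@ex_derive _ _ _ _ _ _ _ Ft).
  + by apply: cvg_at_right_filter; apply: cF; rewrite lexx ltW.
  + by apply: cvg_at_left_filter; apply: cF; rewrite lexx ltW.
- move=> t; rewrite in_itv /= => /andP[t1 t2].
  have := dF t; rewrite (ltW t1) (ltW t2) => /(_ isT) Ft.
  by rewrite derive1E; exact: derive_val.
Qed.

End RealIntegral.

(** * Modulus, complex derivatives and path integrals *)

Section NormC.
Context {R : realType}.
Implicit Types z w : R[i].

Lemma normcD z w : normc (z + w) <= normc z + normc w.
Proof. exact: le_normcD. Qed.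

Lemma normcN z : normc (- z) = normc z.
Proof. exact: complex.normcN. Qed.

Lemma normc_ge0 z : 0 <= normc z.
Proof. by case: z => x y /=; rewrite sqrtr_ge0. Qed.

Lemma Re_add z w : complex.Re (z + w) = complex.Re z + complex.Re w.
Proof. by case: z w => ? ? []. Qed.
Lemma Im_add z w : complex.Im (z + w) = complex.Im z + complex.Im w.
Proof. by case: z w => ? ? []. Qed.
Lemma Re_opp z : complex.Re (- z) = - complex.Re z. Proof. by case: z. Qed.
Lemma Im_opp z : complex.Im (- z) = - complex.Im z. Proof. by case: z. Qed.
Lemma Re_sub z w : complex.Re (z - w) = complex.Re z - complex.Re w.
Proof. by rewrite Re_add Re_opp. Qed.
Lemma Im_sub z w : complex.Im (z - w) = complex.Im z - complex.Im w.
Proof. by rewrite Im_add Im_opp. Qed.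
Lemma Re_mul z w : complex.Re (z * w) =
  complex.Re z * complex.Re w - complex.Im z * complex.Im w.
Proof. by case: z w => ? ? []. Qed.
Lemma Im_mul z w : complex.Im (z * w) =
  complex.Re z * complex.Im w + complex.Im z * complex.Re w.
Proof. by case: z w => ? ? []. Qed.

Lemma Re_le_normc z : `|complex.Re z| <= normc z.
Proof.
case: z => x y /=; rewrite -sqrtr_sqr ler_sqrt ?lerDl ?sqr_ge0 //.
by rewrite addr_ge0 ?sqr_ge0.
Qed.

Lemma Im_le_normc z : `|complex.Im z| <= normc z.
Proof.
case: z => x y /=; rewrite -sqrtr_sqr ler_sqrt ?lerDr ?sqr_ge0 //.
by rewrite addr_ge0 ?sqr_ge0.
Qed.

Lemma normc_real (x : R) : normc x%:C = `|x|.
Proof. by rewrite /= expr0n addr0 sqrtr_sqr. Qed.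

Lemma normc_im (y : R) : normc (0 +i* y) = `|y|.
Proof. by rewrite /= expr0n add0r sqrtr_sqr. Qed.

Lemma normc_i : normc ('i : R[i]) = 1.
Proof. by rewrite normc_im normr1. Qed.

Lemma normc_le_ReIm z : normc z <= `|complex.Re z| + `|complex.Im z|.
Proof.
have -> : z = (complex.Re z)%:C + (0 +i* complex.Im z).
  by case: z => x y; rewrite /= /real_complex_def /GRing.add /= addr0 add0r.
by rewrite (le_trans (normcD _ _)) // normc_real normc_im !Re_add !Im_add /= addr0 add0r.
Qed.

Lemma normc_eq0 z : (normc z == 0) = (z == 0).
Proof. by apply/eqP/eqP => [/eq0_normc //|->]; rewrite normc0. Qed.

Lemma normc_gt0 z : (0 < normc z) = (z != 0).
Proof. by rewrite lt_def normc_ge0 andbT normc_eq0. Qed.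

Lemma normcX z n : normc (z ^+ n) = normc z ^+ n.
Proof. by elim: n => [|n IH]; rewrite ?expr0 ?normc1 // !exprS normcM IH. Qed.

Lemma normcB z w : normc (z - w) = normc (w - z).
Proof. by rewrite -normcN opprB. Qed.

Lemma normc_sum I (r : seq I) (P : pred I) (F : I -> R[i]) :
  normc (\sum_(i <- r | P i) F i) <= \sum_(i <- r | P i) normc (F i).
Proof.
elim/big_rec2: _ => [|i y x _ IH]; first by rewrite normc0.
by rewrite (le_trans (normcD _ _)) // lerD2l.
Qed.

Lemma normc_conj z : normc (conjc z) = normc z.
Proof. by case: z => x y /=; rewrite sqrrN. Qed.

Lemma normcBD z w : normc z <= normc w + normc (z - w).
Proof. by rewrite -{1}(subrK w z) addrC normcD. Qed.

End NormC.

Section ComplexIntegral.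
Context {R : realType}.
Implicit Types (phi psi : R -> R[i]) (f : R[i] -> R[i]) (a b t : R) (z l : R[i]).

(** Continuity and differentiability are spelled out with the real number
    [normc z], because the norm of the normed module [R[i]] takes its values in
    [R[i]], which is only partially ordered. *)
Definition pcont phi t := forall e : R, 0 < e ->
  exists2 d, 0 < d & forall h : R, `|h| < d -> normc (phi (t + h) - phi t) < e.

Definition ccont f z := forall e : R, 0 < e ->
  exists2 d, 0 < d & forall h, normc h < d -> normc (f (z + h) - f z) < e.

Definition cdiff f z l := forall e : R, 0 < e ->
  exists2 d, 0 < d &
    forall h, normc h < d -> normc (f (z + h) - f z - l * h) <= e * normc h.

Definition pcont_on phi a b := forall t, a <= t <= b -> pcont phi t.

Lemma pcont_Re phi t : pcont phi t -> {for t, continuous (fun t => complex.Re (phi t))}.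
Proof.
move=> H; apply/cvgrPdist_lt => e e0; have [d d0 dP] := H e e0.
near=> u; rewrite distrC -Re_sub (le_lt_trans (Re_le_normc _)) //.
have := dP (u - t); rewrite [t + _]addrC subrK; apply; rewrite distrC.
by near: u; apply: cvgr_dist_lt => //; exact: cvg_id.
Unshelve. all: by end_near. Qed.

Lemma pcont_Im phi t : pcont phi t -> {for t, continuous (fun t => complex.Im (phi t))}.
Proof.
move=> H; apply/cvgrPdist_lt => e e0; have [d d0 dP] := H e e0.
near=> u; rewrite distrC -Im_sub (le_lt_trans (Im_le_normc _)) //.
have := dP (u - t); rewrite [t + _]addrC subrK; apply; rewrite distrC.
by near: u; apply: cvgr_dist_lt => //; exact: cvg_id.
Unshelve. all: by end_near. Qed.

Lemma pcontZ k phi t : pcont phi t -> pcont (fun t => k * phi t) t.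
Proof.
move=> H e e0; have K0 : 0 < normc k + 1 by rewrite ltr_wpDl // normc_ge0.
have [d d0 dP] := H _ (divr_gt0 e0 K0); exists d => // h /dP.
rewrite -mulrBr normcM ltr_pdivlMr // => he.
have := normc_ge0 (phi (t + h) - phi t); have := normc_ge0 k; nra.
Qed.

Definition cint phi a b : R[i] :=
  rint (fun t => complex.Re (phi t)) a b +i* rint (fun t => complex.Im (phi t)) a b.

Let cont_Re phi a b : pcont_on phi a b -> cont_on (fun t => complex.Re (phi t)) a b.
Proof. by move=> h t /h; exact: pcont_Re. Qed.
Let cont_Im phi a b : pcont_on phi a b -> cont_on (fun t => complex.Im (phi t)) a b.
Proof. by move=> h t /h; exact: pcont_Im. Qed.

Lemma eq_cint phi psi a b : (forall t, a <= t <= b -> phi t = psi t) -> cint phi a b = cint psi a b.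
Proof. by move=> h; congr (_ +i* _); apply: eq_rint => t /h ->. Qed.

Lemma cintD phi psi a b : pcont_on phi a b -> pcont_on psi a b ->
  cint (fun t => phi t + psi t) a b = cint phi a b + cint psi a b.
Proof.
move=> h1 h2; rewrite /cint {3}/GRing.add /=; congr (_ +i* _).
  rewrite -rintD; [|exact: cont_Re|exact: cont_Re].
  by apply: eq_rint => t _; rewrite Re_add.
rewrite -rintD; [|exact: cont_Im|exact: cont_Im].
by apply: eq_rint => t _; rewrite Im_add.
Qed.

Lemma cintZ k phi a b : pcont_on phi a b ->
  cint (fun t => k * phi t) a b = k * cint phi a b.
Proof.
move=> h; have hR := cont_Re h; have hI := cont_Im h.
have cM c g : cont_on g a b -> cont_on (fun t => c * g t) a b.
  by move=> cg t /cg gt; apply: cvgM => //; exact: cvg_cst.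
apply/eqP; rewrite eq_complex /= Re_mul Im_mul /= -mulNr -!rintZ //.
rewrite -!rintD; try exact: cM.
by apply/andP; split; apply/eqP; apply: eq_rint => t _;
  rewrite ?Re_mul ?Im_mul // mulNr.
Qed.

Lemma cint_split phi a c b : a <= c -> c <= b -> pcont_on phi a b ->
  cint phi a b = cint phi a c + cint phi c b.
Proof.
move=> ac cb h; rewrite /cint (rint_split ac cb (cont_Re h)).
by rewrite (rint_split ac cb (cont_Im h)).
Qed.

(** The factor 2 comes from estimating the real and the imaginary part
    separately. *)
Lemma cint_bound phi a b M : a <= b -> pcont_on phi a b ->
  (forall t, a <= t <= b -> normc (phi t) <= M) ->
  normc (cint phi a b) <= 2 * M * (b - a).
Proof.
move=> ab h hM; apply: le_trans (normc_le_ReIm _) _; rewrite /=.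
have -> : 2 * M * (b - a) = M * (b - a) + M * (b - a) by ring.
apply: lerD; apply: rint_bound => //.
- exact: cont_Re.
- by move=> t /hM; exact/le_trans/Re_le_normc.
- exact: cont_Im.
- by move=> t /hM; exact/le_trans/Im_le_normc.
Qed.

Lemma cint_FTC (F phi : R -> R[i]) a b : a <= b -> pcont_on phi a b ->
  (forall t, a <= t <= b -> forall e, 0 < e -> exists2 d, 0 < d & forall h : R,
     `|h| < d -> normc (F (t + h) - F t - h%:C * phi t) <= e * `|h|) ->
  cint phi a b = F b - F a.
Proof.
move=> ab h dF; apply/eqP; rewrite eq_complex /= Re_sub Im_sub; apply/andP; split; apply/eqP.
  apply: (@rint_FTC _ (fun t => complex.Re (F t))) => //; first exact: cont_Re.
  move=> t /dF {}dF; apply: is_derive1_eps => e /dF[d d0 dP]; exists d => // u /dP.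
  by apply: le_trans; apply: le_trans (Re_le_normc _); rewrite !Re_sub Re_mul /= mul0r subr0.
apply: (@rint_FTC _ (fun t => complex.Im (F t))) => //; first exact: cont_Im.
move=> t /dF {}dF; apply: is_derive1_eps => e /dF[d d0 dP]; exists d => // u /dP.
by apply: le_trans; apply: le_trans (Im_le_normc _); rewrite !Im_sub Im_mul /= mul0r addr0.
Qed.

End ComplexIntegral.

Section RealDifferentiability.
Context {R : realType}.
Implicit Types (f g : R[i] -> R[i]) (z A B : R[i]).

(** Differentiability over the reals; A and B are the Wirtinger
    derivatives with respect to z and to its conjugate. *)
Definition rdiff f z A B := forall e : R, 0 < e -> exists2 d, 0 < d &
  forall h, normc h < d -> normc (f (z + h) - f z - (A * h + B * conjc h)) <= e * normc h.

Lemma rdiff_cont f z A B : rdiff f z A B -> ccont f z.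
Proof.
move=> H e e0; have [d d0 dP] := H 1 ltr01.
have K0 : 0 < normc A + normc B + 1 by rewrite ltr_wpDl // addr_ge0 ?normc_ge0.
exists (Num.min d (e / (normc A + normc B + 1))); first by rewrite lt_min d0 divr_gt0.
move=> h; rewrite lt_min => /andP[hd]; rewrite ltr_pdivlMr // => he.
rewrite -(subrK (A * h + B * conjc h) (_ - _)); apply: le_lt_trans (normcD _ _) _.
have := dP h hd; have := normcD (A * h) (B * conjc h).
by rewrite !normcM normc_conj; nra.
Qed.

Lemma rdiffD f g z A B A' B' : rdiff f z A B -> rdiff g z A' B' ->
  rdiff (fun w => f w + g w) z (A + A') (B + B').
Proof.
move=> h1 h2 e e0; have e2 : 0 < e / 2 by rewrite divr_gt0.
have [d d0 dP] := h1 _ e2; have [d' d'0 d'P] := h2 _ e2.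
exists (Num.min d d'); first by rewrite lt_min d0.
move=> h; rewrite lt_min => /andP[/dP H1 /d'P H2].
have -> : f (z + h) + g (z + h) - (f z + g z) - ((A + A') * h + (B + B') * conjc h) =
  (f (z + h) - f z - (A * h + B * conjc h)) + (g (z + h) - g z - (A' * h + B' * conjc h)) by ring.
by rewrite (le_trans (normcD _ _)) // [e in leRHS]splitr mulrDl lerD.
Qed.

Lemma rdiff_cst (a z : R[i]) : rdiff (fun=> a) z 0 0.
Proof.
by move=> e e0; exists 1 => // h _; rewrite !mul0r addr0 subrr subr0 normc0 mulr_ge0 ?normc_ge0 ?ltW.
Qed.

Lemma rdiff_id z : rdiff id z 1 0.
Proof.
move=> e e0; exists 1 => // h _.
have -> : z + h - z - (1 * h + 0 * conjc h) = 0 by ring.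
by rewrite normc0 mulr_ge0 ?normc_ge0 ?ltW.
Qed.

Lemma rdiff_conj z : rdiff (@conjc R) z 0 1.
Proof.
move=> e e0; exists 1 => // h _.
have -> : conjc (z + h) - conjc z - (0 * h + 1 * conjc h) = 0 by rewrite rmorphD /=; ring.
by rewrite normc0 mulr_ge0 ?normc_ge0 ?ltW.
Qed.

Lemma rdiffM f g z A B A' B' : rdiff f z A B -> rdiff g z A' B' ->
  rdiff (fun w => f w * g w) z (A * g z + f z * A') (B * g z + f z * B').
Proof.
move=> h1 h2 e e0.
have [c c0 cP] := rdiff_cont h2 ltr01.
pose K := normc (g z) + 1; pose L := normc A + normc B + 1; pose D := normc (f z) + 1.
have K0 : 0 < K by rewrite ltr_wpDl // normc_ge0.
have L0 : 0 < L by rewrite ltr_wpDl // addr_ge0 ?normc_ge0.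
have D0 : 0 < D by rewrite ltr_wpDl // normc_ge0.
have e3 : 0 < e / 3 by rewrite divr_gt0.
have [d d0 dP] := h1 _ (divr_gt0 e3 K0).
have [d' d'0 d'P] := h2 _ (divr_gt0 e3 D0).
have [d2 d20 d2P] := rdiff_cont h2 (divr_gt0 e3 L0).
exists (Num.min (Num.min c d) (Num.min d' d2)); first by rewrite !lt_min c0 d0 d'0.
move=> h; rewrite !lt_min => /andP[/andP[/cP H1 /dP H2] /andP[/d'P H3 /d2P H4]].
have -> : f (z + h) * g (z + h) - f z * g z -
    ((A * g z + f z * A') * h + (B * g z + f z * B') * conjc h) =
  (f (z + h) - f z - (A * h + B * conjc h)) * g (z + h) + (A * h + B * conjc h) * (g (z + h) - g z) +
  f z * (g (z + h) - g z - (A' * h + B' * conjc h)) by ring.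
have G : normc (g (z + h)) <= K.
  rewrite -(subrK (g z) (g (z + h))) (le_trans (normcD _ _)) // addrC lerD2l.
  exact: ltW.
have E : e * normc h = e / 3 / K * normc h * K + L * normc h * (e / 3 / L) + D * (e / 3 / D * normc h).
  by field; rewrite !gt_eqF.
have h0 := normc_ge0 h.
rewrite E; apply: le_trans (normcD _ _) _; apply: lerD.
  apply: le_trans (normcD _ _) _; apply: lerD.
    by rewrite normcM; apply: ler_pM; rewrite ?normc_ge0.
  rewrite normcM; apply: ler_pM; rewrite ?normc_ge0 ?(ltW H4) //.
  apply: le_trans (normcD _ _) _; rewrite !normcM normc_conj -mulrDl.
  by rewrite ler_wpM2r // lerDl.
by rewrite normcM; apply: ler_pM; rewrite ?normc_ge0 // lerDl.
Qed.

Lemma rdiff_ext f g z A B A' B' : (forall w, f w = g w) -> A = A' -> B = B' ->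
  rdiff g z A' B' -> rdiff f z A B.
Proof. by move=> fg -> ->; have -> : f = g by apply/funext. Qed.

Lemma rdiff_expn n z : rdiff (fun w => w ^+ n) z (n%:R * z ^+ n.-1) 0.
Proof.
elim: n => [|n IH].
  by apply: rdiff_ext (rdiff_cst 1 z) => [w||]; rewrite ?expr0 ?mul0r.
apply: rdiff_ext (rdiffM (rdiff_id z) IH) => [w||]; rewrite ?exprS //= ?mulr0 ?mul0r ?addr0 //.
case: n {IH} => [|n]; first by rewrite expr0 mul0r mulr0 addr0.
by rewrite -[n.+2%:R]natr1 /= exprS; ring.
Qed.

Lemma rdiff_conj_expn n z : rdiff (fun w => conjc w ^+ n) z 0 (n%:R * conjc z ^+ n.-1).
Proof.
elim: n => [|n IH].
  by apply: rdiff_ext (rdiff_cst 1 z) => [w||]; rewrite ?expr0 ?mul0r.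
apply: rdiff_ext (rdiffM (rdiff_conj z) IH) => [w||]; rewrite ?exprS //= ?mulr0 ?mul0r ?addr0 //.
case: n {IH} => [|n]; first by rewrite expr0 mul0r mulr0 addr0.
by rewrite -[n.+2%:R]natr1 /= exprS; ring.
Qed.

Lemma rdiff_sum (I : Type) (r : seq I) (F : I -> R[i] -> R[i]) (A B : I -> R[i]) z :
  (forall i, rdiff (F i) z (A i) (B i)) ->
  rdiff (fun w => \sum_(i <- r) F i w) z (\sum_(i <- r) A i) (\sum_(i <- r) B i).
Proof.
move=> h; elim: r => [|i r IH].
  by apply: rdiff_ext (rdiff_cst 0 z) => [w||]; rewrite !big_nil.
by apply: rdiff_ext (rdiffD (h i) IH) => [w||]; rewrite !big_cons.
Qed.

Lemma cdiffE f z A : cdiff f z A <-> rdiff f z A 0.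
Proof.
have E h : A * h + 0 * conjc h = A * h by rewrite mul0r addr0.
by split=> H e /H[d d0 dP]; exists d => // h /dP; rewrite E.
Qed.

Lemma cdiff_cont f z A : cdiff f z A -> ccont f z.
Proof. by move=> /cdiffE; exact: rdiff_cont. Qed.

Lemma cdiff_cst (a z : R[i]) : cdiff (fun=> a) z 0.
Proof. by apply/cdiffE; exact: rdiff_cst. Qed.

Lemma cdiff_id z : cdiff id z 1.
Proof. by apply/cdiffE; exact: rdiff_id. Qed.

Lemma cdiffD f g z A B : cdiff f z A -> cdiff g z B -> cdiff (fun w => f w + g w) z (A + B).
Proof. by move=> /cdiffE hf /cdiffE hg; apply/cdiffE; have := rdiffD hf hg; rewrite addr0. Qed.

Lemma cdiffM f g z A B : cdiff f z A -> cdiff g z B ->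
  cdiff (fun w => f w * g w) z (A * g z + f z * B).
Proof.
move=> /cdiffE hf /cdiffE hg; apply/cdiffE; have := rdiffM hf hg.
by rewrite mul0r mulr0 addr0.
Qed.

End RealDifferentiability.

(** * Integrals along the boundary of a rectangle *)

Section Contour.
Context {R : realType}.
Implicit Types (f g : R[i] -> R[i]) (x y : R) (z l : R[i]).

Definition contour f x1 x2 y1 y2 : R[i] :=
  cint (fun t => f (t +i* y1)) x1 x2 - cint (fun t => f (t +i* y2)) x1 x2
  + 'i * (cint (fun t => f (x2 +i* t)) y1 y2 - cint (fun t => f (x1 +i* t)) y1 y2).

Definition ccont_rect f x1 x2 y1 y2 :=
  forall x y, x1 <= x <= x2 -> y1 <= y <= y2 -> ccont f (x +i* y).

Lemma complexDr x y h : (x + h) +i* y = (x +i* y) + h%:C.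
Proof. by rewrite /real_complex_def [RHS]/GRing.add /= addr0. Qed.

Lemma complexDi x y h : x +i* (y + h) = (x +i* y) + 'i * h%:C.
Proof. by apply/eqP; rewrite eq_complex ?Re_add ?Im_add ?Re_mul ?Im_mul /=; apply/andP; split; apply/eqP; ring. Qed.

Lemma pcont_hor f x y : ccont f (x +i* y) -> pcont (fun t => f (t +i* y)) x.
Proof.
move=> h e /h[d d0 dP]; exists d => // u ud.
by rewrite complexDr; apply: dP; rewrite normc_real.
Qed.

Lemma pcont_ver f x y : ccont f (x +i* y) -> pcont (fun t => f (x +i* t)) y.
Proof.
move=> h e /h[d d0 dP]; exists d => // u ud.
by rewrite complexDi; apply: dP; rewrite normcM normc_i mul1r normc_real.
Qed.

Lemma ccont_rect_hor f x1 x2 y1 y2 y : ccont_rect f x1 x2 y1 y2 -> y1 <= y <= y2 ->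
  pcont_on (fun t => f (t +i* y)) x1 x2.
Proof. by move=> h yy t tt; apply: pcont_hor; apply: h. Qed.

Lemma ccont_rect_ver f x1 x2 y1 y2 x : ccont_rect f x1 x2 y1 y2 -> x1 <= x <= x2 ->
  pcont_on (fun t => f (x +i* t)) y1 y2.
Proof. by move=> h xx t tt; apply: pcont_ver; apply: h. Qed.

Lemma ccont_rectS f x1 x2 y1 y2 x1' x2' y1' y2' :
  x1 <= x1' -> x2' <= x2 -> y1 <= y1' -> y2' <= y2 ->
  ccont_rect f x1 x2 y1 y2 -> ccont_rect f x1' x2' y1' y2'.
Proof.
by move=> a b c d h x y /andP[h1 h2] /andP[h3 h4]; apply: h; apply/andP; split; lra.
Qed.

Lemma contour_splitx f x1 x x2 y1 y2 : x1 <= x -> x <= x2 -> y1 <= y2 ->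
  ccont_rect f x1 x2 y1 y2 ->
  contour f x1 x2 y1 y2 = contour f x1 x y1 y2 + contour f x x2 y1 y2.
Proof.
move=> h1 h2 h3 cf; rewrite /contour.
rewrite (cint_split h1 h2 (ccont_rect_hor cf _)) ?lexx //.
rewrite (cint_split h1 h2 (ccont_rect_hor cf _)) ?h3 ?lexx //.
by ring.
Qed.

Lemma contour_splity f x1 x2 y1 y y2 : y1 <= y -> y <= y2 -> x1 <= x2 ->
  ccont_rect f x1 x2 y1 y2 ->
  contour f x1 x2 y1 y2 = contour f x1 x2 y1 y + contour f x1 x2 y y2.
Proof.
move=> h1 h2 h3 cf; rewrite /contour.
rewrite (cint_split h1 h2 (ccont_rect_ver cf _)) ?h3 ?lexx //.
rewrite (cint_split h1 h2 (ccont_rect_ver cf _)) ?lexx //.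
by ring.
Qed.

Definition on_rectangle x1 x2 y1 y2 z :=
  [/\ x1 <= complex.Re z <= x2, y1 <= complex.Im z <= y2 &
      [|| complex.Re z == x1, complex.Re z == x2, complex.Im z == y1 | complex.Im z == y2]].

Section Rectangle.
Variables (x1 x2 y1 y2 : R).
Hypotheses (x12 : x1 <= x2) (y12 : y1 <= y2).
Notation on_rect := (on_rectangle x1 x2 y1 y2).

Lemma ccont_on_rectangle f : ccont_rect f x1 x2 y1 y2 -> forall z, on_rect z -> ccont f z.
Proof. by move=> cf [x y] [/= xx yy _]; exact: cf. Qed.

Let bd_hor1 t : x1 <= t <= x2 -> on_rect (t +i* y1).
Proof. by move=> tt; split; rewrite /= ?lexx ?eqxx ?orbT. Qed.
Let bd_hor2 t : x1 <= t <= x2 -> on_rect (t +i* y2).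
Proof. by move=> tt; split; rewrite /= ?lexx ?eqxx ?orbT ?y12. Qed.
Let bd_ver1 t : y1 <= t <= y2 -> on_rect (x1 +i* t).
Proof. by move=> tt; split; rewrite /= ?lexx ?eqxx ?orbT. Qed.
Let bd_ver2 t : y1 <= t <= y2 -> on_rect (x2 +i* t).
Proof. by move=> tt; split; rewrite /= ?lexx ?eqxx ?orbT ?x12. Qed.

Let hor1 f : (forall z, on_rect z -> ccont f z) -> pcont_on (fun t => f (t +i* y1)) x1 x2.
Proof. by move=> cf t /bd_hor1/cf; exact: pcont_hor. Qed.
Let hor2 f : (forall z, on_rect z -> ccont f z) -> pcont_on (fun t => f (t +i* y2)) x1 x2.
Proof. by move=> cf t /bd_hor2/cf; exact: pcont_hor. Qed.
Let ver1 f : (forall z, on_rect z -> ccont f z) -> pcont_on (fun t => f (x1 +i* t)) y1 y2.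
Proof. by move=> cf t /bd_ver1/cf; exact: pcont_ver. Qed.
Let ver2 f : (forall z, on_rect z -> ccont f z) -> pcont_on (fun t => f (x2 +i* t)) y1 y2.
Proof. by move=> cf t /bd_ver2/cf; exact: pcont_ver. Qed.

Lemma contour_bound f M : (forall z, on_rect z -> ccont f z) ->
  (forall z, on_rect z -> normc (f z) <= M) ->
  normc (contour f x1 x2 y1 y2) <= 4 * M * ((x2 - x1) + (y2 - y1)).
Proof.
move=> cf fM.
have H1 : normc (cint (fun t => f (t +i* y1)) x1 x2) <= 2 * M * (x2 - x1).
  by apply: cint_bound => //; [exact: hor1|move=> t /bd_hor1/fM].
have H2 : normc (cint (fun t => f (t +i* y2)) x1 x2) <= 2 * M * (x2 - x1).
  by apply: cint_bound => //; [exact: hor2|move=> t /bd_hor2/fM].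
have V1 : normc (cint (fun t => f (x1 +i* t)) y1 y2) <= 2 * M * (y2 - y1).
  by apply: cint_bound => //; [exact: ver1|move=> t /bd_ver1/fM].
have V2 : normc (cint (fun t => f (x2 +i* t)) y1 y2) <= 2 * M * (y2 - y1).
  by apply: cint_bound => //; [exact: ver2|move=> t /bd_ver2/fM].
rewrite /contour (le_trans (normcD _ _)) // normcM normc_i mul1r.
have -> : 4 * M * (x2 - x1 + (y2 - y1)) =
  (2 * M * (x2 - x1) + 2 * M * (x2 - x1)) + (2 * M * (y2 - y1) + 2 * M * (y2 - y1)).
  by ring.
by apply: lerD; rewrite (le_trans (normcD _ _)) // normcN lerD.
Qed.

Lemma eq_contour f g : (forall z, on_rect z -> f z = g z) ->
  contour f x1 x2 y1 y2 = contour g x1 x2 y1 y2.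
Proof.
move=> fg; rewrite /contour; congr (_ - _ + 'i * (_ - _)); apply: eq_cint => t tt;
  by [apply/fg/bd_hor1|apply/fg/bd_hor2|apply/fg/bd_ver1|apply/fg/bd_ver2].
Qed.

Lemma contourD f g : (forall z, on_rect z -> ccont f z) -> (forall z, on_rect z -> ccont g z) ->
  contour (fun z => f z + g z) x1 x2 y1 y2 = contour f x1 x2 y1 y2 + contour g x1 x2 y1 y2.
Proof.
move=> cf cg; rewrite /contour.
rewrite (cintD (hor1 cf) (hor1 cg)) (cintD (hor2 cf) (hor2 cg)).
rewrite (cintD (ver1 cf) (ver1 cg)) (cintD (ver2 cf) (ver2 cg)).
by ring.
Qed.

Lemma contourZ k f : (forall z, on_rect z -> ccont f z) ->
  contour (fun z => k * f z) x1 x2 y1 y2 = k * contour f x1 x2 y1 y2.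
Proof.
move=> cf; rewrite /contour.
rewrite (cintZ k (hor1 cf)) (cintZ k (hor2 cf)) (cintZ k (ver1 cf)) (cintZ k (ver2 cf)).
by ring.
Qed.

(** A primitive makes the integrals over the four edges telescope. *)
Lemma contour_FTC F f : (forall z, on_rect z -> ccont f z) ->
  (forall z, on_rect z -> cdiff F z (f z)) ->
  contour f x1 x2 y1 y2 = 0.
Proof.
move=> cf dF.
have hor y : (forall t, x1 <= t <= x2 -> on_rect (t +i* y)) ->
    cint (fun t => f (t +i* y)) x1 x2 = F (x2 +i* y) - F (x1 +i* y).
  move=> hb; apply: (cint_FTC (F := fun t => F (t +i* y))) => //.
    by move=> t /hb/cf; exact: pcont_hor.
  move=> t /hb/dF dFt e e0; have [d d0 dP] := dFt e e0; exists d => // h hd.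
  by have := dP h%:C; rewrite normc_real -complexDr [h%:C * _]mulrC => /(_ hd).
have ver x : (forall t, y1 <= t <= y2 -> on_rect (x +i* t)) ->
    'i * cint (fun t => f (x +i* t)) y1 y2 = F (x +i* y2) - F (x +i* y1).
  move=> hb; rewrite -cintZ; last by move=> t /hb/cf; exact: pcont_ver.
  apply: (cint_FTC (F := fun t => F (x +i* t))) => //.
    by move=> t /hb/cf h; apply: pcontZ; exact: pcont_ver.
  move=> t /hb/dF dFt e e0; have [d d0 dP] := dFt e e0; exists d => // h hd.
  have := dP ('i * h%:C); rewrite normcM normc_i mul1r normc_real -complexDi => /(_ hd).
  by congr (normc (_ - _) <= _); ring.
by rewrite /contour mulrBr !hor // !ver //; ring.
Qed.

End Rectangle.
End Contour.

(** * Goursat theorem *)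

Section Goursat.
Context {R : realType}.
Implicit Types (f g : R[i] -> R[i]) (x y : R) (z l : R[i]).

Lemma nested_limit (u l : nat -> R) :
  (forall n m, (n <= m)%N -> u n <= u m) ->
  (forall n m, (n <= m)%N -> u m <= u n + l n) ->
  exists p, forall n, u n <= p <= u n + l n.
Proof.
move=> h1 h2.
have h n m : u m <= u n + l n.
  have [/h2//|nm] := leqP n m.
  by rewrite (le_trans (h1 m n (ltnW nm))) // h2.
have ub n : ubound (range u) (u n + l n) by move=> _ [m _ <-].
have hs : has_sup (range u) by split; [exists (u 0), 0%N|exists (u 0 + l 0)%R].
exists (sup (range u)) => n; apply/andP; split.
  by apply: sup_upper_bound => //; exists n.
by apply: ge_sup => //; exists (u 0), 0%N.
Qed.

Lemma cdiff_affine (a l p z : R[i]) : cdiff (fun w => a + l * (w - p)) z l.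
Proof.
move=> e e0; exists 1 => // h _.
have -> : a + l * (z + h - p) - (a + l * (z - p)) - l * h = 0 by ring.
by rewrite normc0 mulr_ge0 ?normc_ge0 ?ltW.
Qed.

Lemma cdiff_affine_primitive (a l p z : R[i]) :
  cdiff (fun w => a * w + l / 2 * (w - p) ^+ 2) z (a + l * (z - p)).
Proof.
move=> e e0; pose K := normc (l / 2) + 1.
have K0 : 0 < K by rewrite ltr_wpDl // normc_ge0.
exists (e / K) => [|h]; first exact: divr_gt0.
rewrite ltr_pdivlMr // => hd.
have -> : a * (z + h) + l / 2 * (z + h - p) ^+ 2 - (a * z + l / 2 * (z - p) ^+ 2) -
   (a + l * (z - p)) * h = l / 2 * h * h by field.
rewrite normcM ler_wpM2r ?normc_ge0 // normcM.
apply: le_trans (ltW hd).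
by rewrite mulrC ler_wpM2l ?normc_ge0 // lerDl.
Qed.

Section Square.
Variables (f : R[i] -> R[i]).

Lemma contour_affine (a l p : R[i]) x1 x2 y1 y2 : x1 <= x2 -> y1 <= y2 ->
  contour (fun w => a + l * (w - p)) x1 x2 y1 y2 = 0.
Proof.
move=> h1 h2; apply: (contour_FTC h1 h2) => z _.
  by apply: cdiff_cont; exact: cdiff_affine.
exact: cdiff_affine_primitive.
Qed.

Lemma ccontB f1 f2 z : ccont f1 z -> ccont f2 z -> ccont (fun w : R[i] => f1 w - f2 w : R[i]) z.
Proof.
move=> h1 h2 e e0; have e2 : 0 < e / 2 by rewrite divr_gt0.
have [d d0 dP] := h1 _ e2; have [d' d'0 d'P] := h2 _ e2.
exists (Num.min d d'); first by rewrite lt_min d0.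
move=> h; rewrite lt_min => /andP[/dP H1 /d'P H2].
have -> : f1 (z + h) - f2 (z + h) - (f1 z - f2 z) =
  (f1 (z + h) - f1 z) - (f2 (z + h) - f2 z) by ring.
by rewrite (le_lt_trans (normcD _ _)) // normcN [ltRHS]splitr ltrD.
Qed.

(** Affine functions have primitives, so only the error of the affine
    approximation at p contributes: it is at most e times the size of the
    rectangle, and is integrated over a perimeter of comparable length. *)
Lemma contour_small p l e d x1 x2 y1 y2 : x1 <= x2 -> y1 <= y2 -> 0 <= e ->
  ccont_rect f x1 x2 y1 y2 ->
  (forall h, normc h < d -> normc (f (p + h) - f p - l * h) <= e * normc h) ->
  x1 <= complex.Re p <= x2 -> y1 <= complex.Im p <= y2 ->
  (x2 - x1) + (y2 - y1) < d ->
  normc (contour f x1 x2 y1 y2) <= 4 * e * ((x2 - x1) + (y2 - y1)) ^+ 2.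
Proof.
move=> h1 h2 e0 cf dP xp yp sd.
pose A (w : R[i]) := f p + l * (w - p).
have cA : ccont_rect A x1 x2 y1 y2 by move=> x y _ _; apply: cdiff_cont; exact: cdiff_affine.
have cE : ccont_rect (fun w => f w - A w) x1 x2 y1 y2.
  by move=> x y xx yy; apply: ccontB; [exact: cf|exact: cA].
have -> : contour f x1 x2 y1 y2 = contour (fun w => f w - A w) x1 x2 y1 y2.
  have := contourD h1 h2 (ccont_on_rectangle cE) (ccont_on_rectangle cA); rewrite [X in _ + X]contour_affine // addr0 => <-.
  by apply: eq_contour => // z _; rewrite subrK.
rewrite expr2 mulrA; have -> : forall s : R, 4 * e * s = 4 * (e * s) by move=> s; ring.
apply: contour_bound => // [|[x y] [/= xx yy _]]; first exact: ccont_on_rectangle.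
pose h := (x +i* y) - p.
have hs : normc h <= x2 - x1 + (y2 - y1).
  rewrite (le_trans (normc_le_ReIm _)) // /h Re_sub Im_sub /=.
  by apply: lerD; rewrite ler_norml; apply/andP; split; lra.
have := dP h (le_lt_trans hs sd).
have -> : p + h = x +i* y by rewrite /h addrC subrK.
rewrite /A opprD addrA => H; apply: (le_trans H).
by rewrite ler_wpM2l.
Qed.

Variables (x1 x2 y1 y2 : R).
Hypotheses (x12 : x1 <= x2) (y12 : y1 <= y2).
Hypothesis df : forall x y, x1 <= x <= x2 -> y1 <= y <= y2 -> exists l, cdiff f (x +i* y) l.

Let cf : ccont_rect f x1 x2 y1 y2.
Proof. by move=> x y xx yy; have [l /cdiff_cont] := df xx yy. Qed.

Let W n := (x2 - x1) / 2 ^+ n.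
Let V n := (y2 - y1) / 2 ^+ n.
Let W_ge0 n : 0 <= W n. Proof. by rewrite divr_ge0 ?exprn_ge0 ?subr_ge0. Qed.
Let V_ge0 n : 0 <= V n. Proof. by rewrite divr_ge0 ?exprn_ge0 ?subr_ge0. Qed.
Let WS n : W n = W n.+1 + W n.+1.
Proof. by rewrite /W exprS invfM; field; rewrite expf_neq0. Qed.
Let VS n : V n = V n.+1 + V n.+1.
Proof. by rewrite /V exprS invfM; field; rewrite expf_neq0. Qed.

Let inside n (p : R * R) := [/\ x1 <= p.1, p.1 + W n <= x2, y1 <= p.2 & p.2 + V n <= y2].
Let Q n (p : R * R) := contour f p.1 (p.1 + W n) p.2 (p.2 + V n).

(** One of the four halved rectangles carries at least a quarter of the
    integral. *)
Let bisect (np : nat * (R * R)) : exists p', inside np.1 np.2 ->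
  [/\ inside np.1.+1 p', np.2.1 <= p'.1, p'.1 + W np.1.+1 <= np.2.1 + W np.1,
      np.2.2 <= p'.2 & p'.2 + V np.1.+1 <= np.2.2 + V np.1] /\
      normc (Q np.1 np.2) <= 4 * normc (Q np.1.+1 p').
Proof.
case: np => n [x y] /=.
have [[i1 i2 i3 i4]|ni] := pselect (inside n (x, y)); last by exists (0, 0).
rewrite /= in i1 i2 i3 i4.
have wS := WS n; have vS := VS n.
have w0 := W_ge0 n.+1; have v0 := V_ge0 n.+1.
have cQ : ccont_rect f x (x + W n) y (y + V n) by apply: ccont_rectS cf.
have [lx lx'] : x <= x + W n.+1 /\ x + W n.+1 <= x + W n by lra.
have [ly ly'] : y <= y + V n.+1 /\ y + V n.+1 <= y + V n by lra.
have [lx2 ly2] : x <= x + W n /\ y <= y + V n by lra.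
have ex : x + W n.+1 + W n.+1 = x + W n by lra.
have ey : y + V n.+1 + V n.+1 = y + V n by lra.
have ins x' y' : x <= x' -> x' + W n.+1 <= x + W n -> y <= y' -> y' + V n.+1 <= y + V n ->
  [/\ inside n.+1 (x', y'), x <= x', x' + W n.+1 <= x + W n, y <= y' & y' + V n.+1 <= y + V n].
  by move=> h1 h2 h3 h4; do 2?split => //=; lra.
have E : Q n (x, y) = Q n.+1 (x, y) + Q n.+1 (x + W n.+1, y)
   + (Q n.+1 (x, y + V n.+1) + Q n.+1 (x + W n.+1, y + V n.+1)).
  rewrite /Q /= ex ey.
  rewrite (@contour_splity _ f x (x + W n) y (y + V n.+1)) //.
  congr (_ + _).
    rewrite -(@contour_splitx _ f x (x + W n.+1)) //.
    by apply: ccont_rectS cQ => //; lra.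
  rewrite -(@contour_splitx _ f x (x + W n.+1)) //.
  by apply: ccont_rectS cQ => //; lra.
have fin (a b c d e : R) : a <= b + c + (d + e) -> 4 * b < a -> 4 * c < a -> 4 * d < a ->
  a <= 4 * e by lra.
have tri : normc (Q n (x, y)) <= normc (Q n.+1 (x, y)) + normc (Q n.+1 (x + W n.+1, y))
   + (normc (Q n.+1 (x, y + V n.+1)) + normc (Q n.+1 (x + W n.+1, y + V n.+1))).
  by rewrite E (le_trans (normcD _ _)) // lerD ?normcD.
have [h|h1] := leP (normc (Q n (x, y))) (4 * normc (Q n.+1 (x, y))).
  exists (x, y) => _; split; last exact: h.
  by apply: ins; rewrite ?ex ?ey.
have [h|h2] := leP (normc (Q n (x, y))) (4 * normc (Q n.+1 (x + W n.+1, y))).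
  exists (x + W n.+1, y) => _; split; last exact: h.
  by apply: ins; rewrite ?ex ?ey.
have [h|h3] := leP (normc (Q n (x, y))) (4 * normc (Q n.+1 (x, y + V n.+1))).
  exists (x, y + V n.+1) => _; split; last exact: h.
  by apply: ins; rewrite ?ex ?ey.
exists (x + W n.+1, y + V n.+1) => _; split; last first.
  exact: fin tri h1 h2 h3.
by apply: ins; rewrite ?ex ?ey.
Qed.

(** The successive quarters shrink to a point p, where f is differentiable.
    By [contour_small] the integral over the n-th rectangle is at most e times
    the square of its size, that is of order e / 4^n, while it is at least the
    original integral divided by 4^n. *)
Lemma goursat : contour f x1 x2 y1 y2 = 0.
Proof.
have [sel selP] := choice bisect.
(* the lower left corners of the nested rectangles *)
pose s := fix s n := if n is m.+1 then sel (m, s m) else (x1, y1).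
have s_in n : inside n (s n).
  elim: n => [|n /(selP (n, s n)) [[]//]].
  by split; rewrite /= ?lexx // /W /V expr0 divr1; lra.
have sP n := selP (n, s n) (s_in n).
have QS n : normc (Q 0 (s 0%N)) <= 4 ^+ n * normc (Q n (s n)).
  elim: n => [|n IH]; first by rewrite expr0 mul1r.
  rewrite (le_trans IH) // exprSr -mulrA ler_wpM2l ?exprn_ge0 //.
  by have [_] := sP n.
have [px pxP] : exists p, forall n, (s n).1 <= p <= (s n).1 + W n.
  apply: nested_limit => n m nm.
    rewrite -(subnK nm); elim: (m - n)%N => [//|k IH].
    by rewrite (le_trans IH) // addSn; have [[]] := sP (k + n)%N.
  suff : (s m).1 + W m <= (s n).1 + W n by have := W_ge0 m; lra.
  rewrite -(subnK nm); elim: (m - n)%N => [//|k IH].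
  by rewrite (le_trans _ IH) // addSn; have [[]] := sP (k + n)%N.
have [py pyP] : exists p, forall n, (s n).2 <= p <= (s n).2 + V n.
  apply: nested_limit => n m nm.
    rewrite -(subnK nm); elim: (m - n)%N => [//|k IH].
    by rewrite (le_trans IH) // addSn; have [[]] := sP (k + n)%N.
  suff : (s m).2 + V m <= (s n).2 + V n by have := V_ge0 m; lra.
  rewrite -(subnK nm); elim: (m - n)%N => [//|k IH].
  by rewrite (le_trans _ IH) // addSn; have [[]] := sP (k + n)%N.
have W0 : W 0 = x2 - x1 by rewrite /W expr0 divr1.
have V0 : V 0 = y2 - y1 by rewrite /V expr0 divr1.
have Q0 : Q 0 (s 0%N) = contour f x1 x2 y1 y2.
  by rewrite /Q /= W0 V0 ![_ + (_ - _)]addrC !subrK.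
have [l lP] : exists l, cdiff f (px +i* py) l.
  apply: df; [have := pxP 0%N|have := pyP 0%N]; rewrite ?W0 ?V0 /=; lra.
pose S := (x2 - x1) + (y2 - y1).
have S0 : 0 <= S by rewrite addr_ge0 ?subr_ge0.
have main e : 0 < e -> normc (contour f x1 x2 y1 y2) <= 4 * e * S ^+ 2.
  move=> e0; have [d d0 dP] := lP e e0.
  have [n nP] : exists n : nat, S < d * 2 ^+ n.
    exists (Num.bound (S / d)); rewrite mulrC -ltr_pdivrMr //.
    have bS : 0 <= S / d by rewrite divr_ge0 // ltW.
    apply: lt_le_trans (archi_boundP bS) _.
    by rewrite -natrX ler_nat ltnW // ltn_expl.
  have WV : W n + V n = S / 2 ^+ n by rewrite /W /V -mulrDl.
  have [i1 i2 i3 i4] := s_in n.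
  have := QS n; rewrite Q0 => H; apply: (le_trans H).
  have -> : 4 * e * S ^+ 2 = 4 ^+ n * (4 * e * (W n + V n) ^+ 2).
    rewrite WV expr_div_n -exprM mulnC exprM.
    have -> : (2 ^+ 2 : R) = 4 by rewrite -natrX.
    by field; rewrite expf_neq0.
  rewrite ler_wpM2l ?exprn_ge0 //.
  have EW : (s n).1 + W n - (s n).1 = W n by rewrite addrAC subrr add0r.
  have EV : (s n).2 + V n - (s n).2 = V n by rewrite addrAC subrr add0r.
  have lx : (s n).1 <= (s n).1 + W n by rewrite lerDl.
  have ly : (s n).2 <= (s n).2 + V n by rewrite lerDl.
  have cc := ccont_rectS i1 i2 i3 i4 cf.
  have := @contour_small (px +i* py) l e d _ _ _ _ lx ly (ltW e0) cc dP (pxP n) (pyP n).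
  by rewrite EW EV; apply; rewrite WV ltr_pdivrMr // exprn_gt0.
apply/eqP; rewrite -normc_eq0 eq_le normc_ge0 andbT; apply/ler_addgt0Pr => e e0.
rewrite add0r; have K0 : 0 < 4 * S ^+ 2 + 1 by rewrite ltr_wpDl // mulr_ge0 ?sqr_ge0.
apply: le_trans (main (e / (4 * S ^+ 2 + 1)) (divr_gt0 e0 K0)) _.
have -> : 4 * (e / (4 * S ^+ 2 + 1)) * S ^+ 2 = e * ((4 * S ^+ 2) / (4 * S ^+ 2 + 1)) by ring.
by rewrite ger_pMr // ler_pdivrMr // mul1r lerDl.
Qed.

End Square.
End Goursat.

(** * An exceptional point in Goursat theorem *)

Section DiffRules.
Context {R : realType}.
Implicit Types (f g : R[i] -> R[i]) (z l : R[i]).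

Lemma cdiff_near f g z l (r : R) : 0 < r ->
  (forall h, normc h < r -> f (z + h) = g (z + h)) -> cdiff g z l -> cdiff f z l.
Proof.
move=> r0 fg H e /H[d d0 dP]; exists (Num.min r d); first by rewrite lt_min r0.
move=> h; rewrite lt_min => /andP[/fg -> /dP].
by have := fg 0; rewrite addr0 normc0 => /(_ r0) ->.
Qed.

Lemma cdiffV z : z != 0 -> cdiff (fun w => w^-1) z (- z ^- 2).
Proof.
move=> z0 e e0; have nz : 0 < normc z by rewrite normc_gt0.
pose K := 2 * normc z ^- 3.
have K0 : 0 < K by rewrite mulr_gt0 // invr_gt0 exprn_gt0.
exists (Num.min (normc z / 2) (e / K)).
  by rewrite lt_min; apply/andP; split; apply: divr_gt0.
move=> h; rewrite lt_min => /andP[h1]; rewrite ltr_pdivlMr // => h2.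
have zh : normc z / 2 <= normc (z + h).
  have := normcBD z (z + h); rewrite opprD addrA subrr sub0r normcN; lra.
have zh0 : z + h != 0.
  by rewrite -normc_gt0 (lt_le_trans _ zh) // divr_gt0.
have -> : (z + h)^-1 - z^-1 - - z ^- 2 * h = h * h * (z ^- 2 * (z + h)^-1).
  by field; rewrite z0 zh0.
rewrite !normcM -mulrA mulrC ler_wpM2r ?normc_ge0 // (le_trans _ (ltW h2)) //.
rewrite ler_wpM2l ?normc_ge0 // !normcV normcX /K.
have -> : 2 * normc z ^- 3 = normc z ^- 2 * (normc z / 2)^-1 by field; rewrite gt_eqF.
rewrite ler_wpM2l ?invr_ge0 ?exprn_ge0 ?normc_ge0 // lef_pV2 ?posrE ?divr_gt0 //.
by rewrite (lt_le_trans _ zh) // divr_gt0.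
Qed.

Lemma cdiff_shift f p z l : cdiff f (p + z) l -> cdiff (fun w => f (p + w)) z l.
Proof. by move=> H e /H[d d0 dP]; exists d => // h /dP; rewrite addrA. Qed.

Lemma cdiffB_cst f z l (a : R[i]) : cdiff f z l -> cdiff (fun w => f w - a) z l.
Proof. by move=> /cdiffD/(_ (cdiff_cst (- a) z)); rewrite addr0. Qed.

Lemma cdiff_expV m z : z != 0 -> cdiff (fun w => w ^- m) z (- m%:R * z ^- m.+1).
Proof.
move=> z0; elim: m => [|m IH].
  rewrite oppr0 mul0r; apply: (cdiff_near ltr01 _ (cdiff_cst 1 z)) => h _.
  by rewrite expr0 invr1.
have := cdiffM IH (cdiffV z0).
have -> : - m%:R * z ^- m.+1 / z + z ^- m * - z ^- 2 = - m.+1%:R * z ^- m.+2.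
  rewrite -[m.+1%:R]natr1 !exprS; field.
  by rewrite z0 expf_neq0.
by apply: (cdiff_near ltr01) => h _; rewrite exprSr invfM mulrC.
Qed.

Lemma ccont_near f g z (r : R) : 0 < r ->
  (forall h, normc h < r -> f (z + h) = g (z + h)) -> ccont g z -> ccont f z.
Proof.
move=> r0 fg H e /H[d d0 dP]; exists (Num.min r d); first by rewrite lt_min r0.
move=> h; rewrite lt_min => /andP[/fg -> /dP].
by have := fg 0; rewrite addr0 normc0 => /(_ r0) ->.
Qed.

Lemma ccontD f g z : ccont f z -> ccont g z -> ccont (fun w => f w + g w) z.
Proof.
move=> h1 h2 e e0; have e2 : 0 < e / 2 by rewrite divr_gt0.
have [d d0 dP] := h1 _ e2; have [d' d'0 d'P] := h2 _ e2.
exists (Num.min d d'); first by rewrite lt_min d0.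
move=> h; rewrite lt_min => /andP[/dP H1 /d'P H2].
have -> : f (z + h) + g (z + h) - (f z + g z) =
  (f (z + h) - f z) + (g (z + h) - g z) by ring.
by rewrite (le_lt_trans (normcD _ _)) // [ltRHS]splitr ltrD.
Qed.

Lemma ccontM f g z : ccont f z -> ccont g z -> ccont (fun w => f w * g w) z.
Proof.
move=> h1 h2 e e0.
have [c c0 cP] := h2 _ ltr01.
pose A := normc (g z) + 1; pose D := normc (f z) + 1.
have A0 : 0 < A by rewrite ltr_wpDl // normc_ge0.
have D0 : 0 < D by rewrite ltr_wpDl // normc_ge0.
have e3 : 0 < e / 2 by rewrite divr_gt0.
have [d d0 dP] := h1 _ (divr_gt0 e3 A0).
have [d' d'0 d'P] := h2 _ (divr_gt0 e3 D0).
exists (Num.min c (Num.min d d')); first by rewrite !lt_min c0 d0 d'0.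
move=> h; rewrite !lt_min => /andP[/cP H1 /andP[/dP H2 /d'P H3]].
have -> : f (z + h) * g (z + h) - f z * g z =
  (f (z + h) - f z) * g (z + h) + f z * (g (z + h) - g z) by ring.
have G : normc (g (z + h)) <= A.
  rewrite -(subrK (g z) (g (z + h))) (le_trans (normcD _ _)) // addrC lerD2l.
  exact: ltW.
have E : e = e / 2 / A * A + D * (e / 2 / D) by field; rewrite !gt_eqF.
rewrite [ltRHS]E (le_lt_trans (normcD _ _)) // !normcM ltr_leD //.
  apply: (le_lt_trans (ler_wpM2l (normc_ge0 _) G)).
  by rewrite ltr_pM2r.
by apply: ler_pM; rewrite ?normc_ge0 ?lerDl // ltW.
Qed.

Lemma ccont_cst (a z : R[i]) : ccont (fun=> a) z.
Proof. exact/cdiff_cont/cdiff_cst. Qed.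

Lemma ccont_sum n (F : 'I_n -> R[i] -> R[i]) z : (forall i, ccont (F i) z) ->
  ccont (fun w => \sum_i F i w) z.
Proof.
elim: n F => [|n IH] F H.
  by apply: (ccont_near ltr01 _ (ccont_cst 0 z)) => h _; rewrite big_ord0.
have := ccontD (H ord0) (IH _ (fun i => H (lift ord0 i))).
by apply: (ccont_near ltr01) => h _; rewrite big_ord_recl.
Qed.

End DiffRules.

Section Exceptional.
Context {R : realType}.
Variables (f : R[i] -> R[i]) (p : R[i]).

Lemma contour_flatx (y1 y2 x : R) : contour f x x y1 y2 = 0.
Proof.
have c0 phi (a : R) : cint phi a a = 0.
  by rewrite /cint /rint set_itv1 !Rintegral_set1.
by rewrite /contour !c0 !subrr mulr0 addr0.
Qed.

Lemma contour_flaty (x1 x2 y : R) : contour f x1 x2 y y = 0.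
Proof.
have c0 phi (a : R) : cint phi a a = 0.
  by rewrite /cint /rint set_itv1 !Rintegral_set1.
by rewrite /contour !c0 !subrr mulr0 addr0.
Qed.

(** Cut out a small rectangle containing p.  The integral over the rest vanishes by
    [goursat], and the one over the rectangle tends to 0 with its size, since f is
    bounded near p. *)
Lemma goursat_exceptional (x1 x2 y1 y2 : R) : x1 <= x2 -> y1 <= y2 ->
  x1 <= complex.Re p <= x2 -> y1 <= complex.Im p <= y2 -> ccont f p ->
  (forall z, x1 <= complex.Re z <= x2 -> y1 <= complex.Im z <= y2 -> z != p ->
     exists l, cdiff f z l) ->
  contour f x1 x2 y1 y2 = 0.
Proof.
case Ep : p => [px py] /= x12 y12 /andP[px1 px2] /andP[py1 py2] cp df.
have cf : ccont_rect f x1 x2 y1 y2.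
  move=> x y xx yy; have [->//|/eqP ne] := (x +i* y) =P (px +i* py).
  by have [l /cdiff_cont] := df (x +i* y) xx yy ne.
have away x1' x2' y1' y2' : x1 <= x1' -> x1' <= x2' -> x2' <= x2 ->
   y1 <= y1' -> y1' <= y2' -> y2' <= y2 ->
   (px < x1') || (x2' < px) || (py < y1') || (y2' < py) -> contour f x1' x2' y1' y2' = 0.
  move=> h1 h2 h3 h4 h5 h6 hp; apply: goursat => // x y /andP[a1 a2] /andP[b1 b2].
  apply: df => /=; [lra|lra|]; rewrite eq_complex /= negb_and.
  by move: hp; rewrite !neq_lt => /orP[/orP[/orP[]|]|] hp; apply/orP; [left|left|right|right]; lra.
have [d d0 dP] := cp 1 ltr01.
pose M := normc (f (px +i* py)) + 1.
have M0 : 0 < M by rewrite ltr_wpDl // normc_ge0.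
have main e : 0 < e -> e < d / 4 -> normc (contour f x1 x2 y1 y2) <= 16 * M * e.
  move=> e0 ed.
  pose a1 := Num.max x1 (px - e); pose a2 := Num.min x2 (px + e).
  pose b1 := Num.max y1 (py - e); pose b2 := Num.min y2 (py + e).
  have [ha1 ha1'] : x1 <= a1 /\ px - e <= a1 by split; rewrite le_max lexx ?orbT.
  have [ha2 ha2'] : a2 <= x2 /\ a2 <= px + e by split; rewrite ge_min lexx ?orbT.
  have [hb1 hb1'] : y1 <= b1 /\ py - e <= b1 by split; rewrite le_max lexx ?orbT.
  have [hb2 hb2'] : b2 <= y2 /\ b2 <= py + e by split; rewrite ge_min lexx ?orbT.
  have a1p : a1 <= px by rewrite ge_max px1 lerBlDr lerDl ltW.
  have a2p : px <= a2 by rewrite le_min px2 lerDl ltW.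
  have b1p : b1 <= py by rewrite ge_max py1 lerBlDr lerDl ltW.
  have b2p : py <= b2 by rewrite le_min py2 lerDl ltW.
  have a12 : a1 <= a2 by rewrite (le_trans a1p).
  have b12 : b1 <= b2 by rewrite (le_trans b1p).
  have ca : ccont_rect f x1 a2 y1 y2 by apply: ccont_rectS cf.
  have cb : ccont_rect f a1 a2 y1 y2 by apply: ccont_rectS cf.
  have cb' : ccont_rect f a1 a2 y1 b2 by apply: ccont_rectS cf.
  have cc : ccont_rect f a1 a2 b1 b2 by apply: ccont_rectS cf.
  rewrite (contour_splitx (le_trans ha1 a12) ha2 y12 cf).
  rewrite (contour_splitx ha1 a12 y12 ca).
  rewrite (contour_splity (le_trans hb1 b12) hb2 a12 cb).
  rewrite (contour_splity hb1 b12 a12 cb').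
  have -> : contour f x1 a1 y1 y2 = 0.
    rewrite /a1; case: leP => h; first [by rewrite (contour_flatx y1 y2)|by apply: away => //; lra].
  have -> : contour f a2 x2 y1 y2 = 0.
    rewrite /a2; case: leP => h; first [by rewrite (contour_flatx y1 y2)|by apply: away => //; lra].
  have -> : contour f a1 a2 y1 b1 = 0.
    rewrite /b1; case: leP => h; first [by rewrite (contour_flaty a1 a2)|by apply: away => //; lra].
  have -> : contour f a1 a2 b2 y2 = 0.
    rewrite /b2; case: leP => h; first [by rewrite (contour_flaty a1 a2)|by apply: away => //; lra].
  rewrite !add0r !addr0.
  apply: le_trans (contour_bound (M := M) a12 b12 (ccont_on_rectangle cc) _) _.
    move=> [x y] [/= /andP[xx1 xx2] /andP[yy1 yy2] _].
    pose h := (x +i* y) - (px +i* py).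
    have hd : normc h < d.
      rewrite (le_lt_trans (normc_le_ReIm _)) // /h Re_sub Im_sub /=.
      have : `|x - px| <= e by rewrite ler_distl (le_trans ha1' xx1) (le_trans xx2 ha2').
      have : `|y - py| <= e by rewrite ler_distl (le_trans hb1' yy1) (le_trans yy2 hb2').
      lra.
    have := dP h hd; rewrite /h [_ + (_ - _)]addrC subrK => H.
    rewrite -(subrK (f (px +i* py)) (f _)) (le_trans (normcD _ _)) // addrC lerD2l.
    exact: ltW.
  have -> : 16 * M * e = 4 * M * (4 * e) by ring.
  by rewrite ler_wpM2l ?mulr_ge0 ?(ltW M0) //; lra.
apply/eqP; rewrite -normc_eq0 eq_le normc_ge0 andbT; apply/ler_addgt0Pr => e e0.
have K0 : 0 < 16 * M by rewrite mulr_gt0.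
pose e1 := Num.min (d / 8) (e / (16 * M)).
have e10 : 0 < e1 by rewrite lt_min; apply/andP; split; apply: divr_gt0.
have e1d : e1 < d / 4 by rewrite /e1 gt_min; apply/orP; left; lra.
rewrite add0r (le_trans (main e1 e10 e1d)) // mulrC -ler_pdivlMr //.
by rewrite /e1 ge_min lexx orbT.
Qed.

End Exceptional.

(** * Cauchy formula on a square and Taylor expansion *)

Section Cauchy.
Context {R : realType}.
Implicit Types (f g : R[i] -> R[i]) (x y s : R) (z l : R[i]).

Definition square_contour s f := contour f (- s) s (- s) s.
Definition on_square s z := on_rectangle (- s) s (- s) s z.
Definition in_square s z := (- s <= complex.Re z <= s) && (- s <= complex.Im z <= s).

Section FixS.
Variables (s : R).
Hypothesis s0 : 0 < s.

Let ss : - s <= s. Proof. by rewrite ge0_cp ?ltW. Qed.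

Lemma on_square_norm z : on_square s z -> s <= normc z.
Proof.
have key (x : R) : (x == - s) || (x == s) -> s <= `|x|.
  by case/orP => /eqP ->; rewrite ?normrN ger0_norm // ltW.
move=> [_ _ /or4P[] /eqP h].
- by apply: le_trans (Re_le_normc z); apply: key; rewrite h eqxx.
- by apply: le_trans (Re_le_normc z); apply: key; rewrite h eqxx orbT.
- by apply: le_trans (Im_le_normc z); apply: key; rewrite h eqxx.
- by apply: le_trans (Im_le_normc z); apply: key; rewrite h eqxx orbT.
Qed.

Lemma on_square_neq0 z : on_square s z -> z != 0.
Proof. by move=> /on_square_norm h; rewrite -normc_gt0 (lt_le_trans s0). Qed.

Lemma on_square_in z : on_square s z -> in_square s z.
Proof. by case=> h1 h2 _; apply/andP. Qed.

Lemma in_square_norm z : normc z <= s -> in_square s z.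
Proof.
move=> h; apply/andP; split; rewrite -ler_norml.
  exact: le_trans (Re_le_normc _) h.
exact: le_trans (Im_le_normc _) h.
Qed.

Lemma square_contour_bound f M : (forall z, on_square s z -> ccont f z) ->
  (forall z, on_square s z -> normc (f z) <= M) -> normc (square_contour s f) <= 16 * M * s.
Proof.
move=> cf fM; apply: le_trans (contour_bound ss ss cf fM) _.
by rewrite le_eqVlt; apply/orP; left; apply/eqP; ring.
Qed.

Lemma square_contour_sum n (F : 'I_n -> R[i] -> R[i]) :
  (forall i z, on_square s z -> ccont (F i) z) ->
  square_contour s (fun z => \sum_i F i z) = \sum_i square_contour s (F i).
Proof.
elim: n F => [|n IH] F cF.
  have Z := contourZ ss ss 0 (fun z (_ : on_square s z) => ccont_cst 0 z).
  rewrite big_ord0 -[RHS](mul0r (square_contour s (fun=> 0))) -[RHS]Z.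
  by apply: (eq_contour ss ss) => z _; rewrite big_ord0 mul0r.
rewrite big_ord_recl -IH => [|i z bz]; last exact: cF.
rewrite /square_contour -contourD //; [|by move=> z; exact: cF|].
  by apply: eq_contour => // z _; rewrite big_ord_recl.
by move=> z bz; apply: ccont_sum => i; exact: cF.
Qed.

(** The integral of 1/z.  A lower bound for its modulus suffices in order to
    divide by it, so its value 2 pi i is not computed. *)
Definition winding := square_contour s (fun z => z^-1).

Let cV z : on_square s z -> ccont (fun w : R[i] => w^-1) z.
Proof. by move=> /on_square_neq0/cdiffV/cdiff_cont. Qed.

Let edge_bd t : - s <= t <= s ->
  [/\ on_square s (t +i* - s), on_square s (t +i* s), on_square s (- s +i* t) & on_square s (s +i* t)].
Proof.
by move=> tt; split; split; rewrite //= ?lexx ?ss ?eqxx ?orbT.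
Qed.

Let ge1 (psi : R -> R) : cont_on psi (- s) s ->
  (forall t, - s <= t <= s -> s / (s ^+ 2 + t ^+ 2) <= psi t) -> 1 <= rint psi (- s) s.
Proof.
move=> c h; have -> : 1 = rint (fun=> (2 * s)^-1) (- s) s.
  by rewrite rint_cst // opprK; field; rewrite gt_eqF.
apply: le_rint => // [|t tt]; first exact: cont_on_cst.
apply: le_trans (h t tt).
have t2 : t ^+ 2 <= s ^+ 2.
  case/andP: tt => t1 t2; rewrite -subr_ge0 subr_sqr mulr_ge0 //; lra.
have p0 : 0 < s ^+ 2 + t ^+ 2 by rewrite ltr_pwDl ?sqr_ge0 ?exprn_gt0.
rewrite ler_pdivlMr // mulrC ler_pdivrMr ?mulr_gt0 //.
by rewrite mulrCA -expr2; lra.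
Qed.

Let le_m1 (psi : R -> R) : cont_on psi (- s) s ->
  (forall t, - s <= t <= s -> psi t <= - (s / (s ^+ 2 + t ^+ 2))) -> rint psi (- s) s <= - 1.
Proof.
move=> c h; have cN : cont_on (fun t => (-1) * psi t) (- s) s.
  by move=> t /c ct; apply: cvgM => //; exact: cvg_cst.
have := ge1 cN; rewrite rintZ // mulN1r => H; rewrite lerNr H // => t /h.
by rewrite mulN1r lerNr.
Qed.

(** Each of the four edges contributes to the imaginary part the integral of
    s / (s^2 + t^2) for t in [-s, s], and the integrand is at least
    1 / (2 s). *)
Lemma winding_ge4 : 4 <= normc winding.
Proof.
apply: le_trans (Im_le_normc _); apply: le_trans (ler_norm _).
rewrite /winding /square_contour /contour Im_add Im_sub Im_mul Re_sub /= mul0r add0r mul1r.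
have hR phi : pcont_on phi (- s) s -> cont_on (fun t => complex.Re (phi t)) (- s) s.
  by move=> h t /h; exact: pcont_Re.
have hI phi : pcont_on phi (- s) s -> cont_on (fun t => complex.Im (phi t)) (- s) s.
  by move=> h t /h; exact: pcont_Im.
have E x y : (x +i* y)^-1 = x / (x ^+ 2 + y ^+ 2) -i* (y / (x ^+ 2 + y ^+ 2)) :> R[i].
  by [].
have h1 : 1 <= rint (fun t => complex.Im (t +i* - s)^-1) (- s) s.
  apply: ge1.
    by apply: hI => t /edge_bd[b1 b2 b3 b4]; apply: (pcont_hor (f := fun z => z^-1)); exact: cV.
  by move=> t _; rewrite E /= mulNr opprK sqrrN addrC.
have h2 : rint (fun t => complex.Im (t +i* s)^-1) (- s) s <= -1.
  apply: le_m1.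
    by apply: hI => t /edge_bd[b1 b2 b3 b4]; apply: (pcont_hor (f := fun z => z^-1)); exact: cV.
  by move=> t _; rewrite E /= addrC.
have h3 : 1 <= rint (fun t => complex.Re (s +i* t)^-1) (- s) s.
  apply: ge1.
    by apply: hR => t /edge_bd[b1 b2 b3 b4]; apply: (pcont_ver (f := fun z => z^-1)); exact: cV.
  by move=> t _; rewrite E /=.
have h4 : rint (fun t => complex.Re (- s +i* t)^-1) (- s) s <= -1.
  apply: le_m1.
    by apply: hR => t /edge_bd[b1 b2 b3 b4]; apply: (pcont_ver (f := fun z => z^-1)); exact: cV.
  by move=> t _; rewrite E /= sqrrN mulNr.
lra.
Qed.

Lemma winding_neq0 : winding != 0.
Proof. by rewrite -normc_gt0 (lt_le_trans _ winding_ge4). Qed.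

(** Integrate the geometric series of 1 / (w - z) in powers of z / w: on
    the boundary |w| is at least s, so the series converges geometrically when
    |z| is at most s / 2. *)
Lemma kernel_expansion g M z N : (forall w, on_square s w -> ccont g w) -> 0 <= M ->
  (forall w, on_square s w -> normc (g w) <= M) -> normc z <= s / 2 ->
  normc (square_contour s (fun w => g w / (w - z)) - \sum_(m < N) z ^+ m * square_contour s (fun w => g w * w ^- m.+1))
    <= 32 * M * (normc z / s) ^+ N.
Proof.
move=> cg M0 gM zs.
have wz w : on_square s w -> s / 2 <= normc (w - z).
  by move=> /on_square_norm h; have := normcBD w z; lra.
have s20 : 0 < s / 2 by rewrite divr_gt0.
have wz0 w : on_square s w -> w - z != 0.
  by move=> /wz h; rewrite -normc_gt0 (lt_le_trans s20).
have cVX m w : on_square s w -> ccont (fun w : R[i] => w ^- m) w.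
  by move=> /on_square_neq0/(cdiff_expV m)/cdiff_cont.
have cVz w : on_square s w -> ccont (fun w : R[i] => (w - z)^-1) w.
  move=> /wz0 wz1; rewrite addrC in wz1; have := cdiff_shift (cdiffV wz1).
  move=> /cdiff_cont; apply: (ccont_near ltr01) => h _.
  by rewrite [- z + _]addrC.
have cT (m : 'I_N) w : on_square s w -> ccont (fun w => z ^+ m * (g w * w ^- m.+1)) w.
  by move=> bw; apply: ccontM; [exact: ccont_cst|apply: ccontM; [exact: cg|exact: cVX]].
pose rem w := g w * (z ^+ N * w ^- N / (w - z)).
have crem w : on_square s w -> ccont rem w.
  move=> bw; apply: ccontM; first exact: cg.
  by apply: ccontM; [apply: ccontM; [exact: ccont_cst|exact: cVX]|exact: cVz].
have -> : square_contour s (fun w => g w / (w - z)) =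
   square_contour s (fun w => \sum_(m < N) z ^+ m * (g w * w ^- m.+1) + rem w).
  apply: eq_contour => // w bw.
  have w0 := on_square_neq0 bw; have wz1 := wz0 w bw.
  rewrite /rem; under eq_bigr do rewrite mulrCA.
  rewrite -mulr_sumr -mulrDr; congr (_ * _).
  elim: N {cT rem crem} => [|N IH]; first by rewrite big_ord0 add0r expr0 invr1 mulr1 mul1r.
  rewrite [LHS]IH big_ord_recr /= -addrA; congr (_ + _).
  have -> : w ^- N.+1 = w ^- N / w by rewrite exprSr invfM mulrC.
  rewrite exprSr; move: (z ^+ N) (w ^- N) => a b. field.
  by rewrite wz1 w0.
rewrite /square_contour contourD //; last first.
  by move=> w bw; apply: ccont_sum => i; exact: cT.
rewrite -/(square_contour s _) square_contour_sum //.
have -> : \sum_(m < N) square_contour s (fun w => z ^+ m * (g w * w ^- m.+1)) =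
   \sum_(m < N) z ^+ m * square_contour s (fun w => g w * w ^- m.+1).
  apply: eq_bigr => m _; rewrite /square_contour contourZ // => w bw.
  by apply: ccontM; [exact: cg|exact: cVX].
rewrite addrAC subrr add0r.
apply: le_trans (square_contour_bound (M := M * ((normc z / s) ^+ N * (2 / s))) crem _) _.
  move=> w bw; rewrite /rem normcM ler_pM ?normc_ge0 ?gM //.
  rewrite normcM ler_pM ?normc_ge0 //.
    rewrite normcM normcV !normcX expr_div_n ler_wpM2l ?exprn_ge0 ?normc_ge0 //.
    rewrite lef_pV2 ?posrE ?exprn_gt0 ?normc_gt0 ?on_square_neq0 //.
    by rewrite lerXn2r ?nnegrE ?normc_ge0 ?(ltW s0) // on_square_norm.
  have -> : 2 / s = (s / 2)^-1 by rewrite invf_div.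
  by rewrite normcV lef_pV2 ?posrE ?normc_gt0 ?wz0 // wz.
by rewrite le_eqVlt; apply/orP; left; apply/eqP; field; rewrite gt_eqF.
Qed.

Lemma square_contour_expV m : square_contour s (fun w => w ^- m.+2) = 0.
Proof.
have cVX w : on_square s w -> ccont (fun w : R[i] => w ^- m.+2) w.
  by move=> /on_square_neq0/(cdiff_expV m.+2)/cdiff_cont.
apply: (@contour_FTC _ _ _ _ _ ss ss (fun w => (- m.+1%:R)^-1 * w ^- m.+1)) => // w bw.
have := cdiffM (cdiff_cst (- m.+1%:R)^-1 w) (cdiff_expV m.+1 (on_square_neq0 bw)).
by rewrite mul0r add0r mulrA mulVf ?mul1r // oppr_eq0 pnatr_eq0.
Qed.

Lemma eq0_geometric_bound (x q C : R) : 0 <= q <= 2^-1 -> 0 <= C ->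
  (forall N, `|x| <= C * q ^+ N) -> x = 0.
Proof.
move=> /andP[q0 q2] C0 H; apply/eqP; rewrite -normr_le0; apply/ler_addgt0Pr => e e0.
rewrite add0r.
pose n := Num.bound (C / e).
apply: le_trans (H n) _; apply: le_trans (ler_wpM2l C0 (_ : _ <= 2 ^- n)) _.
  by rewrite -exprVn lerXn2r ?nnegrE // invr_ge0.
rewrite ler_pdivrMr ?exprn_gt0 // mulrC -ler_pdivrMr //.
apply: ltW; have b0 : 0 <= C / e by rewrite divr_ge0 // ltW.
apply: lt_le_trans (archi_boundP b0) _.
by rewrite -natrX ler_nat ltnW // ltn_expl.
Qed.

Lemma eq0_geometric_boundc (x : R[i]) (q C : R) : 0 <= q <= 2^-1 -> 0 <= C ->
  (forall N, normc x <= C * q ^+ N) -> x = 0.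
Proof.
move=> hq C0 H; apply/eqP; rewrite -normc_eq0; apply/eqP.
by apply: (eq0_geometric_bound hq C0) => N; rewrite ger0_norm ?normc_ge0.
Qed.

Let q_le z : normc z <= s / 2 -> 0 <= normc z / s <= 2^-1.
Proof.
move=> h; rewrite divr_ge0 ?normc_ge0 ?(ltW s0) //= ler_pdivrMr //.
by rewrite mulrC.
Qed.

(** By [kernel_expansion] with g = 1: the negative powers from the second one
    on have primitives, so only the term of order 0 remains. *)
Lemma winding_shift z : normc z <= s / 2 -> square_contour s (fun w => (w - z)^-1) = winding.
Proof.
move=> zs; apply/eqP; rewrite -subr_eq0; apply/eqP.
apply: (eq0_geometric_boundc (q_le zs) (C := 32 * 1)) => [|N]; first by rewrite mulr1 ler0n.
have c1 w : on_square s w -> ccont (fun=> 1 : R[i]) w by move=> _; exact: ccont_cst.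
have b1 w : on_square s w -> normc (1 : R[i]) <= 1 by rewrite normc1.
have E z' : square_contour s (fun w => 1 / (w - z')) = square_contour s (fun w => (w - z')^-1).
  by apply: eq_contour => // w _; rewrite mul1r.
have := kernel_expansion N.+1 c1 ler01 b1 zs.
rewrite E big_ord_recl expr0 mul1r big1 ?addr0.
  rewrite (_ : square_contour s (fun w => 1 * w ^- 1) = winding).
    move=> H; apply: le_trans H _; rewrite ler_wpM2l ?mulr1 // exprS.
    have /andP[q0 q1] := q_le zs.
    have q1' : normc z / s <= 1 by lra.
    by rewrite ler_piMl ?exprn_ge0.
  by apply: eq_contour => // w _; rewrite mul1r expr1.
move=> i _; have <- : square_contour s (fun w => w ^- i.+2) = square_contour s (fun w => 1 * w ^- (lift ord0 i).+1).
  by apply: eq_contour => // w _; rewrite mul1r.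
by rewrite square_contour_expV mulr0.
Qed.

Definition tcoef f m := square_contour s (fun w => f w * w ^- m.+1) / winding.

Lemma tcoef_bound f M m : (forall w, on_square s w -> ccont f w) -> 0 <= M ->
  (forall w, on_square s w -> normc (f w) <= M) -> normc (tcoef f m) <= 4 * M * s ^- m.
Proof.
move=> cf M0 fM; rewrite /tcoef normcM normcV.
rewrite ler_pdivrMr; last by rewrite (lt_le_trans _ winding_ge4).
apply: (@le_trans _ _ (4 * M * s ^- m * 4)); last first.
  apply: ler_wpM2l winding_ge4; apply: mulr_ge0; first exact: mulr_ge0.
  by rewrite invr_ge0 exprn_ge0 // ltW.
have -> : 4 * M * s ^- m * 4 = 16 * (M * s ^- m.+1) * s.
  rewrite exprS; field; rewrite expf_neq0 ?gt_eqF //.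
apply: square_contour_bound => w bw.
  apply: ccontM; first exact: cf.
  by have /(cdiff_expV m.+1)/cdiff_cont := on_square_neq0 bw.
rewrite normcM normcV normcX ler_pM ?normc_ge0 ?fM ?invr_ge0 ?exprn_ge0 ?normc_ge0 //.
rewrite lef_pV2 ?posrE ?exprn_gt0 ?normc_gt0 ?on_square_neq0 //.
by rewrite lerXn2r ?nnegrE ?normc_ge0 ?(ltW s0) // on_square_norm.
Qed.

Lemma tcoef_rem g M z N : (forall w, on_square s w -> ccont g w) -> 0 <= M ->
  (forall w, on_square s w -> normc (g w) <= M) -> normc z <= s / 2 ->
  normc (square_contour s (fun w => g w / (w - z)) / winding - \sum_(m < N) z ^+ m * tcoef g m)
    <= 8 * M * (normc z / s) ^+ N.
Proof.
move=> cg M0 gM zs; have H := kernel_expansion N cg M0 gM zs.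
have -> : square_contour s (fun w => g w / (w - z)) / winding - \sum_(m < N) z ^+ m * tcoef g m
 = (square_contour s (fun w => g w / (w - z)) - \sum_(m < N) z ^+ m * square_contour s (fun w => g w * w ^- m.+1)) / winding.
  rewrite mulrBl mulr_suml; congr (_ - _); apply: eq_bigr => m _.
  by rewrite mulrA.
rewrite normcM normcV ler_pdivrMr; last by rewrite (lt_le_trans _ winding_ge4).
apply: le_trans H _.
have -> : 32 * M * (normc z / s) ^+ N = 8 * M * (normc z / s) ^+ N * 4 by ring.
rewrite ler_wpM2l ?winding_ge4 // !mulr_ge0 ?exprn_ge0 //.
by have /andP[] := q_le zs.
Qed.

(** Apply [goursat_exceptional] to the difference quotient of f at z,
    completed by the derivative at z itself, and use [winding_shift]. *)
Lemma cauchy_formula f z : (forall w, in_square s w -> exists l, cdiff f w l) ->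
  normc z <= s / 2 -> f z = square_contour s (fun w => f w / (w - z)) / winding.
Proof.
move=> df zs.
have sl : s / 2 <= s by rewrite ler_piMr ?ltW // invf_lt1 ?ltr1n.
have zb : in_square s z by apply: in_square_norm; apply: le_trans sl.
have cf w : on_square s w -> ccont f w by move=> /on_square_in/df[l /cdiff_cont].
have s20 : 0 < s / 2 by rewrite divr_gt0.
have wz w : on_square s w -> s / 2 <= normc (w - z).
  by move=> /on_square_norm h; have := normcBD w z; lra.
have wz0 w : on_square s w -> w - z != 0.
  by move=> /wz h; rewrite -normc_gt0 (lt_le_trans s20).
have cVz w : w - z != 0 -> ccont (fun w : R[i] => (w - z)^-1) w.
  move=> wz1; rewrite addrC in wz1; have := cdiff_shift (cdiffV wz1).
  move=> /cdiff_cont; apply: (ccont_near ltr01) => h _.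
  by rewrite [- z + _]addrC.
have [l dl] := df z zb.
(* the difference quotient, continued by the derivative *)
pose h w := if w == z then l else (f w - f z) / (w - z).
have h0 : square_contour s h = 0.
  have /andP[zb1 zb2] := zb.
  apply: (@goursat_exceptional _ h z) => //.
    move=> e e0; have e2 : 0 < e / 2 by rewrite divr_gt0.
    have [d d0 dP] := dl _ e2; exists d => // k kd.
    rewrite /h eqxx; have [->|k0] := eqVneq k 0; first by rewrite addr0 eqxx subrr normc0.
    rewrite -subr_eq0 addrAC subrr add0r (negPf k0).
    have -> : (f (z + k) - f z) / k - l = (f (z + k) - f z - l * k) / k by field.
    rewrite normcM normcV ltr_pdivrMr ?normc_gt0 //.
    apply: le_lt_trans (dP k kd) _; rewrite ltr_pM2r ?normc_gt0 //; lra.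
  move=> w w1 w2 wz1.
  have [l' dl'] := df w (introT andP (conj w1 w2)).
  have wz2 : - z + w != 0 by rewrite addrC subr_eq0.
  have := cdiffM (cdiffB_cst (f z) dl') (cdiff_shift (cdiffV wz2)).
  set l'' := (X in cdiff _ _ X) => H; exists l''.
  have r0 : 0 < normc (- z + w) by rewrite normc_gt0.
  apply: (cdiff_near r0 _ H).
  move=> k kd; rewrite /h ifF; first by rewrite [- z + _]addrC.
  apply/eqP => E; move: kd; rewrite -E opprD addrAC addNr add0r normcN.
  by rewrite ltxx.
have E : square_contour s (fun w => f w / (w - z)) = f z * winding.
  have -> : square_contour s (fun w => f w / (w - z)) = square_contour s (fun w => h w + f z * (w - z)^-1).
    apply: eq_contour => // w bw.
    rewrite /h ifF; last by apply/negbTE; rewrite -subr_eq0; exact: wz0.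
    by rewrite mulrBl subrK.
  rewrite /square_contour contourD //.
  - rewrite -/(square_contour s h) h0 add0r contourZ //; last by move=> w /wz0/cVz.
    by rewrite -/(square_contour s _) winding_shift.
  - move=> w bw; have wz1 := wz0 w bw; have := ccontM (ccontD (cf w bw) (ccont_cst (- f z) w)) (cVz w wz1).
    apply: (ccont_near (r := normc (w - z))); first by rewrite normc_gt0.
    move=> k kd; rewrite /h ifF //; apply/eqP => E; move: kd.
    by rewrite -E opprD addrA subrr sub0r normcN ltxx.
  - by move=> w /wz0/cVz; apply: ccontM; exact: ccont_cst.
by rewrite E mulfK // winding_neq0.
Qed.

Lemma cauchy_taylor f M z N : (forall w, in_square s w -> exists l, cdiff f w l) -> 0 <= M ->
  (forall w, on_square s w -> normc (f w) <= M) -> normc z <= s / 2 ->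
  normc (f z - \sum_(m < N) z ^+ m * tcoef f m) <= 8 * M * (normc z / s) ^+ N.
Proof.
move=> df M0 fM zs; rewrite {1}(cauchy_formula df zs).
apply: tcoef_rem => // w /on_square_in/df[l]; exact: cdiff_cont.
Qed.

End FixS.
End Cauchy.

(** * Taylor expansion in two variables *)

Section Coefficients.
Context {R : realType}.
Implicit Types (f g : R[i] -> R[i]) (s : R).

Lemma cdiff_uniq f (z l l' : R[i]) : cdiff f z l -> cdiff f z l' -> l = l'.
Proof.
move=> h1 h2; apply/eqP; rewrite -subr_eq0 -normc_eq0 eq_le normc_ge0 andbT.
apply/ler_addgt0Pr => e e0; rewrite add0r.
have e2 : 0 < e / 2 by rewrite divr_gt0.
have [d d0 dP] := h1 _ e2; have [d' d'0 d'P] := h2 _ e2.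
(* a point at which both estimates apply *)
pose t := Num.min d d' / 2.
have m0 : 0 < Num.min d d' by rewrite lt_min d0.
have t0 : 0 < t by rewrite divr_gt0.
have tm : t < Num.min d d' by rewrite ltr_pdivrMr // ltr_pMr // ltr1n.
have nt : normc t%:C = t by rewrite normc_real gtr0_norm.
have /andP[td td'] : (t < d) && (t < d') by rewrite -lt_min.
have H1 := dP t%:C; rewrite nt in H1; have {}H1 := H1 td.
have H2 := d'P t%:C; rewrite nt in H2; have {}H2 := H2 td'.
have : normc ((l - l') * t%:C) <= e * t.
  have -> : (l - l') * t%:C = (f (z + t%:C) - f z - l' * t%:C) - (f (z + t%:C) - f z - l * t%:C) by ring.
  by rewrite (le_trans (normcD _ _)) // normcN [e in leRHS]splitr mulrDl lerD.
by rewrite normcM nt ler_pM2r.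
Qed.

Variables (s : R).
Hypothesis s0 : 0 < s.

Let ss : - s <= s. Proof. by rewrite ge0_cp ?ltW. Qed.

Let cVX f m : (forall w, on_square s w -> ccont f w) -> forall w, on_square s w -> ccont (fun w => f w * w ^- m.+1) w.
Proof.
move=> cf w bw; apply: ccontM; first exact: cf.
by have /(cdiff_expV m.+1)/cdiff_cont := on_square_neq0 s0 bw.
Qed.

Lemma eq_tcoef f g m : (forall w, on_square s w -> f w = g w) -> tcoef s f m = tcoef s g m.
Proof.
by move=> fg; rewrite /tcoef; congr (_ / _); apply: eq_contour => // w bw; rewrite fg.
Qed.

Lemma tcoefD f g m : (forall w, on_square s w -> ccont f w) -> (forall w, on_square s w -> ccont g w) ->
  tcoef s (fun w => f w + g w) m = tcoef s f m + tcoef s g m.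
Proof.
move=> cf cg; rewrite /tcoef -mulrDl; congr (_ / _).
rewrite /square_contour -contourD //; [|exact: cVX|exact: cVX].
by apply: eq_contour => // w _; rewrite mulrDl.
Qed.

Lemma tcoefZ k f m : (forall w, on_square s w -> ccont f w) ->
  tcoef s (fun w => k * f w) m = k * tcoef s f m.
Proof.
move=> cf; rewrite /tcoef mulrA; congr (_ / _).
rewrite /square_contour -contourZ //; last exact: cVX.
by apply: eq_contour => // w _; rewrite mulrA.
Qed.

Lemma ccontZ k f z : ccont f z -> ccont (fun w : R[i] => k * f w) z.
Proof. exact: ccontM (ccont_cst k z). Qed.

Lemma tcoefB f g m : (forall w, on_square s w -> ccont f w) -> (forall w, on_square s w -> ccont g w) ->
  tcoef s (fun w => f w - g w) m = tcoef s f m - tcoef s g m.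
Proof.
move=> cf cg; rewrite (@eq_tcoef _ (fun w => f w + (-1) * g w)) => [|w _]; last by rewrite mulN1r.
by rewrite tcoefD ?tcoefZ ?mulN1r // => w /cg; exact: ccontZ.
Qed.

Lemma tcoef_sum n (F : 'I_n -> R[i] -> R[i]) m :
  (forall i w, on_square s w -> ccont (F i) w) ->
  tcoef s (fun w => \sum_i F i w) m = \sum_i tcoef s (F i) m.
Proof.
move=> cF; rewrite /tcoef -mulr_suml; congr (_ / _).
rewrite -(square_contour_sum s0) => [|i]; last by apply: cVX => w; exact: cF.
by apply: eq_contour => // w _; rewrite mulr_suml.
Qed.

Section Center.
Variables (f : R[i] -> R[i]) (p : R[i]) (M : R).
Hypothesis df : forall w, in_square s w -> exists l, cdiff f (p + w) l.
Hypothesis M0 : 0 <= M.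
Hypothesis fM : forall w, on_square s w -> normc (f (p + w)) <= M.

Let dg w : in_square s w -> exists l, cdiff (fun w => f (p + w)) w l.
Proof. by move=> /df[l dl]; exists l; exact: cdiff_shift. Qed.

Let g0 : f p = tcoef s (fun w => f (p + w)) 0.
Proof.
have z0 : normc (0 : R[i]) <= s / 2 by rewrite normc0 divr_ge0 // ltW.
have := @cauchy_taylor _ s s0 (fun w => f (p + w)) M 0 1 dg M0 fM z0.
rewrite big_ord1 expr0 mul1r addr0 normc0 mul0r expr1 mulr0 => h.
by apply/eqP; rewrite -subr_eq0 -normc_eq0 eq_le h normc_ge0.
Qed.

(** Taylor expansion with a single term. *)
Lemma local_lipschitz k : normc k <= s / 2 -> normc (f (p + k) - f p) <= 8 * M * (normc k / s).
Proof.
move=> ks; have := @cauchy_taylor _ s s0 (fun w => f (p + w)) M k 1 dg M0 fM ks.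
by rewrite big_ord1 expr0 mul1r -g0 expr1.
Qed.

(** The derivative is the first Taylor coefficient, which is an integral. *)
Lemma cauchy_derivative l : cdiff f p l -> normc l <= 4 * M / s.
Proof.
move=> dl; have -> : l = tcoef s (fun w => f (p + w)) 1.
  apply: (cdiff_uniq dl) => e e0.
  have P0 : 0 <= 8 * M / s ^+ 2 := divr_ge0 (mulr_ge0 (ler0n _ 8) M0) (exprn_ge0 2 (ltW s0)).
  have K0 : 0 < 8 * M / s ^+ 2 + 1 by rewrite ltr_wpDl.
  exists (Num.min (s / 2) (e / (8 * M / s ^+ 2 + 1))).
    by rewrite lt_min; apply/andP; split; apply: divr_gt0.
  move=> k; rewrite lt_min => /andP[/ltW ks]; rewrite ltr_pdivlMr // => ke.
  have := @cauchy_taylor _ s s0 (fun w => f (p + w)) M k 2 dg M0 fM ks.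
  rewrite big_ord_recl big_ord1 /= expr0 mul1r -g0 expr1 opprD addrA [k * _]mulrC => H.
  apply: le_trans H _; have -> : 8 * M * (normc k / s) ^+ 2 = 8 * M / s ^+ 2 * normc k * normc k.
    by field; rewrite gt_eqF.
  rewrite ler_wpM2r ?normc_ge0 // (le_trans _ (ltW ke)) // mulrC.
  by rewrite ler_wpM2l ?normc_ge0 // lerDl.
rewrite -[s in leRHS]expr1; apply: tcoef_bound => // w /on_square_in/dg[l']; exact: cdiff_cont.
Qed.

End Center.
End Coefficients.

Section TwoVariables.
Context {R : realType}.
Variables (f : R[i] -> R[i] -> R[i]) (s M : R).
Hypothesis s0 : 0 < s.
Hypothesis df1 : forall z w, in_square (2 * s) z -> in_square (2 * s) w -> exists l, cdiff (f^~ w) z l.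
Hypothesis df2 : forall z w, in_square (2 * s) z -> in_square (2 * s) w -> exists l, cdiff (f z) w l.
Hypothesis M0 : 0 <= M.
Hypothesis fM : forall z w, in_square (2 * s) z -> in_square (2 * s) w -> normc (f z w) <= M.

Lemma in_squareS (a b : R) z : a <= b -> in_square a z -> in_square b z.
Proof. by move=> ab /andP[/andP[h1 h2] /andP[h3 h4]]; do 2?[apply/andP; split]; lra. Qed.

Let s2s z : in_square s z -> in_square (2 * s) z.
Proof. by apply: in_squareS; rewrite ler_peMl ?(ltW s0) // ler1n. Qed.

Let add_box z w : in_square s z -> in_square s w -> in_square (2 * s) (z + w).
Proof.
move=> /andP[/andP[h1 h2] /andP[h3 h4]] /andP[/andP[k1 k2] /andP[k3 k4]].
by rewrite /in_square Re_add Im_add; do 2?[apply/andP; split]; lra.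
Qed.

(** The coefficient of order n in w is taken first, then the coefficient of
    order m in z of the function of z so obtained. *)
Definition tcoef2 m n := tcoef s (fun z => tcoef s (f z) n) m.

Let c1 w z : in_square s w -> on_square s z -> ccont (f^~ w) z.
Proof. by move=> /s2s h1 /on_square_in/s2s h2; have [l /cdiff_cont] := df1 h2 h1. Qed.
Let c2 z w : in_square (2 * s) z -> on_square s w -> ccont (f z) w.
Proof. by move=> h1 /on_square_in/s2s h2; have [l /cdiff_cont] := df2 h1 h2. Qed.

(** The Lipschitz estimate of f in z is uniform in w. *)
Let ctcoef n z : on_square s z -> ccont (fun z => tcoef s (f z) n) z.
Proof.
move=> bz; have zb := on_square_in bz; move=> e e0.
pose K := 4 * (8 * M / s) * s ^- n + 1.
have K0 : 0 < K.
  rewrite ltr_wpDl // mulr_ge0 ?invr_ge0 ?exprn_ge0 ?(ltW s0) //.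
  by rewrite mulr_ge0 // divr_ge0 ?(ltW s0) // mulr_ge0.
exists (Num.min (s / 2) (e / K)).
  by rewrite lt_min; apply/andP; split; apply: divr_gt0.
move=> k; rewrite lt_min => /andP[/ltW ks]; rewrite ltr_pdivlMr // => ke.
have ksb : in_square s k.
  by apply: in_square_norm => //; rewrite (le_trans ks) // ler_pdivrMr // ler_peMr ?(ltW s0) // ler1n.
have zk : in_square (2 * s) (z + k) by exact: add_box.
rewrite -(tcoefB s0 n (fun w => c2 zk) (fun w => c2 (s2s zb))).
apply: le_lt_trans (@tcoef_bound _ _ s0 _ (8 * M * (normc k / s)) n _ _ _) _.
- move=> w bw; apply: ccontB; first exact: c2.
  by apply: c2 => //; exact: s2s.
- exact: mulr_ge0 (mulr_ge0 (ler0n _ 8) M0) (divr_ge0 (normc_ge0 k) (ltW s0)).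
- move=> w bw; have wb := on_square_in bw.
  apply: (@local_lipschitz _ s s0 (f^~ w) z M _ M0 _ k ks).
    by move=> h hb; apply: df1; [exact: add_box|exact: s2s].
  by move=> h /on_square_in hb; apply: fM; [exact: add_box|exact: s2s].
apply: le_lt_trans ke.
have -> : 4 * (8 * M * (normc k / s)) * s ^- n = normc k * (4 * (8 * M / s) * s ^- n).
  by field; rewrite expf_neq0 ?gt_eqF.
by rewrite ler_wpM2l ?normc_ge0 // lerDl.
Qed.

(** Expand in z, then expand each coefficient in w.  The m-th coefficient in z
    is a bounded functional of size O(s^-m), so the error of the expansion in w
    gets multiplied by the sum of the powers of |z| / s, which is at most 2. *)
Theorem cauchy_taylor2 z w N : normc z <= s / 2 -> normc w <= s / 2 ->
  normc (f z w - \sum_(m < N) \sum_(n < N) tcoef2 m n * z ^+ m * w ^+ n)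
    <= 64 * M * ((normc z / s) ^+ N + (normc w / s) ^+ N).
Proof.
move=> zs ws.
have hs : s / 2 <= s by rewrite ler_pdivrMr // ler_peMr ?(ltW s0) // ler1n.
have wb : in_square s w by apply: in_square_norm => //; exact: le_trans hs.
have q0 (x : R[i]) : 0 <= normc x / s by rewrite divr_ge0 ?normc_ge0 ?ltW.
have qz : normc z / s <= 2^-1 by rewrite ler_pdivrMr // mulrC.
set qw := normc w / s.
have H1 := @cauchy_taylor _ s s0 (f^~ w) M z N _ M0 _ zs.
have {}H1 : normc (f z w - \sum_(m < N) z ^+ m * tcoef s (f^~ w) m) <= 8 * M * (normc z / s) ^+ N.
  apply: H1 => [k kb|k /on_square_in/s2s kb]; last by apply: fM => //; exact: s2s.
  by apply: df1; exact: s2s.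
pose rho k := f k w - \sum_(n < N) w ^+ n * tcoef s (f k) n.
have crho k : on_square s k -> ccont rho k.
  move=> bk; apply: ccontB; first exact: c1.
  by apply: ccont_sum => i; apply: ccontZ; exact: ctcoef.
have qw0 : 0 <= 8 * M * qw ^+ N := mulr_ge0 (mulr_ge0 (ler0n _ 8) M0) (exprn_ge0 N (q0 w)).
have rhoM k : on_square s k -> normc (rho k) <= 8 * M * qw ^+ N.
  move=> /on_square_in/s2s kb; apply: cauchy_taylor => //.
    by move=> x /s2s xb; exact: df2.
  by move=> x /on_square_in/s2s xb; exact: fM.
have H2 m : normc (tcoef s (f^~ w) m - \sum_(n < N) w ^+ n * tcoef2 m n) <= 4 * (8 * M * qw ^+ N) * s ^- m.
  have -> : \sum_(n < N) w ^+ n * tcoef2 m n = tcoef s (fun k => \sum_(n < N) w ^+ n * tcoef s (f k) n) m.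
    rewrite tcoef_sum //; last by move=> i k bk; apply: ccontZ; exact: ctcoef.
    by apply: eq_bigr => n _; rewrite tcoefZ // => k bk; exact: ctcoef.
  rewrite -tcoefB //; last 2 first.
  - by move=> k bk; exact: c1.
  - by move=> k bk; apply: ccont_sum => i; apply: ccontZ; exact: ctcoef.
  exact: tcoef_bound.
have E : f z w - \sum_(m < N) \sum_(n < N) tcoef2 m n * z ^+ m * w ^+ n =
   (f z w - \sum_(m < N) z ^+ m * tcoef s (f^~ w) m) +
   \sum_(m < N) z ^+ m * (tcoef s (f^~ w) m - \sum_(n < N) w ^+ n * tcoef2 m n).
  rewrite -addrA; congr (_ + _); rewrite addrC -sumrB -sumrN; apply: eq_bigr => m _.
  rewrite mulrBr addrAC subrr add0r mulr_sumr; congr (- _); apply: eq_bigr => n _.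
  by ring.
rewrite E (le_trans (normcD _ _)) // mulrDr lerD //.
  by rewrite (le_trans H1) // ler_wpM2r ?exprn_ge0 // ler_wpM2r // ler_nat.
apply: le_trans (normc_sum _ _ _) _.
have geo : \sum_(m < N) (normc z / s) ^+ m <= 2.
  have := subrX1 (normc z / s) N.
  set S := \sum_(i < N) _ => ES.
  have hN := exprn_ge0 N (q0 z).
  have S0 : 0 <= S by apply: sumr_ge0 => i _; exact: exprn_ge0.
  by nra.
apply: (@le_trans _ _ (\sum_(m < N) (normc z / s) ^+ m * (32 * M * qw ^+ N))).
  apply: ler_sum => m _; rewrite normcM normcX expr_div_n.
  have -> : normc z ^+ m / s ^+ m * (32 * M * qw ^+ N) = normc z ^+ m * (4 * (8 * M * qw ^+ N) * s ^- m) by ring.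
  by rewrite ler_wpM2l ?exprn_ge0 ?normc_ge0.
rewrite -mulr_suml.
have -> : 64 * M * qw ^+ N = 2 * (32 * M * qw ^+ N) by ring.
have ge0' : 0 <= 32 * M * qw ^+ N := mulr_ge0 (mulr_ge0 (ler0n _ 32) M0) (exprn_ge0 N (q0 w)).
by rewrite ler_wpM2r.
Qed.

End TwoVariables.

(** * Neighbourhoods and derivatives in two complex variables *)

Section Bridge.
Context {R : realType}.

Lemma normcE (z : R[i]) : `|z| = (normc z)%:C.
Proof. by rewrite normc_def; case: z. Qed.

Lemma near_C2 (P : C2 R -> Prop) (p : C2 R) :
  (\forall q \near p, P q) <->
  exists2 r : R, 0 < r & forall a b, normc a < r -> normc b < r -> P (p.1 + a, p.2 + b).
Proof.
split.
  move=> /nbhs_ballP[e /= e0 H].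
  have [e1 Ee] : exists e1, e = e1%:C.
    exists (complex.Re e); case: e e0 {H} => x y; rewrite ltcE /= => /andP[/eqP -> _] //.
  exists e1; first by move: e0; rewrite Ee ltcR.
  move=> a b ha hb; apply: H; split; rewrite /ball /= opprD addrA subrr sub0r normrN normcE Ee ltcR //.
case=> r r0 H; apply/nbhs_ballP; exists r%:C; first by rewrite /= ltcR.
move=> [q1 q2] [/= h1 h2].
have := H (q1 - p.1) (q2 - p.2); rewrite ![_ + (_ - _)]addrC !subrK; apply.
  by move: h1; rewrite /ball /= normcE ltcR normcB.
by move: h2; rewrite /ball /= normcE ltcR normcB.
Qed.

Lemma near_CC (P : CC R -> Prop) (p : CC R) :
  (\forall q \near p, P q) <->
  exists2 r : R, 0 < r & forall a : R[i], normc a < r -> P (p + a).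
Proof.
split.
  move=> /nbhs_ballP[e /= e0 H].
  have [e1 Ee] : exists e1, e = e1%:C.
    exists (complex.Re e); case: e e0 {H} => x y; rewrite ltcE /= => /andP[/eqP -> _] //.
  exists e1; first by move: e0; rewrite Ee ltcR.
  move=> a ha; apply: H; rewrite /ball /= opprD addrA subrr sub0r normrN normcE Ee ltcR //.
case=> r r0 H; apply/nbhs_ballP; exists r%:C; first by rewrite /= ltcR.
move=> q h1.
have := H (q - p); rewrite ![_ + (_ - _)]addrC !subrK; apply.
by move: h1; rewrite /ball /= normcE ltcR normcB.
Qed.

Lemma C2_norm_lt (p : C2 R) (e : R) : (`|p| < e%:C) = (normc p.1 < e) && (normc p.2 < e).
Proof.
by rewrite prod_normE num_gt_max; case: p => a b /=; rewrite !normcE !ltcR.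
Qed.

(** The directional derivative in the direction v is a complex derivative in the parameter
    of the complex line through p directed by v, for each component. *)
Lemma derivable_cdiff (H : C2 R -> C2 R) (p v : C2 R) : derivable H p v ->
  cdiff (fun t => (H (p + t *: v)).1) 0 ('D_v H p).1 /\
  cdiff (fun t => (H (p + t *: v)).2) 0 ('D_v H p).2.
Proof.
move=> dH.
have main (e : R) : 0 < e -> exists2 d : R, 0 < d & forall h, normc h < d ->
   normc ((H (p + h *: v)).1 - (H p).1 - ('D_v H p).1 * h) <= e * normc h /\
   normc ((H (p + h *: v)).2 - (H p).2 - ('D_v H p).2 * h) <= e * normc h.
  move=> e0; have /cvgrPdist_lt/(_ e%:C) := dH; rewrite ltcR => /(_ e0).
  rewrite /dnbhs /within /= => /near_CC[d d0 dP]; exists d => // h hd.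
  have [->|h0] := eqVneq h 0.
    by rewrite scale0r addr0 !subrr !mulr0 subr0 normc0 mulr0.
  have := dP h hd; rewrite add0r => /(_ h0); rewrite C2_norm_lt /= => /andP[].
  have E (x y l : R[i]) : normc (l - h^-1 *: (x - y)) = normc (x - y - l * h) / normc h.
    rewrite -normcV -normcM -normcN; congr normc.
    by rewrite /GRing.scale /=; field.
  rewrite [h *: v + p]addrC !E !ltr_pdivrMr ?normc_gt0 // => h1 h2.
  by split; exact: ltW.
split=> e /main[d d0 dP]; exists d => // h /dP[h1 h2]; rewrite add0r scale0r addr0 //.
Qed.

Lemma cdiff_derive (H : C2 R -> C2 R) (p v : C2 R) (l : C2 R) :
  cdiff (fun t => (H (p + t *: v)).1) 0 l.1 ->
  cdiff (fun t => (H (p + t *: v)).2) 0 l.2 -> 'D_v H p = l.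
Proof.
move=> h1 h2; apply: cvg_lim => //.
apply/cvgrPdist_lt => e e0.
have [e1 Ee] : exists e1, e = e1%:C.
  exists (complex.Re e); case: e e0 => x y; rewrite ltcE /= => /andP[/eqP -> _] //.
move: e0; rewrite Ee ltcR => e10; have e20 : 0 < e1 / 2 by rewrite divr_gt0.
have [d d0 dP] := h1 _ e20; have [d' d'0 d'P] := h2 _ e20.
rewrite /dnbhs /within /=; apply/near_CC; exists (Num.min d d'); first by rewrite lt_min d0.
move=> h; rewrite lt_min add0r => /andP[/dP H1 /d'P H2] h0; rewrite C2_norm_lt /=.
have E (x y k : R[i]) : normc (k - h^-1 *: (x - y)) = normc (x - y - k * h) / normc h.
  rewrite -normcV -normcM -normcN; congr normc.
  by rewrite /GRing.scale /=; field.
rewrite add0r scale0r addr0 in H1 H2.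
rewrite [h *: v + p]addrC !E !ltr_pdivrMr ?normc_gt0 //.
by apply/andP; split; [apply: le_lt_trans H1 _|apply: le_lt_trans H2 _];
  rewrite ltr_pM2r ?normc_gt0 //; lra.
Qed.

End Bridge.

(** * Taylor coefficients and jets of holomorphic maps *)

Section Quadratic.
Context {R : realType}.

Definition quad (a00 a10 a01 a20 a11 a02 z w : R[i]) : R[i] :=
  a00 + a10 * z + a01 * w + a20 * z ^+ 2 + a11 * z * w + a02 * w ^+ 2.

Lemma in_square_normc (s : R) (z : R[i]) : in_square s z -> normc z <= 2 * s.
Proof.
move=> /andP[]; rewrite -!ler_norml => h1 h2.
by apply: le_trans (normc_le_ReIm z) _; lra.
Qed.

(** The difference of f and the quadratic polynomial is O(d^3) on a disc of
    radius comparable to d; by [cauchy_derivative] its derivative is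
    O(d^2). *)
Lemma quad_deriv (f : R[i] -> R[i] -> R[i]) (a00 a10 a01 a20 a11 a02 : R[i]) (C r : R) :
  0 < r -> 0 <= C ->
  (forall z w, normc z <= r -> normc w <= r -> exists l, cdiff (f^~ w) z l) ->
  (forall z w, normc z <= r -> normc w <= r ->
     normc (f z w - quad a00 a10 a01 a20 a11 a02 z w) <= C * (normc z + normc w) ^+ 3) ->
  forall z w d l, 0 < d -> d <= r / 3 -> normc z <= d -> normc w <= d ->
    cdiff (f^~ w) z l ->
    normc (l - (a10 + 2 * a20 * z + a11 * w)) <= 256 * C * d ^+ 2.
Proof.
move=> r0 C0 df fC z w d l d0 dr zd wd dl.
have zr k : in_square d k -> normc (z + k) <= 3 * d.
  by move=> /in_square_normc h; apply: le_trans (normcD _ _) _; lra.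
have wr : normc w <= r by lra.
have d3 : 3 * d <= r by lra.
pose q1 := a10 + a11 * w; pose q0 := a00 + a01 * w + a02 * w ^+ 2.
have qE x : quad a00 a10 a01 a20 a11 a02 x w = q0 + q1 * x + a20 * x ^+ 2.
  by rewrite /quad /q0 /q1; ring.
have dq x : cdiff (fun x => quad a00 a10 a01 a20 a11 a02 x w) x (a10 + 2 * a20 * x + a11 * w).
  have H := cdiffD (cdiffD (cdiff_cst q0 x) (cdiffM (cdiff_cst q1 x) (cdiff_id x)))
     (cdiffM (cdiff_cst a20 x) (cdiffM (cdiff_id x) (cdiff_id x))).
  have E : 0 + (0 * id x + q1 * 1) + (0 * (id x * id x) + a20 * (1 * id x + id x * 1)) = a10 + 2 * a20 * x + a11 * w.
    by rewrite /q1 /id; ring.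
  by rewrite E in H; apply: (cdiff_near ltr01 _ H) => h _; rewrite qE expr2.
have dqN x : cdiff (fun x => - quad a00 a10 a01 a20 a11 a02 x w) x (- (a10 + 2 * a20 * x + a11 * w)).
  have := cdiffM (cdiff_cst (-1) x) (dq x); rewrite mul0r add0r mulN1r.
  by apply: (cdiff_near ltr01) => h _; rewrite mulN1r.
pose rho x := f x w - quad a00 a10 a01 a20 a11 a02 x w.
have drho k : in_square d k -> exists l, cdiff rho (z + k) l.
  move=> kb; have [l' dl'] := df (z + k) w (le_trans (zr k kb) d3) wr.
  by eexists; exact: cdiffD dl' (dqN (z + k)).
have M0 : 0 <= C * (4 * d) ^+ 3.
  by rewrite mulr_ge0 // exprn_ge0 // mulr_ge0 // ltW.
have rhoM k : on_square d k -> normc (rho (z + k)) <= C * (4 * d) ^+ 3.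
  move=> /on_square_in/zr kb; apply: le_trans (fC _ _ (le_trans kb d3) wr) _.
  rewrite ler_wpM2l // lerXn2r ?nnegrE ?addr_ge0 ?normc_ge0 //; lra.
have := cauchy_derivative d0 drho M0 rhoM (cdiffD dl (dqN z)).
by have -> : 4 * (C * (4 * d) ^+ 3) / d = 256 * C * d ^+ 2 by field; rewrite gt_eqF.
Qed.

End Quadratic.

Section LocalPower.
Context {R : realType}.
Variables (H : C2 R -> C2 R) (A : set (C2 R)).
Hypotheses (A0 : open_nbhs (0 : C2 R) A) (hH : holomorphic_on A H).

(** Selecting the component by a boolean makes it possible to treat both
    components of the map at once. *)
Definition coordC2 (b : bool) (p : C2 R) : R[i] := if b then p.1 else p.2.
Definition coordfun (b : bool) (z w : R[i]) : R[i] := coordC2 b (H (z, w)).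

Lemma dir10 (p : C2 R) (t : R[i]) : p + t *: ((1, 0) : C2 R) = (p.1 + t, p.2).
Proof. by case: p => a b; congr pair; rewrite /= /GRing.scale /= ?mulr1 ?mulr0 ?addr0. Qed.
Lemma dir01 (p : C2 R) (t : R[i]) : p + t *: ((0, 1) : C2 R) = (p.1, p.2 + t).
Proof. by case: p => a b; congr pair; rewrite /= /GRing.scale /= ?mulr1 ?mulr0 ?addr0. Qed.

(** The factor 2 leaves room for Taylor expansions centred at points
    of the smaller square. *)
Lemma local_box : exists s M : R, [/\ 0 < s, 0 <= M,
  forall z w, in_square (2 * s) z -> in_square (2 * s) w -> A (z, w) &
  forall b z w, in_square (2 * s) z -> in_square (2 * s) w -> normc (coordfun b z w) <= M].
Proof.
have [oA A00] := A0.
have /near_C2[r r0 rP] : \forall p \near (0 : C2 R), A p by exact: open_nbhs_nbhs.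
have cH : {for 0, continuous H} by apply: differentiable_continuous; exact: hH.
have /cvgrPdist_lt/(_ (1%:C)) := cH; rewrite ltcR => /(_ ltr01)/near_C2[r' r'0 r'P].
pose m := Num.min r r'; have m0 : 0 < m by rewrite lt_min r0.
(* A point of the square of half-side 2 m / 5 has modulus at most 4 m / 5 < m. *)
exists (m / 5), (normc (H 0).1 + normc (H 0).2 + 1).
have bx z : in_square (2 * (m / 5)) z -> normc z < m.
  by move=> /in_square_normc h; apply: le_lt_trans h _; lra.
split; first exact: divr_gt0.
- by rewrite !addr_ge0 ?normc_ge0.
- move=> z w /bx; rewrite lt_min => /andP[h1 _] /bx; rewrite lt_min => /andP[h2 _].
  by have := rP z w h1 h2; rewrite !add0r.
- move=> b z w /bx; rewrite lt_min => /andP[_ h1] /bx; rewrite lt_min => /andP[_ h2].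
  have := r'P z w h1 h2; rewrite !add0r C2_norm_lt /= => /andP[k1 k2].
  have n1 := normc_ge0 (H 0).1; have n2 := normc_ge0 (H 0).2.
  rewrite /coordfun /coordC2; case: b.
    have := normcBD (H (z, w)).1 (H 0).1; rewrite normcB; lra.
  have := normcBD (H (z, w)).2 (H 0).2; rewrite normcB; lra.
Qed.

Lemma coordfun_dz z w : A (z, w) ->
  forall b, cdiff ((coordfun b)^~ w) z (coordC2 b ('D_((1, 0) : C2 R) H (z, w))).
Proof.
move=> Azw; have [h1 h2] := derivable_cdiff (@diff_derivable _ _ _ H (z, w) ((1, 0) : C2 R) (hH Azw)).
case; rewrite /coordfun /coordC2.
  by move=> e /h1[d d0 dP]; exists d => // h /dP; rewrite scale0r addr0 add0r dir10.
by move=> e /h2[d d0 dP]; exists d => // h /dP; rewrite scale0r addr0 add0r dir10.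
Qed.

Lemma coordfun_dw z w : A (z, w) ->
  forall b, cdiff (coordfun b z) w (coordC2 b ('D_((0, 1) : C2 R) H (z, w))).
Proof.
move=> Azw; have [h1 h2] := derivable_cdiff (@diff_derivable _ _ _ H (z, w) ((0, 1) : C2 R) (hH Azw)).
case; rewrite /coordfun /coordC2.
  by move=> e /h1[d d0 dP]; exists d => // h /dP; rewrite scale0r addr0 add0r dir01.
by move=> e /h2[d d0 dP]; exists d => // h /dP; rewrite scale0r addr0 add0r dir01.
Qed.

Variables (s M : R).
Hypotheses (s0 : 0 < s) (M0 : 0 <= M).
Hypothesis boxA : forall z w, in_square (2 * s) z -> in_square (2 * s) w -> A (z, w).
Hypothesis boxM : forall b z w, in_square (2 * s) z -> in_square (2 * s) w -> normc (coordfun b z w) <= M.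

Definition jet_coef b := tcoef2 (coordfun b) s.

Lemma coordfun_taylor b z w N : normc z <= s / 2 -> normc w <= s / 2 ->
  normc (coordfun b z w - \sum_(m < N) \sum_(n < N) jet_coef b m n * z ^+ m * w ^+ n)
    <= 64 * M * ((normc z / s) ^+ N + (normc w / s) ^+ N).
Proof.
apply: cauchy_taylor2 => //; try by move=> *; exact: boxM.
- by move=> z' w' hz hw; eexists; apply: coordfun_dz; exact: boxA.
- by move=> z' w' hz hw; eexists; apply: coordfun_dw; exact: boxA.
Qed.

Lemma jet_coef00 b : jet_coef b 0 0 = coordfun b 0 0.
Proof.
have z0 : normc (0 : R[i]) <= s / 2 by rewrite normc0 divr_ge0 // ltW.
have := coordfun_taylor b 1 z0 z0; rewrite !big_ord1 !expr0 !mulr1 normc0 mul0r expr1 addr0 mulr0 => h.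
by apply/esym/eqP; rewrite -subr_eq0 -normc_eq0 eq_le h normc_ge0.
Qed.

Let quadb b := quad (jet_coef b 0 0) (jet_coef b 1 0) (jet_coef b 0 1) (jet_coef b 2 0) (jet_coef b 1 1) (jet_coef b 0 2).

(** The expansion of order 3 in each variable contains three monomials of
    degree larger than 2, which go into the error term. *)
Lemma coordfun_quad b : exists2 C : R, 0 <= C & forall z w, normc z <= s / 2 -> normc w <= s / 2 ->
  normc (coordfun b z w - quadb b z w) <= C * (normc z + normc w) ^+ 3.
Proof.
pose K := normc (jet_coef b 2 1) + normc (jet_coef b 1 2) + normc (jet_coef b 2 2) * s.
have K0 : 0 <= K by rewrite !addr_ge0 ?mulr_ge0 ?normc_ge0 // ltW.
have P0 : 0 <= 64 * M / s ^+ 3 := divr_ge0 (mulr_ge0 (ler0n _ 64) M0) (exprn_ge0 3 (ltW s0)).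
exists (64 * M / s ^+ 3 + K) => [|z w zs ws]; first exact: addr_ge0.
set x := normc z; set y := normc w.
have x0 : 0 <= x := normc_ge0 z; have y0 : 0 <= y := normc_ge0 w.
have -> : coordfun b z w - quadb b z w =
  (coordfun b z w - \sum_(m < 3) \sum_(n < 3) jet_coef b m n * z ^+ m * w ^+ n) +
  (jet_coef b 2 1 * (z ^+ 2 * w) + jet_coef b 1 2 * (z * w ^+ 2) + jet_coef b 2 2 * (z ^+ 2 * w ^+ 2)).
  rewrite /quadb /quad; move: (coordfun b z w) (jet_coef b) => u c.
  by rewrite !(big_ord_recr, big_ord0) /=; ring.
apply: le_trans (normcD _ _) _; rewrite mulrDl; apply: lerD.
  apply: le_trans (coordfun_taylor b 3 zs ws) _; rewrite -/x -/y.
  have -> : 64 * M * ((x / s) ^+ 3 + (y / s) ^+ 3) = 64 * M / s ^+ 3 * (x ^+ 3 + y ^+ 3).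
    by field; rewrite gt_eqF.
  rewrite ler_wpM2l //.
  have := mulr_ge0 x0 y0; nra.
have n1 : normc (z ^+ 2 * w) = x ^+ 2 * y by rewrite normcM normcX.
have n2 : normc (z * w ^+ 2) = x * y ^+ 2 by rewrite normcM normcX.
have n3 : normc (z ^+ 2 * w ^+ 2) = x ^+ 2 * y ^+ 2 by rewrite normcM !normcX.
have xyle : x ^+ 2 * y <= (x + y) ^+ 3 by have := mulr_ge0 x0 y0; nra.
have xyle' : x * y ^+ 2 <= (x + y) ^+ 3 by have := mulr_ge0 x0 y0; nra.
have xyle2 : x ^+ 2 * y ^+ 2 <= s * (x + y) ^+ 3.
  have -> : x ^+ 2 * y ^+ 2 = y * (x ^+ 2 * y) by ring.
  by apply: ler_pM => //; rewrite ?mulr_ge0 ?sqr_ge0 // (le_trans ws) // ler_pdivrMr // ler_peMr ?(ltW s0) // ler1n.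
rewrite /K !mulrDl; apply: le_trans (normcD _ _) _; apply: lerD.
  apply: le_trans (normcD _ _) _; apply: lerD.
    by rewrite normcM ler_wpM2l ?normc_ge0 // n1.
  by rewrite normcM ler_wpM2l ?normc_ge0 // n2.
by rewrite normcM n3 -[leRHS]mulrA ler_wpM2l ?normc_ge0.
Qed.

(** Second derivatives are derivatives of the first ones, so an approximation
    of the first derivatives by affine functions is required. *)
Lemma derive_z_affine : exists2 C : R, 0 <= C & exists2 r : R, 0 < r & forall b z w d, 0 < d -> d <= r ->
  normc z <= d -> normc w <= d ->
  normc (coordC2 b ('D_((1, 0) : C2 R) H (z, w)) -
     (jet_coef b 1 0 + 2 * jet_coef b 2 0 * z + jet_coef b 1 1 * w)) <= C * d ^+ 2.
Proof.
have s2 : 0 < s / 2 by rewrite divr_gt0.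
have inb z : normc z <= s / 2 -> in_square (2 * s) z.
  by move=> h; apply: in_square_norm; have := ltW s0; lra.
have [K1 K10 h1] := coordfun_quad true; have [K2 K20 h2] := coordfun_quad false.
have p1 : 0 <= 256 * K1 := mulr_ge0 (ler0n _ 256) K10.
have p2 : 0 <= 256 * K2 := mulr_ge0 (ler0n _ 256) K20.
exists (256 * K1 + 256 * K2); first exact: addr_ge0.
exists (s / 2 / 3) => [|b z w d d0 dr zd wd]; first by rewrite divr_gt0.
have Azw : A (z, w) by apply: boxA; apply: inb; lra.
have dfb z' w' : normc z' <= s / 2 -> normc w' <= s / 2 -> exists l, cdiff ((coordfun b)^~ w') z' l.
  by move=> zz ww; eexists; apply: coordfun_dz; apply: boxA; exact: inb.
have Q C : 0 <= C -> (forall z w, normc z <= s / 2 -> normc w <= s / 2 ->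
  normc (coordfun b z w - quadb b z w) <= C * (normc z + normc w) ^+ 3) -> _ :=
  fun C0 h => @quad_deriv _ (coordfun b) _ _ _ _ _ _ C (s / 2) s2 C0 dfb h z w d _ d0 dr zd wd (coordfun_dz Azw b).
have d2 : 0 <= d ^+ 2 by rewrite sqr_ge0.
case: b dfb Q => dfb Q.
  by apply: le_trans (Q _ K10 h1) _; apply: ler_wpM2r d2 _ _ _; rewrite lerDl; exact: p2.
by apply: le_trans (Q _ K20 h2) _; apply: ler_wpM2r d2 _ _ _; rewrite lerDr; exact: p1.
Qed.

(** [derive_z_affine] with the roles of the variables exchanged. *)
Lemma derive_w_affine : exists2 C : R, 0 <= C & exists2 r : R, 0 < r & forall b z w d, 0 < d -> d <= r ->
  normc z <= d -> normc w <= d ->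
  normc (coordC2 b ('D_((0, 1) : C2 R) H (z, w)) -
     (jet_coef b 0 1 + 2 * jet_coef b 0 2 * w + jet_coef b 1 1 * z)) <= C * d ^+ 2.
Proof.
have s2 : 0 < s / 2 by rewrite divr_gt0.
have inb z : normc z <= s / 2 -> in_square (2 * s) z.
  by move=> h; apply: in_square_norm; have := ltW s0; lra.
have [K1 K10 h1] := coordfun_quad true; have [K2 K20 h2] := coordfun_quad false.
have p1 : 0 <= 256 * K1 := mulr_ge0 (ler0n _ 256) K10.
have p2 : 0 <= 256 * K2 := mulr_ge0 (ler0n _ 256) K20.
exists (256 * K1 + 256 * K2); first exact: addr_ge0.
exists (s / 2 / 3) => [|b z w d d0 dr zd wd]; first by rewrite divr_gt0.
have Azw : A (z, w) by apply: boxA; apply: inb; lra.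
have dfb z' w' : normc z' <= s / 2 -> normc w' <= s / 2 -> exists l, cdiff ((fun a b' => coordfun b b' a)^~ w') z' l.
  by move=> zz ww; eexists; apply: coordfun_dw; apply: boxA; exact: inb.
have Q C : 0 <= C -> (forall z w, normc z <= s / 2 -> normc w <= s / 2 ->
  normc (coordfun b z w - quadb b z w) <= C * (normc z + normc w) ^+ 3) ->
   normc (coordC2 b ('D_((0, 1) : C2 R) H (z, w)) -
     (jet_coef b 0 1 + 2 * jet_coef b 0 2 * w + jet_coef b 1 1 * z)) <= 256 * C * d ^+ 2.
  move=> C0 h; apply: (@quad_deriv _ (fun a b' => coordfun b b' a) (jet_coef b 0 0) (jet_coef b 0 1) (jet_coef b 1 0)
    (jet_coef b 0 2) (jet_coef b 1 1) (jet_coef b 2 0) C (s / 2) s2 C0 dfb _ w z d _ d0 dr wd zd (coordfun_dw Azw b)).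
  move=> z' w' hz hw; have := h w' z' hw hz; rewrite [normc z' + _]addrC.
  have -> // : quadb b w' z' = quad (jet_coef b 0 0) (jet_coef b 0 1) (jet_coef b 1 0)
    (jet_coef b 0 2) (jet_coef b 1 1) (jet_coef b 2 0) z' w'.
  by rewrite /quadb /quad; move: (jet_coef b) => c; ring.
have d2 : 0 <= d ^+ 2 by rewrite sqr_ge0.
case: b dfb Q => dfb Q.
  by apply: le_trans (Q _ K10 h1) _; apply: ler_wpM2r d2 _ _ _; rewrite lerDl; exact: p2.
by apply: le_trans (Q _ K20 h2) _; apply: ler_wpM2r d2 _ _ _; rewrite lerDr; exact: p1.
Qed.

Lemma eq0_quadratic_bound (C r : R) (x : R[i]) : 0 <= C -> 0 < r ->
  (forall d, 0 < d -> d <= r -> normc x <= C * d ^+ 2) -> x = 0.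
Proof.
move=> C0 r0 h; apply/eqP; rewrite -normc_eq0 eq_le normc_ge0 andbT.
apply/ler_addgt0Pr => e e0; rewrite add0r.
have K0 : 0 < C + 1 by rewrite ltr_wpDl.
pose d := Num.min (Num.min r 1) (e / (C + 1)).
have d0 : 0 < d by rewrite !lt_min r0 ltr01 divr_gt0.
have dr : d <= r by rewrite !ge_min lexx.
have d1 : d <= 1 by rewrite !ge_min lexx orbT.
have de : d * (C + 1) <= e by rewrite -ler_pdivlMr // ge_min lexx orbT.
by apply: le_trans (h d d0 dr) _; nra.
Qed.

(** An affine approximation with an error that is quadratic in the radius
    contains the derivative at 0. *)
Lemma lin_cdiff (g : R[i] -> R[i]) (c l : R[i]) (C r : R) : 0 <= C -> 0 < r ->
  (forall t d, 0 < d -> d <= r -> normc t <= d -> normc (g t - (c + l * t)) <= C * d ^+ 2) ->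
  cdiff g 0 l.
Proof.
move=> C0 r0 h; have g0 : g 0 = c.
  apply/eqP; rewrite -subr_eq0; apply/eqP; apply: (eq0_quadratic_bound C0 r0) => d d0 dr.
  by have := h 0 d d0 dr; rewrite mulr0 addr0 normc0; apply; exact: ltW.
move=> e e0; have K0 : 0 < C + 1 by rewrite ltr_wpDl.
exists (Num.min r (e / (C + 1))); first by rewrite lt_min r0 divr_gt0.
move=> t; rewrite lt_min => /andP[tr]; rewrite ltr_pdivlMr // => te; rewrite add0r g0.
have [->|t0] := eqVneq t 0; first by rewrite g0 subrr mulr0 subr0 normc0 mulr0.
have nt : 0 < normc t by rewrite normc_gt0.
have := h t (normc t) nt (ltW tr) (lexx _); rewrite opprD addrA => H1.
apply: le_trans H1 _; rewrite expr2 mulrA ler_wpM2r ?(ltW nt) //.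
by nra.
Qed.

Lemma eq_coordC2 (p q : C2 R) : (forall b, coordC2 b p = coordC2 b q) -> p = q.
Proof. by case: p q => a b [c d] h; congr pair; [exact: (h true)|exact: (h false)]. Qed.

Lemma derive_at0 :
  [/\ 'D_((1, 0) : C2 R) H 0 = (jet_coef true 1 0, jet_coef false 1 0),
      'D_((0, 1) : C2 R) H 0 = (jet_coef true 0 1, jet_coef false 0 1),
      'D_((1, 0) : C2 R) ('D_((1, 0) : C2 R) H) 0 = (2 * jet_coef true 2 0, 2 * jet_coef false 2 0),
      'D_((1, 0) : C2 R) ('D_((0, 1) : C2 R) H) 0 = (jet_coef true 1 1, jet_coef false 1 1) &
      'D_((0, 1) : C2 R) ('D_((0, 1) : C2 R) H) 0 = (2 * jet_coef true 0 2, 2 * jet_coef false 0 2)].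
Proof.
have [C C0 [r r0 hz]] := derive_z_affine; have [C' C'0 [r' r'0 hw]] := derive_w_affine.
have nd0 d : 0 < d -> normc (0 : R[i]) <= d by rewrite normc0 => /ltW.
have e0 : (0 : C2 R) = (0, 0) by [].
split.
- apply: eq_coordC2 => b; apply/eqP; rewrite -subr_eq0; apply/eqP.
  apply: (eq0_quadratic_bound C0 r0) => d d0 dr.
  have := hz b 0 0 d d0 dr (nd0 d d0) (nd0 d d0); rewrite !mulr0 !addr0; by case: b.
- apply: eq_coordC2 => b; apply/eqP; rewrite -subr_eq0; apply/eqP.
  apply: (eq0_quadratic_bound C'0 r'0) => d d0 dr.
  have := hw b 0 0 d d0 dr (nd0 d d0) (nd0 d d0); rewrite !mulr0 !addr0; by case: b.
- apply: cdiff_derive => /=.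
    apply: (@lin_cdiff _ (jet_coef true 1 0) _ C r) => // t d d0 dr td; rewrite dir10 /= add0r.
    by have := hz true t 0 d d0 dr td (nd0 d d0); rewrite mulr0 addr0.
  apply: (@lin_cdiff _ (jet_coef false 1 0) _ C r) => // t d d0 dr td; rewrite dir10 /= add0r.
  by have := hz false t 0 d d0 dr td (nd0 d d0); rewrite mulr0 addr0.
- apply: cdiff_derive => /=.
    apply: (@lin_cdiff _ (jet_coef true 0 1) _ C' r') => // t d d0 dr td; rewrite dir10 /= add0r.
    by have := hw true t 0 d d0 dr td (nd0 d d0); rewrite mulr0 addr0.
  apply: (@lin_cdiff _ (jet_coef false 0 1) _ C' r') => // t d d0 dr td; rewrite dir10 /= add0r.
  by have := hw false t 0 d d0 dr td (nd0 d d0); rewrite mulr0 addr0.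
- apply: cdiff_derive => /=.
    apply: (@lin_cdiff _ (jet_coef true 0 1) _ C' r') => // t d d0 dr td; rewrite dir01 /= add0r.
    by have := hw true 0 t d d0 dr (nd0 d d0) td; rewrite mulr0 addr0.
  apply: (@lin_cdiff _ (jet_coef false 0 1) _ C' r') => // t d d0 dr td; rewrite dir01 /= add0r.
  by have := hw false 0 t d d0 dr (nd0 d d0) td; rewrite mulr0 addr0.
Qed.

(** By [derive_at0] the coefficients of order 1 and 2 are, up to the factor
    2 of the pure second derivatives, the partial derivatives prescribed by the
    tangency. *)
Lemma tangent_coefs : H 0 = 0 -> tangent_to_id 2 H ->
  forall m n, (m + n <= 2)%N ->
    jet_coef true m n = ((m == 1%N) && (n == 0%N))%:R /\ jet_coef false m n = ((m == 0%N) && (n == 1%N))%:R.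
Proof.
move=> H0 Ht; have [h10 h01 h20 h11 h02] := derive_at0.
have id1 (v : C2 R) : 'D_v idfun = (fun=> v) :> (C2 R -> C2 R) by apply/funext => p; exact: derive_id.
have id2 (u v : C2 R) : 'D_u ('D_v idfun) (0 : C2 R) = 0 :> C2 R by rewrite id1 derive_cst.
have t10 : 'D_((1, 0) : C2 R) H 0 = (1, 0) := etrans (Ht 1%N 0%N isT) (congr1 (@^~ 0) (id1 (1, 0))).
have t01 : 'D_((0, 1) : C2 R) H 0 = (0, 1) := etrans (Ht 0%N 1%N isT) (congr1 (@^~ 0) (id1 (0, 1))).
have t20 : 'D_((1, 0) : C2 R) ('D_((1, 0) : C2 R) H) 0 = 0 := etrans (Ht 2 0%N isT) (id2 (1, 0) (1, 0)).
have t11 : 'D_((1, 0) : C2 R) ('D_((0, 1) : C2 R) H) 0 = 0 := etrans (Ht 1%N 1%N isT) (id2 (1, 0) (0, 1)).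
have t02 : 'D_((0, 1) : C2 R) ('D_((0, 1) : C2 R) H) 0 = 0 := etrans (Ht 0%N 2 isT) (id2 (0, 1) (0, 1)).
rewrite h10 in t10; rewrite h01 in t01; rewrite h20 in t20; rewrite h11 in t11; rewrite h02 in t02.
have d2 (x : R[i]) : 2 * x = 0 -> x = 0 by move=> /eqP; rewrite mulf_eq0 pnatr_eq0 /= => /eqP.
have a10 : jet_coef true 1 0 = 1 := congr1 fst t10; have b10 : jet_coef false 1 0 = 0 := congr1 snd t10.
have a01 : jet_coef true 0 1 = 0 := congr1 fst t01; have b01 : jet_coef false 0 1 = 1 := congr1 snd t01.
have a20 : jet_coef true 2 0 = 0 := d2 _ (congr1 fst t20); have b20 : jet_coef false 2 0 = 0 := d2 _ (congr1 snd t20).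
have a11 : jet_coef true 1 1 = 0 := congr1 fst t11; have b11 : jet_coef false 1 1 = 0 := congr1 snd t11.
have a02 : jet_coef true 0 2 = 0 := d2 _ (congr1 fst t02); have b02 : jet_coef false 0 2 = 0 := d2 _ (congr1 snd t02).
have a00 : jet_coef true 0 0 = 0 by rewrite jet_coef00 /coordfun /coordC2 H0.
have b00 : jet_coef false 0 0 = 0 by rewrite jet_coef00 /coordfun /coordC2 H0.
move: a00 b00 a10 b10 a01 b01 a20 b20 a11 b11 a02 b02.
move: (jet_coef true) (jet_coef false) => P Q a00 b00 a10 b10 a01 b01 a20 b20 a11 b11 a02 b02.
by case=> [|[|[|m]]] [|[|[|n]]] //= _; split.
Qed.

End LocalPower.

(** * Lipschitz estimates for functions of class C^1 *)

Section DirectionalMVT.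
Context {R : realType}.

Lemma dir_is_derive (V : normedModType R) (f : V -> R) (x v : V) (u : R) :
  derivable f (x + u *: v) v ->
  is_derive u (1 : R) (fun u => f (x + u *: v)) ('D_v f (x + u *: v)).
Proof.
move=> df; have E : (fun h : R => h^-1 *: (f (x + (h *: 1 + u) *: v) - f (x + u *: v))) =
   (fun h => h^-1 *: (f (h *: v + (x + u *: v)) - f (x + u *: v))).
  apply/funext => h; congr (_ *: (f _ - _)).
  have -> : h *: (1 : R) = h by rewrite /GRing.scale /= mulr1.
  by rewrite scalerDl addrCA.
apply: DeriveDef.
  rewrite /derivable E; exact: df.
by rewrite /derive E.
Qed.

(** The mean value theorem on the segment from x to x + t v, which stays in
    the ball; the continuity of the derivative at 0 bounds it on a small
    ball. *)
Lemma dir_lip (V : normedModType R) (f : V -> R) (v : V) (A : set V) (K : R) :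
  open_nbhs 0 A -> (forall x, A x -> derivable f x v) ->
  {for 0, continuous ('D_v f)} -> `|'D_v f 0| < K ->
  exists2 d : R, 0 < d & forall x t, `|x| < d -> `|x + t *: v| < d ->
    `|f (x + t *: v) - f x| <= K * `|t|.
Proof.
move=> A0 df cD DK.
have nA : \forall x \near (0 : V), A x by exact: open_nbhs_nbhs.
have nK : \forall x \near (0 : V), `|'D_v f x| < K.
  by apply: (cvgr_lt (`|'D_v f 0|)) => //; exact: cvg_norm.
have /nbhs_ballP[d /= d0 dP] : \forall x \near (0 : V), A x /\ `|'D_v f x| < K.
  by near=> x; split; near: x.
have {}dP x : `|x| < d -> A x /\ `|'D_v f x| < K.
  by move=> xd; apply: dP; rewrite -ball_normE /= sub0r normrN.
exists d => // x t.
wlog t0 : x t / 0 <= t.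
  move=> W xd xtd; have [t0|/ltW t0] := leP 0 t; first exact: W.
  have := W (x + t *: v) (- t); rewrite oppr_ge0 scaleNr addrK normrN distrC; exact.
move=> xd xtd; pose g u := f (x + u *: v).
have seg u : 0 <= u <= t -> `|x + u *: v| < d.
  move=> /andP[u0 ut]; have [tE|tn0] := eqVneq t 0.
    have -> : u = 0 by apply/eqP; rewrite eq_le u0 andbT -tE.
    by rewrite scale0r addr0.
  have tp : 0 < t by rewrite lt_def tn0.
  have -> : x + u *: v = (1 - u / t) *: x + (u / t) *: (x + t *: v).
    by rewrite scalerDr scalerA divfK // addrA -scalerDl subrK scale1r.
  have q0 : 0 <= u / t by rewrite divr_ge0.
  have q1 : u / t <= 1 by rewrite ler_pdivrMr // mul1r.
  apply: le_lt_trans (ler_normD _ _) _; rewrite (normrZ (1 - u / t)) (normrZ (u / t)) (ger0_norm q0) ger0_norm ?subr_ge0 //.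
  have m1 : Num.max `|x| `|x + t *: v| < d by rewrite gt_max xd.
  apply: le_lt_trans m1; move: q0 q1; set q := u / t; set m := Num.max _ _ => q0 q1.
  have -> : m = (1 - q) * m + q * m by ring.
  by apply: lerD; apply: ler_wpM2l; rewrite ?subr_ge0 ?le_max ?lexx ?orbT.
have dg u : 0 <= u <= t -> is_derive u 1 g ('D_v f (x + u *: v)).
  by move=> /seg/dP[Au _]; apply: dir_is_derive; exact: df.
have [c ct E] : exists2 c, c \in `[0, t]%R & g t - g 0 = 'D_v f (x + c *: v) * (t - 0).
  apply: (@MVT_segment R g (fun u => 'D_v f (x + u *: v)) 0 t t0).
    move=> u; rewrite in_itv /= => /andP[u0 ut]; apply: dg.
    by rewrite (ltW u0) (ltW ut).
  apply: continuous_in_subspaceT => u; rewrite inE /= in_itv /= => /dg du.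
  apply: differentiable_continuous; apply/derivable1_diffP.
  exact: (@ex_derive _ _ _ _ _ _ _ du).
move: E; rewrite /g scale0r addr0 subr0 => ->.
rewrite normrM ler_wpM2r //; move: ct; rewrite in_itv /= => /seg/dP[_ /ltW //].
Unshelve. all: by end_near. Qed.

Lemma class_C_dir (V : normedModType R) n (f : V -> R) : class_C_near0 n.+1 f ->
  exists2 A : set V, open_nbhs 0 A & forall v, (forall x, A x -> derivable f x v) /\
    {for 0, continuous ('D_v f)}.
Proof.
case=> A A0 [_ h]; exists A => // v; have [h1 h2] := h v; split => //.
case: n {h} h2 => [|n] [h2 _]; by apply: h2; case: A0.
Qed.

Lemma class_C_lip (V : normedModType R) n (f : V -> R) (v : V) : class_C_near0 n.+1 f ->
  exists K d : R, [/\ 0 <= K, 0 < d & forall x t, `|x| < d -> `|x + t *: v| < d ->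
    `|f (x + t *: v) - f x| <= K * `|t|].
Proof.
move=> /class_C_dir[A A0 /(_ v)[h1 h2]].
have [|d d0 dP] := @dir_lip V f v A (`|'D_v f 0| + 1) A0 h1 h2; first by rewrite ltrDl.
by exists (`|'D_v f 0| + 1), d; split => //; rewrite addr_ge0.
Qed.

(** The functions of two variables, below, are seen as functions of three
    variables that do not depend on the last one; this gives a single path to
    the estimates of [lip0]. *)
Definition lip3 (g : R -> R -> R -> R) := exists K d : R, [/\ 0 <= K, 0 < d &
  forall a b c a' b' c', `|a| < d -> `|b| < d -> `|c| < d -> `|a'| < d -> `|b'| < d -> `|c'| < d ->
    `|g a' b' c' - g a b c| <= K * (`|a' - a| + `|b' - b| + `|c' - c|)].

Lemma class_C_lip2 n (f : R * R -> R) : class_C_near0 n.+1 f -> lip3 (fun a b _ => f (a, b)).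
Proof.
move=> h; have [K [d [K0 d0 h1]]] := class_C_lip ((1, 0) : R * R) h.
have [K' [d' [K'0 d'0 h2]]] := class_C_lip ((0, 1) : R * R) h.
exists (K + K'), (Num.min d d'); split; [exact: addr_ge0|by rewrite lt_min d0|].
move=> a b c a' b' c'; rewrite !lt_min.
move=> /andP[a1 a2] /andP[b1 b2] _ /andP[a1' a2'] /andP[b1' b2'] _.
have nE (x y : R) e : `|x| < e -> `|y| < e -> `|(x, y)| < e.
  by move=> h3 h4; rewrite prod_normE gt_max h3 h4.
have e1 : (a, b) + (a' - a) *: ((1, 0) : R * R) = (a', b).
  by congr pair; rewrite /= /GRing.scale /=; ring.
have e2 : (a', b) + (b' - b) *: ((0, 1) : R * R) = (a', b').
  by congr pair; rewrite /= /GRing.scale /=; ring.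
have := h1 (a, b) (a' - a); rewrite e1 => /(_ (nE _ _ _ a1 b1) (nE _ _ _ a1' b1)) H1.
have := h2 (a', b) (b' - b); rewrite e2 => /(_ (nE _ _ _ a2' b2) (nE _ _ _ a2' b2')) H2.
have -> : f (a', b') - f (a, b) = (f (a', b') - f (a', b)) + (f (a', b) - f (a, b)) by ring.
apply: le_trans (ler_normD _ _) _.
have := normr_ge0 (a' - a); have := normr_ge0 (b' - b); have := normr_ge0 (c' - c); nra.
Qed.

Lemma class_C_lip3 n (f : (R * R) * R -> R) : class_C_near0 n.+1 f ->
  lip3 (fun a b c => f ((a, b), c)).
Proof.
move=> h; have [K [d [K0 d0 h1]]] := class_C_lip (((1, 0), 0) : R * R * R) h.
have [K' [d' [K'0 d'0 h2]]] := class_C_lip (((0, 1), 0) : R * R * R) h.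
have [K2 [d2 [K20 d20 h3]]] := class_C_lip (((0, 0), 1) : R * R * R) h.
exists (K + K' + K2), (Num.min (Num.min d d') d2).
split; [by rewrite !addr_ge0|by rewrite !lt_min d0 d'0|].
move=> a b c a' b' c'; rewrite !lt_min => /andP[/andP[a1 a2] a3] /andP[/andP[b1 b2] b3]
 /andP[/andP[c1 c2] c3] /andP[/andP[a1' a2'] a3'] /andP[/andP[b1' b2'] b3'] /andP[/andP[c1' c2'] c3'].
have nE (x y z : R) e : `|x| < e -> `|y| < e -> `|z| < e -> `|((x, y), z)| < e.
  by move=> k1 k2 k3; rewrite !prod_normE !gt_max /= k1 k2 k3.
have e1 : ((a, b), c) + (a' - a) *: (((1, 0), 0) : R * R * R) = ((a', b), c).
  by congr (_, _, _); rewrite /= /GRing.scale /=; ring.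
have e2 : ((a', b), c) + (b' - b) *: (((0, 1), 0) : R * R * R) = ((a', b'), c).
  by congr (_, _, _); rewrite /= /GRing.scale /=; ring.
have e3 : ((a', b'), c) + (c' - c) *: (((0, 0), 1) : R * R * R) = ((a', b'), c').
  by congr (_, _, _); rewrite /= /GRing.scale /=; ring.
have := h1 ((a, b), c) (a' - a); rewrite e1 => /(_ (nE _ _ _ _ a1 b1 c1) (nE _ _ _ _ a1' b1 c1)) H1.
have := h2 ((a', b), c) (b' - b); rewrite e2 => /(_ (nE _ _ _ _ a2' b2 c2) (nE _ _ _ _ a2' b2' c2)) H2.
have := h3 ((a', b'), c) (c' - c); rewrite e3 => /(_ (nE _ _ _ _ a3' b3' c3) (nE _ _ _ _ a3' b3' c3')) H3.
have -> : f (a', b', c') - f (a, b, c) =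
  (f (a', b', c') - f (a', b', c)) + ((f (a', b', c) - f (a', b, c)) + (f (a', b, c) - f (a, b, c))) by ring.
apply: le_trans (ler_normD _ _) _.
have := ler_normD (f (a', b', c) - f (a', b, c)) (f (a', b, c) - f (a, b, c)).
have := normr_ge0 (a' - a); have := normr_ge0 (b' - b); have := normr_ge0 (c' - c); nra.
Qed.

(** A function that is O(t^2) has derivative 0 at 0, so its derivative is
    small near 0. *)
Lemma flat_lip n (f : R -> R) : class_C_near0 n.+1 f -> f =O_ (0 : R) (fun t : R => `|t| ^+ 2) ->
  f 0 = 0 /\ forall e : R, 0 < e -> exists2 d : R, 0 < d & forall a b, `|a| < d -> `|b| < d ->
    `|f b - f a| <= e * `|b - a|.
Proof.
move=> h /eqO_exP[k k0 /nbhs_ballP[r /= r0 kP]].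
have {}kP x : `|x| < r -> `|f x| <= k * `|x| ^+ 2.
  by move=> xr; have := kP x; rewrite -ball_normE /= sub0r normrN => /(_ xr); rewrite normrX normr_id.
have f0 : f 0 = 0.
  by apply/eqP; rewrite -normr_le0; have := kP 0; rewrite normr0 expr0n mulr0; apply.
split => // e e0; have [A A0 /(_ 1)[h1 h2]] := class_C_dir h.
have D0 : 'D_1 f 0 = 0.
  apply: (@derive_val _ _ _ _ _ _ _ (@is_derive1_eps _ f 0 0 _)) => e1 e10.
  have k1 : 0 < k + 1 by rewrite ltr_wpDl // ltW.
  exists (Num.min r (e1 / (k + 1))); first by rewrite lt_min r0 divr_gt0.
  move=> t; rewrite lt_min => /andP[tr]; rewrite ltr_pdivlMr // => te.
  rewrite add0r f0 mulr0 !subr0; apply: le_trans (kP t tr) _.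
  by have := normr_ge0 t; nra.
have [|d d0 dP] := @dir_lip R f 1 A e A0 h1 h2; first by rewrite D0 normr0.
exists d => // a b ad on_square.
have := dP a (b - a); rewrite /GRing.scale /= mulr1 addrC subrK; exact.
Qed.

End DirectionalMVT.

(** * The terms of higher weight in the defining function *)

Section Remainder.
Context {R : realType}.
Implicit Types (G : R[i] -> R -> R[i]) (z : R[i]) (s : R).

(** With z of size eps and s of size eps^d, the first part says that a change
    dz of z changes G by O(eps^d |dz|), against eps^(d-1) |dz| for the model
    polynomial; the second part says that a change ds of s changes G by
    o(|ds|).  So G is negligible in the limit. *)
Definition small_remainder (d : nat) G :=
  (exists C r : R, [/\ 0 <= C, 0 < r & forall z z' s, normc z < r -> normc z' < r -> `|s| < r ->
     normc (G z' s - G z s) <= C * (normc z ^+ d + normc z' ^+ d + `|s|) * normc (z' - z)]) /\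
  (forall e : R, 0 < e -> exists2 r : R, 0 < r & forall z s s', normc z < r -> `|s| < r -> `|s'| < r ->
     normc (G z s' - G z s) <= e * `|s' - s|).

Lemma small_remainder0 d : small_remainder d (fun _ _ => 0).
Proof.
split; first by exists 0, 1; split => // *; rewrite subrr normc0 !mul0r.
by move=> e e0; exists 1 => // *; rewrite subrr normc0 mulr_ge0 // ltW.
Qed.

Lemma small_remainderD d G G' : small_remainder d G -> small_remainder d G' ->
  small_remainder d (fun z s => G z s + G' z s).
Proof.
move=> [[C [r [C0 r0 h1]]] h2] [[C' [r' [C'0 r'0 h1']]] h2']; split.
  exists (C + C'), (Num.min r r'); split; [exact: addr_ge0|by rewrite lt_min r0|].
  move=> z z' s; rewrite !lt_min => /andP[a1 a2] /andP[b1 b2] /andP[c1 c2].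
  rewrite opprD addrACA; apply: le_trans (normcD _ _) _; rewrite !mulrDl -mulrDl -mulrDl.
  by apply: le_trans (lerD (h1 _ _ _ a1 b1 c1) (h1' _ _ _ a2 b2 c2)) _; rewrite -!mulrDl.
move=> e e0; have e2 : 0 < e / 2 by rewrite divr_gt0.
have [a a0 aP] := h2 _ e2; have [b b0 bP] := h2' _ e2.
exists (Num.min a b); first by rewrite lt_min a0.
move=> z s s'; rewrite !lt_min => /andP[a1 a2] /andP[b1 b2] /andP[c1 c2].
rewrite opprD addrACA; apply: le_trans (normcD _ _) _; rewrite [e]splitr mulrDl.
by apply: lerD; [exact: aP|exact: bP].
Qed.

Lemma small_remainder_sum d (I : Type) (r : seq I) (P : pred I) (F : I -> R[i] -> R -> R[i]) :
  (forall i, P i -> small_remainder d (F i)) ->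
  small_remainder d (fun z s => \sum_(i <- r | P i) F i z s).
Proof.
move=> h; elim: r => [|i r IH].
  have -> : (fun z s => \sum_(i <- [::] | P i) F i z s) = (fun _ _ => 0).
    by apply/funext => z; apply/funext => s; rewrite big_nil.
  exact: small_remainder0.
case Pi : (P i).
  have -> : (fun z s => \sum_(i <- i :: r | P i) F i z s) =
    (fun z s => F i z s + \sum_(i <- r | P i) F i z s).
    by apply/funext => z; apply/funext => s; rewrite big_cons Pi.
  by apply: small_remainderD => //; exact: h.
have -> // : (fun z s => \sum_(i <- i :: r | P i) F i z s) =
    (fun z s => \sum_(i <- r | P i) F i z s).
by apply/funext => z; apply/funext => s; rewrite big_cons Pi.
Qed.

Lemma small_remainder_Re d G : small_remainder d G -> small_remainder d (fun z s => (complex.Re (G z s))%:C).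
Proof.
have le_Re (x y : R[i]) : normc ((complex.Re x)%:C - (complex.Re y)%:C) <= normc (x - y).
  by rewrite -rmorphB normc_real -Re_sub Re_le_normc.
case=> [[C [r [C0 r0 h1]]] h2]; split.
  exists C, r; split => // z z' s hz hz' hs.
  by apply: le_trans (le_Re _ _) _; exact: h1.
move=> e /h2[r' r'0 hr']; exists r' => // z s s' hz hs hs'.
by apply: le_trans (le_Re _ _) _; exact: hr'.
Qed.

Lemma expn_lip i z z' (t : R) : normc z <= t -> normc z' <= t ->
  normc (z' ^+ i - z ^+ i) <= i%:R * t ^+ i.-1 * normc (z' - z).
Proof.
move=> zt zt'; have t0 : 0 <= t := le_trans (normc_ge0 _) zt.
elim: i => [|i IH]; first by rewrite !expr0 subrr normc0 !mul0r.
have -> : z' ^+ i.+1 - z ^+ i.+1 = z' ^+ i * (z' - z) + (z' ^+ i - z ^+ i) * z.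
  by rewrite !exprSr; ring.
apply: le_trans (normcD _ _) _; rewrite !normcM normcX /=.
have -> : i.+1%:R * t ^+ i * normc (z' - z) = t ^+ i * normc (z' - z) + i%:R * t ^+ i * normc (z' - z).
  by rewrite -[i.+1%:R]natr1; ring.
apply: lerD.
  by rewrite ler_wpM2r ?normc_ge0 // lerXn2r ?nnegrE ?normc_ge0.
case: i IH => [|i] IH; first by rewrite !expr0 subrr normc0 !mul0r.
have -> : i.+1%:R * t ^+ i.+1 * normc (z' - z) = (i.+1%:R * t ^+ i * normc (z' - z)) * t.
  by rewrite exprSr; ring.
by apply: ler_pM; rewrite ?normc_ge0.
Qed.

Lemma monomial_lip i j z z' (t : R) : normc z <= t -> normc z' <= t ->
  normc (z' ^+ i * conjc z' ^+ j - z ^+ i * conjc z ^+ j) <= (i + j)%:R * t ^+ (i + j).-1 * normc (z' - z).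
Proof.
move=> zt zt'; have t0 : 0 <= t := le_trans (normc_ge0 _) zt.
have -> : z' ^+ i * conjc z' ^+ j - z ^+ i * conjc z ^+ j =
  (z' ^+ i - z ^+ i) * conjc z' ^+ j + z ^+ i * (conjc z' ^+ j - conjc z ^+ j) by ring.
apply: le_trans (normcD _ _) _; rewrite !normcM !normcX normc_conj.
have cj : normc (conjc z' - conjc z) = normc (z' - z) by rewrite -rmorphB normc_conj.
have h1 := expn_lip i zt zt'.
have h2 : normc (conjc z' ^+ j - conjc z ^+ j) <= j%:R * t ^+ j.-1 * normc (z' - z).
  by rewrite -cj; apply: expn_lip; rewrite normc_conj.
have k1 : normc z' ^+ j <= t ^+ j by rewrite lerXn2r ?nnegrE ?normc_ge0.
have k2 : normc z ^+ i <= t ^+ i by rewrite lerXn2r ?nnegrE ?normc_ge0.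
have tp m : 0 <= t ^+ m by rewrite exprn_ge0.
have nz := normc_ge0 (z' - z).
apply: (@le_trans _ _ (i%:R * t ^+ i.-1 * normc (z' - z) * t ^+ j + t ^+ i * (j%:R * t ^+ j.-1 * normc (z' - z)))).
  by apply: lerD; apply: ler_pM; rewrite ?normc_ge0 ?exprn_ge0 ?normc_ge0.
rewrite le_eqVlt; apply/orP; left; apply/eqP.
have Ei : i%:R * t ^+ i.-1 * t ^+ j = i%:R * t ^+ (i + j).-1.
  case: i {k2 h1} => [|i]; first by rewrite !mul0r.
  by rewrite /= -mulrA -exprD.
have Ej : t ^+ i * (j%:R * t ^+ j.-1) = j%:R * t ^+ (i + j).-1.
  case: j {k1 h2 Ei} => [|j]; first by rewrite !mul0r mulr0.
  by rewrite addnS /= mulrCA -exprD.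
by rewrite natrD !mulrDl -Ei -Ej; ring.
Qed.

Lemma expn_lip_real l (s s' t : R) : `|s| <= t -> `|s'| <= t ->
  `|s' ^+ l - s ^+ l| <= l%:R * t ^+ l.-1 * `|s' - s|.
Proof.
move=> h h'; have := @expn_lip l s%:C s'%:C t.
by rewrite -!rmorphXn -!rmorphB !normc_real; apply.
Qed.

Definition lip0 G := exists K r : R, [/\ 0 <= K, 0 < r & forall z z' s s',
  normc z < r -> normc z' < r -> `|s| < r -> `|s'| < r ->
  normc (G z' s' - G z s) <= K * (normc (z' - z) + `|s' - s|)].

(** The first estimate comes from the factor s^l when l is not 0, and
    otherwise from the degree i + j > d of the monomial in z.  The second one
    comes from the factor of positive degree i + j in z. *)
Lemma small_remainder_monomial d i j l G : (0 < d)%N -> lip0 G -> (0 < i + j)%N -> (l = 0%N -> (d < i + j)%N) ->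
  small_remainder d (fun z s => z ^+ i * conjc z ^+ j * s%:C ^+ l * G z s).
Proof.
move=> d0 [K [r [K0 r0 GK]]] ij0 ijl; pose D := (i + j)%N.
have D0 : (0 < D)%N := ij0.
pose r1 := Num.min r 1.
have r10 : 0 < r1 by rewrite lt_min r0 ltr01.
pose B := normc (G 0 0) + K * 2.
have B0 : 0 <= B by rewrite addr_ge0 ?normc_ge0 ?mulr_ge0.
have GB z s : normc z < r1 -> `|s| < r1 -> normc (G z s) <= B.
  rewrite !lt_min => /andP[zr z1] /andP[sr s1].
  apply: le_trans (normcBD _ (G 0 0)) _; rewrite lerD2l.
  have := GK 0 z 0 s; rewrite normc0 normr0 => /(_ r0 zr r0 sr) h; apply: le_trans h _.
  by rewrite !subr0 ler_wpM2l //; lra.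
pose m z := z ^+ i * conjc z ^+ j.
have nm z : normc (m z) = normc z ^+ D by rewrite normcM !normcX normc_conj -exprD.
split.
  exists (D%:R * B + K), r1; split => // [|z z' s zr zr' sr].
    by rewrite addr_ge0 // mulr_ge0.
  have GBz' := GB z' s zr' sr.
  move: (zr) (zr') (sr); rewrite !lt_min => /andP[zr1 z1] /andP[zr1' z1'] /andP[sr1 s1].
  have G2 := GK z z' s s zr1 zr1' sr1 sr1; rewrite subrr normr0 addr0 in G2.
  pose t := Num.max (normc z) (normc z').
  have [zt zt'] : normc z <= t /\ normc z' <= t by rewrite !le_max !lexx orbT.
  have t0 : 0 <= t := le_trans (normc_ge0 _) zt.
  have t1 : t <= 1 by rewrite ge_max !ltW.
  have E : m z' * s%:C ^+ l * G z' s - m z * s%:C ^+ l * G z s =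
     s%:C ^+ l * ((m z' - m z) * G z' s + m z * (G z' s - G z s)) by ring.
  rewrite E normcM normcX normc_real.
  have inner : normc ((m z' - m z) * G z' s + m z * (G z' s - G z s)) <= (D%:R * B + K) * t ^+ D.-1 * normc (z' - z).
    apply: le_trans (normcD _ _) _; rewrite (normcM (m z' - m z)) (normcM (m z)) nm !mulrDl; apply: lerD.
      apply: (@le_trans _ _ (D%:R * t ^+ D.-1 * normc (z' - z) * B)).
        by apply: ler_pM; rewrite ?normc_ge0 //; exact: monomial_lip.
      by rewrite le_eqVlt; apply/orP; left; apply/eqP; ring.
    have zD : normc z ^+ D <= t ^+ D.-1.
      apply: (@le_trans _ _ (t ^+ D)); first by rewrite lerXn2r ?nnegrE ?normc_ge0.
      by rewrite -{1}(prednK D0) exprS ler_piMl ?exprn_ge0.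
    have -> : K * t ^+ D.-1 * normc (z' - z) = t ^+ D.-1 * (K * normc (z' - z)) by ring.
    by apply: ler_pM; rewrite ?exprn_ge0 ?normc_ge0.
  have DBK : 0 <= D%:R * B + K by rewrite addr_ge0 // mulr_ge0.
  have main : `|s| ^+ l * t ^+ D.-1 <= normc z ^+ d + normc z' ^+ d + `|s|.
    have zd : 0 <= normc z ^+ d by rewrite exprn_ge0 ?normc_ge0.
    have zd' : 0 <= normc z' ^+ d by rewrite exprn_ge0 ?normc_ge0.
    case: l ijl {E} => [|l] ijl.
      rewrite expr0 mul1r.
      have dD : (d <= D.-1)%N by rewrite -ltnS prednK //; exact: ijl.
      apply: (@le_trans _ _ (t ^+ d)); first by rewrite ler_wiXn2l.
      rewrite /t; have [_|_] := leP (normc z) (normc z'); first by rewrite addrAC lerDr addr_ge0.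
      by rewrite -addrA lerDl addr_ge0.
    apply: (@le_trans _ _ `|s|); last by rewrite lerDr addr_ge0.
    rewrite exprS -mulrA ler_piMr //.
    by rewrite mulr_ile1 ?exprn_ge0 ?exprn_ile1 // ltW.
  apply: le_trans (ler_wpM2l (exprn_ge0 l (normr_ge0 s)) inner) _.
  have -> : `|s| ^+ l * ((D%:R * B + K) * t ^+ D.-1 * normc (z' - z)) =
    (D%:R * B + K) * (`|s| ^+ l * t ^+ D.-1) * normc (z' - z) by ring.
  by rewrite ler_wpM2r ?normc_ge0 // ler_wpM2l.
move=> e e0; pose Q := l%:R * B + K + 1.
have Q0 : 0 < Q by rewrite ltr_wpDl // addr_ge0 // mulr_ge0.
exists (Num.min r1 (e / Q)); first by rewrite lt_min r10 divr_gt0.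
move=> z s s'; rewrite 3!(lt_min _ r1) => /andP[zr ze] /andP[sr _] /andP[sr' _].
have GBs' := GB z s' zr sr'.
move: (zr) (sr) (sr'); rewrite !lt_min => /andP[zr1 z1] /andP[sr1 s1] /andP[sr1' s1'].
have G2 := GK z z s s' zr1 zr1 sr1 sr1'; rewrite subrr normc0 add0r in G2.
have E : m z * s'%:C ^+ l * G z s' - m z * s%:C ^+ l * G z s =
  m z * ((s'%:C ^+ l - s%:C ^+ l) * G z s' + s%:C ^+ l * (G z s' - G z s)) by ring.
rewrite E normcM nm.
have inner : normc ((s'%:C ^+ l - s%:C ^+ l) * G z s' + s%:C ^+ l * (G z s' - G z s)) <= Q * `|s' - s|.
  apply: le_trans (normcD _ _) _; rewrite !normcM normcX normc_real -!rmorphXn -rmorphB normc_real.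
  apply: (@le_trans _ _ (l%:R * `|s' - s| * B + K * `|s' - s|)).
    apply: lerD; last first.
      rewrite -[leRHS]mul1r; apply: ler_pM; rewrite ?exprn_ge0 ?normc_ge0 //.
      by rewrite exprn_ile1 // ltW.
    apply: ler_pM; rewrite ?normc_ge0 //.
    have := @expn_lip_real l s s' 1 (ltW s1) (ltW s1'); by rewrite expr1n mulr1.
  by rewrite /Q; have := normr_ge0 (s' - s); nra.
have zD : normc z ^+ D <= e / Q.
  apply: le_trans (ltW ze); rewrite -(prednK D0) exprS ler_piMr ?normc_ge0 //.
  by rewrite exprn_ile1 ?normc_ge0 // ltW.
apply: le_trans (ler_pM _ _ zD inner) _; rewrite ?exprn_ge0 ?normc_ge0 //.
by rewrite mulrA divfK // gt_eqF.
Qed.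

Lemma lip0_ReIm G : lip3 (fun a b c => complex.Re (G (a +i* b) c)) ->
  lip3 (fun a b c => complex.Im (G (a +i* b) c)) -> lip0 G.
Proof.
move=> [K [r [K0 r0 h]]] [K' [r' [K'0 r'0 h']]].
exists (2 * (K + K')), (Num.min r r').
split; [by rewrite mulr_ge0 // addr_ge0|by rewrite lt_min r0|].
move=> [a b] [a' b'] s s'; set z := a +i* b; set z' := a' +i* b'.
rewrite !lt_min => /andP[z1 z2] /andP[z1' z2'] /andP[s1 s2] /andP[s1' s2'].
have A1 := le_lt_trans (Re_le_normc z) z1; have B1 := le_lt_trans (Im_le_normc z) z1.
have A2 := le_lt_trans (Re_le_normc z) z2; have B2 := le_lt_trans (Im_le_normc z) z2.
have A1' := le_lt_trans (Re_le_normc z') z1'; have B1' := le_lt_trans (Im_le_normc z') z1'.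
have A2' := le_lt_trans (Re_le_normc z') z2'; have B2' := le_lt_trans (Im_le_normc z') z2'.
have H := h a b s a' b' s' A1 B1 s1 A1' B1' s1'; have H' := h' a b s a' b' s' A2 B2 s2 A2' B2' s2'.
have Ra : `|a' - a| <= normc (z' - z) := Re_le_normc (z' - z).
have Ia : `|b' - b| <= normc (z' - z) := Im_le_normc (z' - z).
apply: le_trans (normc_le_ReIm _) _; rewrite Re_sub Im_sub.
rewrite -/z -/z' in H H'.
apply: le_trans (lerD H H') _; rewrite -mulrDl [2 * _]mulrC -mulrA ler_wpM2l ?addr_ge0 //.
by have := normr_ge0 (s' - s); lra.
Qed.

Lemma class_C_lip0_C n (f : R[i] -> R[i]) : class_C_near0_C n.+1 f -> lip0 (fun z _ => f z).
Proof. by move=> [/class_C_lip2 h /class_C_lip2 h']; exact: lip0_ReIm. Qed.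

Lemma class_C_lip0_CR n (f : R[i] -> R -> R[i]) : class_C_near0_CR n.+1 f -> lip0 f.
Proof. by move=> [/class_C_lip3 h /class_C_lip3 h']; exact: lip0_ReIm. Qed.

(** What the defining function contains besides - Re w and the model
    polynomial. *)
Definition defining_remainder (d : nat) (r0 : nat -> nat -> R[i] -> R[i])
    (rl : nat -> nat -> nat -> R[i] -> R -> R[i]) (theta1 : R -> R) (z : R[i]) (s : R) : R[i] :=
  \sum_(i < d.+2) \sum_(j < d.+2 | (i + j == d.+1)%N)
      z ^+ i * conjc z ^+ j * r0 i j z
  + \sum_(1 <= l < d) \sum_(i < d.+1) \sum_(j < d.+1 | (i + j == d - l)%N)
      z ^+ i * conjc z ^+ j * s%:C ^+ l * rl i j l z s
  + (theta1 s)%:C.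

Lemma small_remainder_ext d G G' : (forall z s, G z s = G' z s) -> small_remainder d G -> small_remainder d G'.
Proof. by move=> h; have -> : G = G' by apply/funext => z; apply/funext. Qed.

Lemma defining_remainder_small d n r0 rl theta1 : (0 < d)%N ->
  (forall i j, (i + j = d.+1)%N -> class_C_near0_C n.+1 (r0 i j)) ->
  (forall i j l, (1 <= l < d)%N -> (i + j = d - l)%N -> class_C_near0_CR n.+1 (rl i j l)) ->
  class_C_near0 n.+1 theta1 -> theta1 =O_ (0 : R) (fun t : R => `|t| ^+ 2) ->
  small_remainder d (defining_remainder d r0 rl theta1) /\ defining_remainder d r0 rl theta1 0 0 = 0.
Proof.
move=> d0 h0 hl ht hO; have [t0 tP] := flat_lip ht hO.
split.
  apply: small_remainderD; first apply: small_remainderD.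
  - apply: small_remainder_sum => i _; apply: small_remainder_sum => j /eqP ij.
    apply: (@small_remainder_ext _ (fun z s => z ^+ i * conjc z ^+ j * s%:C ^+ 0 * r0 i j z)).
      by move=> z s; rewrite expr0 mulr1.
    by apply: small_remainder_monomial => //; rewrite ?ij //; apply: class_C_lip0_C; exact: h0.
  - rewrite /index_iota; have H : forall l, (l \in iota 1 (d - 1)) -> (1 <= l < d)%N.
      by move=> l; rewrite mem_iota; lia.
    have -> : (fun z s => \sum_(l <- iota 1 (d - 1)) \sum_(i < d.+1) \sum_(j < d.+1 | (i + j == d - l)%N)
      z ^+ i * conjc z ^+ j * s%:C ^+ l * rl i j l z s) = (fun z s => \sum_(l <- iota 1 (d - 1) | (1 <= l < d)%N) \sum_(i < d.+1) \sum_(j < d.+1 | (i + j == d - l)%N)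
      z ^+ i * conjc z ^+ j * s%:C ^+ l * rl i j l z s).
      apply/funext => z; apply/funext => s; rewrite big_seq_cond [RHS]big_seq_cond.
      by apply: eq_bigl => l; case E : (l \in _) => //=; rewrite H.
    apply: small_remainder_sum => l ld; apply: small_remainder_sum => i _; apply: small_remainder_sum => j /eqP ij.
    apply: small_remainder_monomial => //; rewrite ?ij; try lia.
    by apply: class_C_lip0_CR; exact: hl.
  - split.
      by exists 0, 1; split => // *; rewrite subrr normc0 !mul0r.
    move=> e /tP[r r0' rP]; exists r => // z s s' _ sr sr'.
    by rewrite -rmorphB normc_real; exact: rP.
rewrite /defining_remainder t0 addr0 big1 ?add0r; last first.
  move=> i _; rewrite big1 // => j /eqP ij.
  case: (nat_of_ord i) ij => [|i'] ij; last by rewrite expr0n !mul0r.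
  by rewrite add0n in ij; rewrite ij rmorph0 !expr0n /= mulr0 mul0r.
rewrite big_nat big1 // => l ld; rewrite big1 // => i _; rewrite big1 // => j _.
by case: l ld => // l _; rewrite !rmorph0 exprS mul0r mulr0 mul0r.
Qed.

End Remainder.

(** * Weighted homogeneous parts *)

Section Expansion.
Context {R : realType}.

(** A Taylor expansion with an error bound whose constant C does not depend
    on N.  Orders 0 and 1 are left out so that this form is stable under
    subtracting a coordinate function, see [sum_sub_delta]. *)
Definition expands (Phi : R[i] -> R[i] -> R[i]) (c : nat -> nat -> R[i]) (C s : R) :=
  forall N z w, (1 < N)%N -> normc z <= s / 2 -> normc w <= s / 2 ->
  normc (Phi z w - \sum_(m < N) \sum_(n < N) c m n * z ^+ m * w ^+ n)
    <= C * ((normc z / s) ^+ N + (normc w / s) ^+ N).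

End Expansion.

Section WeightedPart.
Context {R : realType}.
Variables (d e nu : nat) (c : nat -> nat -> R[i]).
Hypothesis d0 : (0 < d)%N.

(** The monomials z^m w^n counted with weight nu are those with
    m + (d n + e) = nu; the shift e is 0 for the second component and d - 1
    for the first one. *)
Definition weight_coef n : R[i] := if (d * n + e <= nu)%N then c (nu - (d * n + e)) n else 0.
Definition weight_part (z w : R[i]) : R[i] := \sum_(n < nu.+1) weight_coef n * z ^+ (nu - (d * n + e)) * w ^+ n.

Lemma weight_part_double z w : \sum_(m < nu.+2) \sum_(n < nu.+2)
    (if (m + (d * n + e) == nu)%N then c m n * z ^+ m * w ^+ n else 0) = weight_part z w.
Proof.
rewrite exchange_big big_ord_recr /= [X in _ + X]big1 ?addr0 => [|m _]; last first.
  by rewrite ifF //; apply/eqP; nia.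
apply: eq_bigr => n _; rewrite /weight_coef; case: leqP => h; last first.
  by rewrite !mul0r big1 // => m _; rewrite ifF //; apply/eqP; lia.
have hm : (nu - (d * n + e) < nu.+2)%N by lia.
rewrite (bigD1 (Ordinal hm)) //= subnK // eqxx big1 ?addr0 // => m.
rewrite -val_eqE /= => mn; rewrite ifF //; apply/eqP => E.
by move/eqP: mn; lia.
Qed.

(** Replacing z by eps z and w by eps^d w multiplies a monomial of weight k
    by eps^(k-e); the smallest weight dominates. *)
Lemma weighted_expansion (Phi : R[i] -> R[i] -> R[i]) (C0 s : R) :
  0 < s -> 0 <= C0 ->
  expands Phi c C0 s ->
  (forall m n, (m + (d * n + e) < nu)%N -> c m n = 0) ->
  forall z W, 0 <= W -> exists K r : R, [/\ 0 <= K, 0 < r & forall eps w, 0 < eps -> eps < r -> normc w <= W ->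
    normc ((eps ^+ e)%:C * Phi (eps%:C * z) ((eps ^+ d)%:C * w) - (eps ^+ nu)%:C * weight_part z w) <= K * eps ^+ nu.+1].
Proof.
move=> s0 C00 HT Hc z W W0; pose x := normc z; have x0 : 0 <= x := normc_ge0 z.
pose N := nu.+2.
pose K1 := \sum_(m < N) \sum_(n < N) normc (c m n) * x ^+ m * W ^+ n.
have K10 : 0 <= K1.
  by apply: sumr_ge0 => m _; apply: sumr_ge0 => n _; rewrite !mulr_ge0 ?normc_ge0 ?exprn_ge0.
pose K2 := C0 * ((x / s) ^+ N + (W / s) ^+ N).
have K20 : 0 <= K2 by rewrite mulr_ge0 // addr_ge0 // exprn_ge0 // divr_ge0 // ltW.
have S0 : 0 < x + W + 1 by rewrite ltr_wpDl // addr_ge0.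
have r0 : 0 < s / 2 / (x + W + 1) by rewrite !divr_gt0.
exists (K1 + K2), (Num.min 1 (s / 2 / (x + W + 1))).
split; [exact: addr_ge0|by rewrite lt_min ltr01|].
move=> eps w e0; rewrite lt_min => /andP[e1]; rewrite ltr_pdivlMr // => es wW.
have ed : eps ^+ d <= eps by rewrite -(prednK d0) exprS ler_piMr ?(ltW e0) // exprn_ile1 ?ltW.
have ed0 : 0 <= eps ^+ d by rewrite exprn_ge0 // ltW.
have zs : normc (eps%:C * z) <= s / 2.
  rewrite normcM normc_real gtr0_norm // -/x; apply: le_trans (ltW es).
  by rewrite ler_wpM2l ?(ltW e0) // -addrA lerDl addr_ge0.
have ws : normc ((eps ^+ d)%:C * w) <= s / 2.
  rewrite normcM normc_real ger0_norm //; apply: le_trans (ltW es).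
  apply: ler_pM => //; first exact: normc_ge0.
  by apply: le_trans wW _; rewrite addrAC lerDr addr_ge0.
have err := HT N _ _ isT zs ws.
set S := \sum_(m < N) _ in err.
have -> : (eps ^+ e)%:C * Phi (eps%:C * z) ((eps ^+ d)%:C * w) - (eps ^+ nu)%:C * weight_part z w =
  (eps ^+ e)%:C * (Phi (eps%:C * z) ((eps ^+ d)%:C * w) - S) +
  ((eps ^+ e)%:C * S - (eps ^+ nu)%:C * weight_part z w) by ring.
have en1 : 0 <= eps ^+ nu.+1 by rewrite exprn_ge0 // ltW.
apply: le_trans (normcD _ _) _; rewrite addrC mulrDl; apply: lerD; last first.
  rewrite normcM normc_real ger0_norm ?exprn_ge0 ?(ltW e0) //.
  apply: (@le_trans _ _ (1 * (K2 * eps ^+ nu.+1))); last by rewrite mul1r.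
  apply: ler_pM; rewrite ?exprn_ge0 ?normc_ge0 ?(ltW e0) ?exprn_ile1 ?(ltW e1) ?(ltW e0) //.
  apply: le_trans err _; rewrite /K2 -mulrA ler_wpM2l // mulrDl; apply: lerD.
    rewrite normcM normc_real gtr0_norm // -/x -mulrA exprMn mulrC ler_wpM2l //.
      by rewrite exprn_ge0 // divr_ge0 // ltW.
    by rewrite ler_wiXn2l ?(ltW e0) ?(ltW e1).
  rewrite normcM normc_real ger0_norm // -mulrA exprMn mulrC; apply: ler_pM.
  - by rewrite exprn_ge0 // divr_ge0 ?normc_ge0 // ltW.
  - by rewrite exprn_ge0.
  - rewrite lerXn2r ?nnegrE ?divr_ge0 ?normc_ge0 ?(ltW s0) //.
    by rewrite ler_wpM2r // invr_ge0 ltW.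
  - apply: (@le_trans _ _ (eps ^+ N)); first by rewrite lerXn2r ?nnegrE // ltW.
    by rewrite ler_wiXn2l ?(ltW e0) ?(ltW e1).
rewrite -weight_part_double /S !mulr_sumr -sumrB.
apply: le_trans (normc_sum _ _ _) _; rewrite /K1 mulr_suml; apply: ler_sum => m _.
rewrite !mulr_sumr -sumrB.
apply: le_trans (normc_sum _ _ _) _; rewrite mulr_suml; apply: ler_sum => n _.
have -> : (eps ^+ e)%:C * (c m n * (eps%:C * z) ^+ m * ((eps ^+ d)%:C * w) ^+ n) =
  c m n * z ^+ m * w ^+ n * (eps ^+ (m + (d * n + e)))%:C.
  rewrite !exprMn !exprD !exprM !rmorphM !rmorphXn /=; ring.
have [->|/eqP cn0] := c m n =P 0.
  by rewrite !mul0r if_same mulr0 subrr normc0 !mul0r.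
have ge : (nu <= m + (d * n + e))%N by rewrite leqNgt; apply: contra cn0 => /Hc ->.
case: eqP => [->|ne].
  by rewrite mulrC subrr normc0 !mulr_ge0 ?normc_ge0 ?exprn_ge0 // ltW.
have lt : (nu.+1 <= m + (d * n + e))%N by rewrite ltn_neqAle ge andbT eq_sym; apply/eqP.
rewrite mulr0 subr0 !normcM !normcX normc_real ger0_norm ?exprn_ge0 ?(ltW e0) // -/x.
apply: ler_pM.
- by rewrite !mulr_ge0 ?exprn_ge0 ?normc_ge0.
- by rewrite exprn_ge0 // ltW.
- by rewrite ler_wpM2l ?mulr_ge0 ?exprn_ge0 ?normc_ge0 // lerXn2r ?nnegrE ?normc_ge0.
- by rewrite ler_wiXn2l ?(ltW e0) ?(ltW e1).
Qed.

Lemma weight_part_bound z W : 0 <= W -> exists2 B : R, 0 <= B & forall w, normc w <= W -> normc (weight_part z w) <= B.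
Proof.
move=> W0; exists (\sum_(n < nu.+1) normc (weight_coef n) * normc z ^+ (nu - (d * n + e)) * W ^+ n).
  by apply: sumr_ge0 => n _; rewrite !mulr_ge0 ?normc_ge0 ?exprn_ge0 ?normc_ge0.
move=> w wW; apply: le_trans (normc_sum _ _ _) _; apply: ler_sum => n _.
rewrite !normcM !normcX ler_wpM2l ?mulr_ge0 ?exprn_ge0 ?normc_ge0 //.
by rewrite lerXn2r ?nnegrE ?normc_ge0.
Qed.

Lemma weight_part_lip z W : 0 <= W -> exists2 L : R, 0 <= L & forall w w', normc w <= W -> normc w' <= W ->
  normc (weight_part z w' - weight_part z w) <= L * normc (w' - w).
Proof.
move=> W0; exists (\sum_(n < nu.+1) normc (weight_coef n) * normc z ^+ (nu - (d * n + e)) * (n%:R * W ^+ n.-1)).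
  by apply: sumr_ge0 => n _; rewrite !mulr_ge0 ?normc_ge0 ?exprn_ge0 ?normc_ge0.
move=> w w' wW wW'; rewrite -sumrB mulr_suml.
apply: le_trans (normc_sum _ _ _) _; apply: ler_sum => n _.
rewrite -mulrBr normcM [normc (weight_coef n * _)]normcM normcX -[leRHS]mulrA.
rewrite ler_wpM2l ?mulr_ge0 ?exprn_ge0 ?normc_ge0 //.
exact: expn_lip.
Qed.

End WeightedPart.

(** * The model polynomial *)

Section Model.
Context {R : realType}.
Variables (d k0 : nat) (alpha : nat -> R[i]).
Hypotheses (k0d : (k0 < d)%N) (dk0 : (d <= k0.*2)%N) (d2 : (1 < d)%N).
Hypothesis alphaJ : forall j, (d - k0 <= j <= k0)%N -> alpha j = conjc (alpha (d - j)%N).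
Hypothesis alpha0 : alpha k0 != 0.

Notation P := (model_poly d k0 alpha).

(** The real part of h times this number is the differential of the real part
    of P.  When P is real this is 2 dP/dz, see [model_derivE]. *)
Definition model_deriv (z : R[i]) : R[i] := \sum_(d - k0 <= j < k0.+1)
  (j%:R * alpha j * z ^+ j.-1 * conjc z ^+ (d - j)
   + (d - j)%:R * conjc (alpha j) * conjc z ^+ j * z ^+ (d - j).-1).

Lemma model_conj z : conjc (P z) = P z.
Proof.
rewrite /model_poly rmorph_sum big_nat_rev /= big_nat [RHS]big_nat; apply: eq_bigr => j /andP[j1 j2].
have -> : (d - k0 + k0.+1 - j.+1 = d - j)%N by lia.
rewrite !rmorphM !rmorphXn /= conjcK subKn; last lia.
by rewrite -alphaJ ?j1 //; ring.
Qed.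

Lemma model_real z : P z = (complex.Re (P z))%:C.
Proof.
have := model_conj z; case: (P z) => a b /= [] h; congr (_ +i* _).
by apply/eqP; rewrite -[_ == _](@mulrn_eq0 _ b 2) //= mulr2n -{1}h addNr.
Qed.

Lemma model_scale (e : R) z : P (e%:C * z) = (e ^+ d)%:C * P z.
Proof.
rewrite /model_poly mulr_sumr big_nat [RHS]big_nat; apply: eq_bigr => j /andP[j1 j2].
have ej : d = (j + (d - j))%N by lia.
have cE : conjc (e%:C * z) = e%:C * conjc z by rewrite (rmorphM (@conjc R)); congr (_ * _); exact: conjc_real.
rewrite cE !exprMn {3}ej exprD rmorphM !rmorphXn /=; ring.
Qed.

Lemma model_diff z (e : R) : 0 < e -> exists2 r : R, 0 < r & forall h, normc h < r ->
  `|complex.Re (P (z + h)) - complex.Re (P z) - complex.Re (model_deriv z * h)| <= e * normc h.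
Proof.
have D j : rdiff (fun w => alpha j * w ^+ j * conjc w ^+ (d - j)) z
    (j%:R * alpha j * z ^+ j.-1 * conjc z ^+ (d - j))
    ((d - j)%:R * alpha j * z ^+ j * conjc z ^+ (d - j).-1).
  apply: rdiff_ext (rdiffM (rdiffM (rdiff_cst (alpha j) z) (rdiff_expn j z)) (rdiff_conj_expn (d - j) z)) => //.
    by ring.
  by ring.
move=> e0; have [r r0 rP] := rdiff_sum (index_iota (d - k0) k0.+1) D e0.
exists r => // h /rP; apply: le_trans; apply: le_trans (Re_le_normc _).
rewrite !Re_sub Re_add /model_deriv big_split /= mulrDl Re_add.
rewrite le_eqVlt; apply/orP; left; apply/eqP; congr (`|_ - (_ + _)|).
have cj (x : R[i]) : complex.Re x = complex.Re (conjc x) by case: x.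
rewrite [RHS]cj rmorphM rmorph_sum; congr (complex.Re (_ * _)); last exact: esym (conjcK h).
apply: eq_bigr => j _; rewrite !rmorphM !rmorphXn /= conjcK rmorph_nat; ring.
Qed.

(** To be used with the symmetry of alpha, by which j -> d - j exchanges a term
    and a conjugate. *)
Let reindex (F G : nat -> R[i]) : (forall j, (d - k0 <= j <= k0)%N -> F j = G (d - j)%N) ->
  \sum_(d - k0 <= j < k0.+1) F j = \sum_(d - k0 <= j < k0.+1) G j.
Proof.
move=> h; rewrite [RHS]big_nat_rev /= big_nat [RHS]big_nat; apply: eq_bigr => j hj.
by rewrite h; [congr (G _); lia|lia].
Qed.

Lemma model_derivE z : model_deriv z = \sum_(d - k0 <= j < k0.+1) 2 * j%:R * alpha j * z ^+ j.-1 * conjc z ^+ (d - j).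
Proof.
rewrite /model_deriv big_split /= (reindex (F := fun j => (d - j)%:R * conjc (alpha j) * conjc z ^+ j * z ^+ (d - j).-1)
   (G := fun j => j%:R * alpha j * z ^+ j.-1 * conjc z ^+ (d - j))).
  by rewrite -big_split /=; apply: eq_bigr => j _; ring.
move=> j hj; rewrite [alpha (d - j)]alphaJ; last by lia.
by rewrite subKn; [ring|lia].
Qed.

Lemma model_deriv_conjE z : conjc (model_deriv z) =
  \sum_(d - k0 <= j < k0.+1) 2 * (d - j)%:R * alpha j * z ^+ j * conjc z ^+ (d - j).-1.
Proof.
rewrite model_derivE rmorph_sum; apply: reindex => j hj.
rewrite !rmorphM !rmorphXn !rmorph_nat /= conjcK [alpha (d - j)]alphaJ; last by lia.
rewrite subKn; last by lia.
by ring.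
Qed.

(** On the unit circle, a monomial z^j times the (d-j)-th power of the conjugate
    of z becomes z^(2j) after multiplication by z^d, hence a power of z^2. *)
Definition circle_poly : {poly R[i]} := \sum_(d - k0 <= j < k0.+1) alpha j *: 'X^j.
Definition circle_deriv : {poly R[i]} := 2 *: circle_poly^`().
Definition circle_deriv_conj : {poly R[i]} := \sum_(d - k0 <= j < k0.+1) (2 * (d - j)%:R * alpha j) *: 'X^j.

Section Unit.
Variable z : R[i].
Hypothesis zz : z * conjc z = 1.

Let zc m n : z ^+ (m + n) * conjc z ^+ n = z ^+ m.
Proof. by rewrite exprD -mulrA -exprMn zz expr1n mulr1. Qed.

Lemma model_circle : z ^+ d * P z = circle_poly.[z ^+ 2].
Proof.
rewrite /model_poly /circle_poly horner_sum mulr_sumr big_nat [RHS]big_nat; apply: eq_bigr => j /andP[j1 j2].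
rewrite hornerZ hornerXn -exprM -(zc (2 * j) (d - j)).
have -> : (2 * j + (d - j) = d + j)%N by lia.
by rewrite exprD; ring.
Qed.

Lemma model_deriv_circle : z ^+ d.-1 * model_deriv z = circle_deriv.[z ^+ 2].
Proof.
rewrite model_derivE /circle_deriv hornerZ /circle_poly raddf_sum /= horner_sum !mulr_sumr.
rewrite big_nat [RHS]big_nat; apply: eq_bigr => j /andP[j1 j2].
rewrite derivZ derivXn hornerZ hornerMn hornerXn -exprM -(zc (2 * j.-1) (d - j)).
have -> : (2 * j.-1 + (d - j) = d.-1 + j.-1)%N by lia.
by rewrite exprD -mulr_natl; ring.
Qed.

Lemma model_deriv_conj_circle : z ^+ d.-1 * conjc (model_deriv z) = circle_deriv_conj.[z ^+ 2].
Proof.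
rewrite model_deriv_conjE /circle_deriv_conj horner_sum mulr_sumr.
rewrite big_nat [RHS]big_nat; apply: eq_bigr => j /andP[j1 j2].
rewrite hornerZ hornerXn -exprM -(zc (2 * j) (d - j).-1).
have -> : (2 * j + (d - j).-1 = d.-1 + j)%N by lia.
by rewrite exprD; ring.
Qed.

End Unit.

Let coef_range (c : nat -> R[i]) i :
  (\sum_(d - k0 <= j < k0.+1) c j *: 'X^j : {poly R[i]})`_i = if (d - k0 <= i <= k0)%N then c i else 0.
Proof.
rewrite coef_sum; under eq_bigr do rewrite coefZ coefXn.
case: ifP => h.
  rewrite (bigD1_seq i) ?mem_index_iota ?iota_uniq //= eqxx mulr1 big1 ?addr0 //.
  by move=> j ji; rewrite eq_sym (negPf ji) mulr0.
rewrite big_nat big1 // => j hj; rewrite (_ : i == j = false) ?mulr0 //.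
by apply: contraFF h => /eqP ->.
Qed.

Let gt_size (p : {poly R[i]}) i : p`_i != 0 -> (i < size p)%N.
Proof. by move=> h; rewrite ltnNge; apply: contra h => /leq_sizeP/(_ i (leqnn _)) ->. Qed.

Lemma size_circle_poly : size circle_poly = k0.+1.
Proof.
apply/eqP; rewrite eqn_leq; apply/andP; split.
  by apply/leq_sizeP => j hj; rewrite coef_range ifF //; apply/negbTE; lia.
by apply: gt_size; rewrite coef_range ifT //; lia.
Qed.

Lemma circle_poly_at0 : circle_poly.[0] = 0.
Proof. by rewrite horner_coef0 coef_range ifF //; apply/negbTE; lia. Qed.

Lemma size_circle_deriv : size circle_deriv = k0.
Proof.
rewrite /circle_deriv size_scale ?pnatr_eq0 //.
apply/eqP; rewrite eqn_leq; apply/andP; split.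
  by have := lt_size_deriv (p := circle_poly); rewrite -size_poly_eq0 size_circle_poly ltnS; apply.
have -> : k0 = k0.-1.+1 by lia.
apply: gt_size; rewrite coef_deriv coef_range ifT ?prednK; try lia.
by rewrite mulrn_eq0 negb_or alpha0 andbT; lia.
Qed.

Lemma size_circle_deriv_conj : (size circle_deriv_conj <= k0.+1)%N.
Proof. by apply/leq_sizeP => j hj; rewrite coef_range ifF //; apply/negbTE; lia. Qed.

Lemma circle_deriv_conj_neq0 : circle_deriv_conj != 0.
Proof.
apply/eqP => /(congr1 (fun q : {poly R[i]} => q`_k0)); rewrite coef0 coef_range ifT; last by lia.
move=> /eqP; rewrite !mulf_eq0 (negPf alpha0) !pnatr_eq0 /= orbF subn_eq0; lia.
Qed.

Lemma circle_deriv_conj_at0 : circle_deriv_conj.[0] = 0.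
Proof. by rewrite horner_coef0 coef_range ifF //; apply/negbTE; lia. Qed.

End Model.

Section PolyIdentity.
Context {R : realType}.

Lemma poly_inf_roots (F : idomainType) (p : {poly F}) (u : nat -> F) :
  injective u -> (forall n, root p (u n)) -> p = 0.
Proof.
move=> ui ur; apply/eqP; apply: contraT => p0.
have := @max_poly_roots _ p [seq u i | i <- iota 0 (size p)] p0.
rewrite size_map size_iota ltnn => -> //; first by apply/allP => x /mapP[i _ ->].
by rewrite map_inj_uniq ?iota_uniq.
Qed.

(** The points (n + i) / |n + i|.  Their squares are pairwise distinct, which
    makes them enough points to test polynomials in z^2. *)
Definition unit_pt (n : nat) : R[i] :=
  (n%:R +i* 1) / ((Num.sqrt (n%:R ^+ 2 + 1))%:C).

Lemma unit_pt_norm1 n : unit_pt n * conjc (unit_pt n) = 1.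
Proof.
have p0 : 0 < (n%:R ^+ 2 + 1 : R) by rewrite ltr_wpDl // sqr_ge0.
have s0 : (Num.sqrt (n%:R ^+ 2 + 1 : R))%:C != 0 :> R[i].
  by rewrite -normc_gt0 normc_real normr_gt0 gt_eqF // sqrtr_gt0.
have cE : conjc (unit_pt n) = (n%:R -i* 1) / (Num.sqrt (n%:R ^+ 2 + 1))%:C.
  by rewrite /unit_pt rmorphM fmorphV; congr (_ / _); exact: conjc_real.
rewrite cE /unit_pt mulrACA -invfM -rmorphM /= -expr2 sqr_sqrtr ?(ltW p0) //.
have -> : (n%:R +i* 1) * (n%:R -i* 1) = (n%:R ^+ 2 + 1)%:C :> R[i].
  by apply/eqP; rewrite eq_complex Re_mul Im_mul /=; apply/andP; split; apply/eqP; ring.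
by rewrite mulfV // -normc_gt0 normc_real normr_gt0 gt_eqF.
Qed.

Lemma unit_pt_sq_inj : injective (fun n => unit_pt n ^+ 2).
Proof.
move=> m n /= E.
have sqE k : unit_pt k ^+ 2 = (k%:R +i* 1) / (k%:R -i* 1).
  have w0 : (k%:R +i* 1 : R[i]) != 0 by rewrite eq_complex /= oner_eq0 andbF.
  have v0 : (k%:R -i* 1 : R[i]) != 0 by rewrite eq_complex /= oppr_eq0 oner_eq0 andbF.
  have cE : conjc (unit_pt k) = (k%:R -i* 1) / (Num.sqrt (k%:R ^+ 2 + 1))%:C.
    by rewrite /unit_pt rmorphM fmorphV; congr (_ / _); exact: conjc_real.
  have := unit_pt_norm1 k; rewrite cE.
  have s0 : (Num.sqrt (k%:R ^+ 2 + 1 : R))%:C != 0 :> R[i].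
    by rewrite -normc_gt0 normc_real normr_gt0 gt_eqF // sqrtr_gt0 ltr_wpDl // sqr_ge0.
  move=> h; have -> : unit_pt k ^+ 2 = unit_pt k * (unit_pt k * ((k%:R -i* 1) / (Num.sqrt (k%:R ^+ 2 + 1))%:C)) * ((Num.sqrt (k%:R ^+ 2 + 1))%:C / (k%:R -i* 1)).
    by rewrite expr2; field; rewrite s0 v0.
  by rewrite h mulr1 /unit_pt; field; rewrite s0 v0.
move: E; rewrite !sqE => /eqP.
have v0 k : (k%:R -i* 1 : R[i]) != 0 by rewrite eq_complex /= oppr_eq0 oner_eq0 andbF.
rewrite eqr_div // => /eqP/(congr1 (@complex.Im R)); rewrite !Im_mul /= => h.
have : (m%:R : R) = n%:R by lra.
by move/eqP; rewrite eqr_nat => /eqP.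
Qed.

(** For each k the polynomial obtained by evaluating the coefficients has
    infinitely many roots, so the coefficients themselves have infinitely many
    roots. *)
Lemma polypoly_eq0 (Q : {poly {poly R[i]}}) (X : nat -> nat -> R[i]) :
  (forall k, injective (X k)) ->
  (forall k n, (map_poly (fun a : {poly R[i]} => a.[unit_pt k ^+ 2]) Q).[X k n] = 0) -> Q = 0.
Proof.
move=> Xi h.
have h1 k : map_poly (horner_eval (unit_pt k ^+ 2)) Q = 0.
  by apply: (poly_inf_roots (Xi k)) => n; apply/rootP; exact: h.
apply/polyP => j; rewrite coef0.
apply: (poly_inf_roots unit_pt_sq_inj) => k; apply/rootP.
have := congr1 (fun q : {poly R[i]} => q`_j) (h1 k).
by rewrite coef_map coef0.
Qed.

End PolyIdentity.

(** * The identity between the parts of lowest weight *)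

(** P, D and Rm stand for the model polynomial, its differential and the
    remainder of the defining function; F and G for the components of the map
    minus the identity.  The last hypothesis is the invariance of the
    hypersurface. *)
Section LeadingIdentity.
Context {R : realType}.

Lemma common_lower_bound (rs : seq R) : all (fun r => 0 < r) rs -> exists2 mu : R, 0 < mu & all (fun r => mu <= r) rs.
Proof.
elim: rs => [_|r rs IH /= /andP[r0 /IH[mu mu0 h]]]; first by exists 1.
exists (Num.min r mu); first by rewrite lt_min r0.
rewrite ge_min lexx /=; apply: sub_all h => t ht; by rewrite ge_min ht orbT.
Qed.

Lemma eq0_linear_bound (X K : R) : 0 <= K -> (forall e, 0 < e -> e <= 1 -> `|X| <= K * e) -> X = 0.
Proof.
move=> K0 h; apply/eqP; rewrite -normr_le0; apply/ler_addgt0Pr => e e0; rewrite add0r.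
have K1 : 0 < K + 1 by rewrite ltr_wpDl.
pose t := Num.min 1 (e / (K + 1)).
have t0 : 0 < t by rewrite lt_min ltr01 divr_gt0.
have t1 : t <= 1 by rewrite ge_min lexx.
have te : t <= e / (K + 1) by rewrite ge_min lexx orbT.
apply: le_trans (h t t0 t1) _; apply: le_trans (ler_wpM2l K0 te) _.
by rewrite mulrCA ger_pMr // ler_pdivrMr // mul1r lerDl.
Qed.

Lemma le_one_plus (x s W a b q : R) : 0 <= x -> 0 <= s -> 0 <= W -> 0 <= a -> 0 <= b -> 0 <= q ->
  let A := 1 + (x + s + W + a + b + q) in
  [/\ 1 <= A, x + 1 <= A, s + b <= A /\ s <= A, W <= A & a <= A /\ q <= A].
Proof. by move=> x0 s1 W0 a0 b0 q0 A; rewrite /A; split; [| |split| |split]; lra. Qed.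

Variables (d nu : nat) (P : R[i] -> R) (D : R[i] -> R[i]) (Rm : R[i] -> R -> R).
Variables (F G : R[i] -> R[i] -> R[i]) (Fc Gc : nat -> nat -> R[i]) (C0 s0 : R).
Hypothesis d0 : (0 < d)%N.
Hypothesis HPs : forall (e : R) z, P (e%:C * z) = e ^+ d * P z.
Hypothesis HPd : forall z (e : R), 0 < e -> exists2 r : R, 0 < r & forall h, normc h < r ->
  `|P (z + h) - P z - complex.Re (D z * h)| <= e * normc h.
Hypothesis HR : small_remainder d (fun z s => (Rm z s)%:C).
Hypothesis HR0 : Rm 0 0 = 0.
Hypotheses (s00 : 0 < s0) (C00 : 0 <= C0).
Hypothesis HTF : expands F Fc C0 s0.
Hypothesis HTG : expands G Gc C0 s0.
Hypothesis Ford : forall m n, (m + n <= 2)%N -> Fc m n = 0.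
Hypothesis Gord : forall m n, (m + n <= 2)%N -> Gc m n = 0.
Hypothesis Fnu : forall m n, (m + (d * n + d.-1) < nu)%N -> Fc m n = 0.
Hypothesis Gnu : forall m n, (m + (d * n + 0) < nu)%N -> Gc m n = 0.
Hypothesis HM : exists2 r : R, 0 < r & forall z w, normc z < r -> normc w < r ->
  complex.Re w = P z + Rm z (complex.Im w) ->
  complex.Re (w + G z w) = P (z + F z w) + Rm (z + F z w) (complex.Im (w + G z w)).

(** A monomial of degree at least 3 has weight at least 3, whatever
    d is. *)
Lemma order3_bound (Phi : R[i] -> R[i] -> R[i]) (c : nat -> nat -> R[i]) :
  expands Phi c C0 s0 ->
  (forall m n, (m + n <= 2)%N -> c m n = 0) ->
  forall z W, 0 <= W -> exists M r : R, [/\ 0 <= M, 0 < r & forall eps w, 0 < eps -> eps < r -> normc w <= W ->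
    normc (Phi (eps%:C * z) ((eps ^+ d)%:C * w)) <= M * eps ^+ 3].
Proof.
move=> HT Hc z W W0.
have c3 m n : (m + (d * n + 0) < 3)%N -> c m n = 0.
  by move=> h; apply: Hc; apply: leq_trans (_ : m + d * n <= 2)%N; [rewrite leq_add2l leq_pmull|lia].
have [K [r [K0 r0 h]]] := weighted_expansion d0 s00 C00 HT c3 z W0.
have [B B0 hB] := weight_part_bound d 0 3 c z W0.
exists (B + K), (Num.min 1 r); split; [exact: addr_ge0|by rewrite lt_min ltr01|].
move=> eps w e0; rewrite lt_min => /andP[e1 er] wW.
have := h eps w e0 er wW; rewrite expr0 mul1r => H.
rewrite -(subrK ((eps ^+ 3)%:C * weight_part d 0 3 c z w) (Phi _ _)) addrC.
apply: le_trans (normcD _ _) _; rewrite mulrDl; apply: lerD.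
  have e3 : 0 <= eps ^+ 3 by rewrite exprn_ge0 // ltW.
  by rewrite normcM normc_real ger0_norm // mulrC ler_wpM2r // hB.
apply: le_trans H _; rewrite ler_wpM2l // exprS.
by rewrite ler_piMl ?exprn_ge0 ?(ltW e0) ?(ltW e1).
Qed.

Lemma size_of_weight_part (e : nat) (Phi st : R[i]) (K B eps : R) : 0 < eps -> eps <= 1 -> 0 <= K ->
  normc ((eps ^+ e)%:C * Phi - (eps ^+ nu)%:C * st) <= K * eps ^+ nu.+1 -> normc st <= B ->
  eps ^+ e * normc Phi <= (B + K) * eps ^+ nu.
Proof.
move=> e0 e1 K0 H HB.
have en : 0 <= eps ^+ nu by rewrite exprn_ge0 // ltW.
have -> : eps ^+ e * normc Phi = normc ((eps ^+ e)%:C * Phi).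
  by rewrite normcM normc_real ger0_norm // exprn_ge0 // ltW.
rewrite -(subrK ((eps ^+ nu)%:C * st) ((eps ^+ e)%:C * Phi)) addrC.
apply: le_trans (normcD _ _) _; rewrite mulrDl; apply: lerD.
  by rewrite normcM normc_real ger0_norm // mulrC ler_wpM2r.
apply: le_trans H _; rewrite ler_wpM2l // exprS.
by rewrite ler_piMl.
Qed.

(** The point z1 = eps z, w = eps^d om lies on the hypersurface when
    om = P(z) + rho + i s, with rho coming from the remainder; rho is at most
    eta.  Its image also does, and subtracting the two equations gives
    Re G(z1, w) = (P (z1 + F) - P z1) + (variation of the remainder).  Divided
    by eps^nu, the left-hand side tends to Re G_nu, the variation of P to
    Re (D(z) F_nu) and the last term to 0.  Everything is estimated by a multiple
    of eta, which is arbitrary. *)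
Theorem leading_identity z s : let w := P z +i* s in
  complex.Re (weight_part d 0 nu Gc z w) = complex.Re (D z * weight_part d d.-1 nu Fc z w).
Proof.
move=> w0; pose x := normc z; have x0 : 0 <= x := normc_ge0 z.
pose W := `|P z| + 1 + `|s|.
have W0 : 0 <= W by rewrite !addr_ge0.
have [KF [rF [KF0 rF0 hF]]] := weighted_expansion d0 s00 C00 HTF Fnu z W0.
have [KG [rG [KG0 rG0 hG]]] := weighted_expansion d0 s00 C00 HTG Gnu z W0.
have [MF3 [r3 [MF30 r30 hF3]]] := order3_bound HTF Ford z W0.
have [MG3 [r4 [MG30 r40 hG3]]] := order3_bound HTG Gord z W0.
have [BF BF0 hBF] := weight_part_bound d d.-1 nu Fc z W0.
have [BG BG0 hBG] := weight_part_bound d 0 nu Gc z W0.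
have [LF LF0 hLF] := weight_part_lip d d.-1 nu Fc z W0.
have [LG LG0 hLG] := weight_part_lip d 0 nu Gc z W0.
have [[C [rC [CC0 rC0 hC']]] HR2'] := HR.
have hC z0 z' t : normc z0 < rC -> normc z' < rC -> `|t| < rC ->
    `|Rm z' t - Rm z0 t| <= C * (normc z0 ^+ d + normc z' ^+ d + `|t|) * normc (z' - z0).
  by rewrite -normc_real rmorphB; exact: hC'.
have HR2 (e : R) (e_gt0 : 0 < e) : exists2 r : R, 0 < r & forall z0 t t',
    normc z0 < r -> `|t| < r -> `|t'| < r -> `|Rm z0 t' - Rm z0 t| <= e * `|t' - t|.
  have [r1 r10 hr1] := HR2' e e_gt0; exists r1 => // z0 t t'.
  by rewrite -[`|_ - Rm _ _|]normc_real rmorphB; exact: hr1.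
have [rM rM0 hM] := HM.
pose MF := BF + KF; pose MG := BG + KG; pose nD := normc (D z).
have MF0 : 0 <= MF by exact: addr_ge0.
have MG0 : 0 <= MG by exact: addr_ge0.
have nD0 : 0 <= nD := normc_ge0 _.
pose S := x ^+ d + (x + 1) ^+ d + `|s|.
have S0 : 0 <= S by rewrite !addr_ge0 ?exprn_ge0 ?addr_ge0.
have CS0 : 0 <= C * S * MF by rewrite !mulr_ge0.
pose K := KG + MF + nD * KF + MG + C * S * MF + LG + nD * LF.
have K0 : 0 <= K by rewrite /K !addr_ge0 // mulr_ge0.
apply/eqP; rewrite -subr_eq0; apply/eqP; apply: (eq0_linear_bound K0) => eta eta0 eta1.
pose s1 := `|s| + 1.
have s10 : 0 < s1 by rewrite ltr_wpDl.
have [ra ra0 hra] := HR2 _ (divr_gt0 (divr_gt0 eta0 (ltr0Sn R 1)) s10).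
have [rb rb0 hrb] := HR2 _ eta0.
have [rP rP0 hrP] := HPd z eta0.
(* mu is below every threshold; eps is chosen so that all the quantities that
   appear, such as eps * (x + 1), are smaller than mu. *)
have [mu mu0] : exists2 mu : R, 0 < mu & all (fun r => mu <= r)
  [:: 1; eta; eta / 2; rF; rG; r3; r4; rC; rM; ra; rb; rP].
  by apply: common_lower_bound; rewrite /= ltr01 eta0 rF0 rG0 r30 r40 rC0 rM0 ra0 rb0 rP0 divr_gt0.
move=> /= /andP[m1 /andP[meta /andP[meta2 /andP[mF /andP[mG /andP[m3 /andP[m4 /andP[mC /andP[mM /andP[ma /andP[mb /andP[mP _]]]]]]]]]]]].
pose Q := C * (x ^+ d + `|s|) * x.
have Q0 : 0 <= Q by rewrite !mulr_ge0 // addr_ge0 ?exprn_ge0.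
pose A := 1 + (x + `|s| + W + MF3 + MG3 + Q).
have A0 : 0 < A by rewrite ltr_pwDl // !addr_ge0.
pose eps := mu / 2 / A.
have e0 : 0 < eps by rewrite !divr_gt0.
have e0' := ltW e0.
have small t : t <= A -> eps * t < mu.
  move=> tA; apply: (@le_lt_trans _ _ (eps * A)); first by rewrite ler_wpM2l.
  by rewrite divfK ?gt_eqF // ltr_pdivrMr // ltr_pMr // ltr1n.
have ns0 : 0 <= `|s| := normr_ge0 s.
have [A1 Ax [AG As] AW [AF AQ]] := le_one_plus x0 ns0 W0 MF30 MG30 Q0.
have [tx ts tW] : [/\ eps * (x + 1) < mu, eps * `|s| < mu & eps * W < mu].
  by split; apply: small.
have [tF tG tQ] : [/\ eps * MF3 < mu, eps * (`|s| + MG3) < mu & eps * Q < mu].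
  by split; apply: small.
have emu : eps < mu by rewrite -[eps]mulr1; apply: small.
have e1 : eps <= 1 := le_trans (ltW emu) m1.
pose E := eps ^+ d; have E0 : 0 < E by rewrite exprn_gt0.
have Ee : E <= eps by rewrite /E -(prednK d0) exprS ler_piMr // exprn_ile1.
have ED : E = eps * eps ^+ d.-1 by rewrite /E -exprS (prednK d0).
pose En := eps ^+ nu; have En0 : 0 < En by rewrite exprn_gt0.
pose z1 := eps%:C * z; pose sg := E * s.
have nz1 : normc z1 = eps * x by rewrite normcM normc_real gtr0_norm.
have nz1mu : normc z1 < mu by rewrite nz1; apply: le_lt_trans tx; rewrite ler_wpM2l // lerDl.
have nsg : `|sg| = E * `|s| by rewrite normrM gtr0_norm.
have nsgmu : `|sg| < mu by rewrite nsg; apply: le_lt_trans ts; rewrite ler_wpM2r.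
(* the correction that puts the point on the hypersurface: its equation is
   explicit because the remainder depends on w only through Im w *)
pose rho := Rm z1 sg / E.
have hrho : `|rho| <= eta.
  rewrite normrM normfV (gtr0_norm E0) ler_pdivrMr //.
  have H1 : `|Rm z1 sg - Rm 0 sg| <= E * (eta / 2).
    have n0 : normc (0 : R[i]) < rC by rewrite normc0.
    have := hC 0 z1 sg n0 (lt_le_trans nz1mu mC) (lt_le_trans nsgmu mC).
    rewrite normc0 expr0n (gtn_eqF d0) add0r subr0 nz1 nsg exprMn -/E -mulrDr => H.
    apply: le_trans H _.
    have -> : C * (E * (x ^+ d + `|s|)) * (eps * x) = E * (eps * Q) by rewrite /Q; ring.
    by rewrite ler_wpM2l ?(ltW E0) // ltW // (lt_le_trans tQ).
  have H2 : `|Rm 0 sg - Rm 0 0| <= E * (eta / 2).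
    have n0 : normc (0 : R[i]) < ra by rewrite normc0.
    have n1 : `|0 : R| < ra by rewrite normr0.
    have := hra 0 0 sg n0 n1 (lt_le_trans nsgmu ma).
    rewrite subr0 nsg => H; apply: le_trans H _.
    have -> : eta / 2 / s1 * (E * `|s|) = E * (eta / 2) * (`|s| / s1) by ring.
    rewrite ler_piMr ?mulr_ge0 ?divr_ge0 ?(ltW E0) ?(ltW eta0) //.
    by rewrite ler_pdivrMr // mul1r lerDl.
  have -> : Rm z1 sg = (Rm z1 sg - Rm 0 sg) + (Rm 0 sg - Rm 0 0) by rewrite HR0; ring.
  apply: le_trans (ler_normD _ _) _; apply: le_trans (lerD H1 H2) _.
  by rewrite -mulrDr -splitr mulrC.
pose om : R[i] := (P z + rho) +i* s.
have nom : normc om <= W.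
  apply: le_trans (normc_le_ReIm _) _; rewrite /= /W lerD2r.
  by apply: le_trans (ler_normD _ _) _; rewrite lerD2l (le_trans hrho).
have nw0 : normc w0 <= W.
  by apply: le_trans (normc_le_ReIm _) _; rewrite /= /W lerD2r lerDl.
have dom : normc (om - w0) <= eta.
  have -> : om - w0 = rho%:C.
    apply/eqP; rewrite eq_complex Re_sub Im_sub /=; apply/andP; split; apply/eqP; ring.
  by rewrite normc_real.
pose w := E%:C * om.
have wRe : complex.Re w = P z1 + Rm z1 sg.
  by rewrite Re_mul /= mul0r subr0 HPs -/E mulrDr /rho mulrCA divff ?gt_eqF // mulr1.
have wIm : complex.Im w = sg by rewrite Im_mul /= mul0r addr0.
have nwmu : normc w < mu.
  rewrite normcM normc_real gtr0_norm //; apply: le_lt_trans tW.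
  by apply: ler_pM; rewrite ?normc_ge0 ?(ltW E0).
pose Fe := F z1 w; pose Ge := G z1 w.
have HE := hM z1 w (lt_le_trans nz1mu mM) (lt_le_trans nwmu mM).
rewrite wIm in HE; have {HE} := HE wRe.
rewrite -/Fe -/Ge Re_add Im_add wRe wIm => HE.
have nF3 : normc Fe <= MF3 * eps ^+ 3 by apply: hF3 => //; exact: lt_le_trans emu m3.
have nG3 : normc Ge <= MG3 * eps ^+ 3 by apply: hG3 => //; exact: lt_le_trans emu m4.
have e2 : eps ^+ 2 <= eps by rewrite expr2 ler_piMl.
have e3 : eps ^+ 3 <= eps by rewrite exprS ler_piMr // exprn_ile1.
have e32 : eps ^+ 3 <= eps * eps by rewrite exprS ler_wpM2l.
have hFe := hF eps om e0 (lt_le_trans emu mF) nom.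
have hGe := hG eps om e0 (lt_le_trans emu mG) nom.
have nF := size_of_weight_part e0 e1 KF0 hFe (hBF om nom).
have nG := size_of_weight_part e0 e1 KG0 hGe (hBG om nom).
rewrite -/z1 -/E -/w -/Fe -/Ge -/En -/MF -/MG ?expr0 ?mul1r in hFe hGe nF nG.
have EnS : eps ^+ nu.+1 <= eta * En.
  by rewrite exprS ler_wpM2r ?(ltW En0) // (le_trans (ltW emu)).
(* z1 + Fe = eps (z + h), so that the homogeneity of P applies *)
pose h := (eps^-1)%:C * Fe.
have hE : eps%:C * h = Fe.
  by rewrite /h mulrA -rmorphM mulfV ?gt_eqF // rmorph1 mul1r.
have nh : normc h = normc Fe / eps by rewrite normcM normc_real gtr0_norm ?invr_gt0 // mulrC.
have nhmu : normc h < mu.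
  rewrite nh ltr_pdivrMr //; apply: le_lt_trans nF3 _.
  apply: (@le_lt_trans _ _ (eps * MF3 * eps)); last by rewrite ltr_pM2r.
  have -> : eps * MF3 * eps = MF3 * (eps * eps) by ring.
  by rewrite ler_wpM2l.
have zF : z1 + Fe = eps%:C * (z + h) by rewrite mulrDr hE.
have nzF : normc (z1 + Fe) <= eps * (x + 1).
  rewrite zF normcM normc_real gtr0_norm // ler_wpM2l //.
  by apply: le_trans (normcD _ _) _; rewrite lerD2l (le_trans (ltW nhmu)).
have nzFmu : normc (z1 + Fe) < mu := le_lt_trans nzF tx.
have EEF : E * normc h = eps ^+ d.-1 * normc Fe.
  by rewrite nh ED [eps * _]mulrC mulrA -[X in X / _]mulrA [eps * _]mulrC mulrA mulfK ?gt_eqF.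
have HP1 : `|P (z1 + Fe) - P z1 - complex.Re (D z * ((eps ^+ d.-1)%:C * Fe))| <= eta * MF * En.
  have -> : P (z1 + Fe) - P z1 - complex.Re (D z * ((eps ^+ d.-1)%:C * Fe)) =
     E * (P (z + h) - P z - complex.Re (D z * h)).
    rewrite zF !HPs -/E.
    have -> : (eps ^+ d.-1)%:C * Fe = E%:C * h.
      rewrite -hE mulrA -rmorphM; congr (_%:C * _).
      by rewrite ED mulrC.
    have -> : D z * (E%:C * h) = E%:C * (D z * h) by ring.
    by rewrite [complex.Re (E%:C * _)]Re_mul /= mul0r subr0; ring.
  rewrite normrM (gtr0_norm E0).
  have := hrP h (lt_le_trans nhmu mP) => H.
  apply: (@le_trans _ _ (E * (eta * normc h))); first by rewrite ler_wpM2l // ltW.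
  have -> : E * (eta * normc h) = eta * (eps ^+ d.-1 * normc Fe) by rewrite -EEF; ring.
  by rewrite -mulrA ler_wpM2l // ltW.
have HP2 : `|complex.Re (D z * ((eps ^+ d.-1)%:C * Fe)) - En * complex.Re (D z * weight_part d d.-1 nu Fc z om)| <= eta * (nD * KF) * En.
  have -> : En * complex.Re (D z * weight_part d d.-1 nu Fc z om) = complex.Re (D z * (En%:C * weight_part d d.-1 nu Fc z om)).
    have -> : D z * (En%:C * weight_part d d.-1 nu Fc z om) = En%:C * (D z * weight_part d d.-1 nu Fc z om) by ring.
    by rewrite [RHS]Re_mul /= mul0r subr0.
  rewrite -Re_sub -mulrBr; apply: le_trans (Re_le_normc _) _; rewrite normcM -/nD.
  have -> : eta * (nD * KF) * En = nD * (KF * (eta * En)) by ring.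
  rewrite ler_wpM2l //; apply: le_trans hFe _; by rewrite ler_wpM2l.
have HG1 : `|complex.Re Ge - En * complex.Re (weight_part d 0 nu Gc z om)| <= eta * KG * En.
  have -> : En * complex.Re (weight_part d 0 nu Gc z om) = complex.Re (En%:C * weight_part d 0 nu Gc z om).
    by rewrite [RHS]Re_mul /= mul0r subr0.
  rewrite -Re_sub; apply: le_trans (Re_le_normc _) _; apply: le_trans hGe _.
  have -> : eta * KG * En = KG * (eta * En) by ring.
  by rewrite ler_wpM2l.
have nIm : `|sg + complex.Im Ge| < mu.
  apply: le_lt_trans (ler_normD _ _) _; apply: le_lt_trans tG.
  rewrite mulrDr; apply: lerD; first by rewrite nsg ler_wpM2r.
  apply: le_trans (Im_le_normc _) _; apply: le_trans nG3 _.
  by rewrite mulrC ler_wpM2r.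
have HR3 : `|Rm (z1 + Fe) (sg + complex.Im Ge) - Rm (z1 + Fe) sg| <= eta * MG * En.
  have := hrb (z1 + Fe) sg (sg + complex.Im Ge) (lt_le_trans nzFmu mb) (lt_le_trans nsgmu mb) (lt_le_trans nIm mb).
  rewrite [sg + _ - sg]addrAC subrr add0r => H; apply: le_trans H _.
  rewrite -mulrA ler_wpM2l ?(ltW eta0) //; exact: le_trans (Im_le_normc _) nG.
have HR4 : `|Rm (z1 + Fe) sg - Rm z1 sg| <= eta * (C * S * MF) * En.
  have := hC z1 (z1 + Fe) sg (lt_le_trans nz1mu mC) (lt_le_trans nzFmu mC) (lt_le_trans nsgmu mC).
  rewrite [z1 + Fe - z1]addrAC subrr add0r => H; apply: le_trans H _.
  have HS : normc z1 ^+ d + normc (z1 + Fe) ^+ d + `|sg| <= E * S.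
    rewrite /S !mulrDr nsg; apply: lerD => //; apply: lerD.
      by rewrite nz1 exprMn.
    rewrite -exprMn; apply: lerXn2r; rewrite ?nnegrE ?normc_ge0 //.
    by rewrite (mulr_ge0 e0') // addr_ge0.
  apply: (@le_trans _ _ (C * (E * S) * normc Fe)).
    apply: ler_wpM2r; first exact: normc_ge0.
    by apply: ler_wpM2l.
  have -> : C * (E * S) * normc Fe = C * S * (eps * (eps ^+ d.-1 * normc Fe)).
    by rewrite ED; ring.
  have -> : eta * (C * S * MF) * En = C * S * (eta * (MF * En)) by ring.
  rewrite ler_wpM2l ?mulr_ge0 //; apply: ler_pM => //; last by exact: le_trans (ltW emu) meta.
  by rewrite mulr_ge0 ?exprn_ge0 ?normc_ge0.
have main : `|complex.Re (weight_part d 0 nu Gc z om) - complex.Re (D z * weight_part d d.-1 nu Fc z om)| <=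
    (KG + MF + nD * KF + MG + C * S * MF) * eta.
  rewrite -(ler_pM2l En0) -[En in leLHS]gtr0_norm // -normrM mulrBr.
  have -> : En * complex.Re (weight_part d 0 nu Gc z om) - En * complex.Re (D z * weight_part d d.-1 nu Fc z om) =
    - (complex.Re Ge - En * complex.Re (weight_part d 0 nu Gc z om)) +
    (P (z1 + Fe) - P z1 - complex.Re (D z * ((eps ^+ d.-1)%:C * Fe))) +
    (complex.Re (D z * ((eps ^+ d.-1)%:C * Fe)) - En * complex.Re (D z * weight_part d d.-1 nu Fc z om)) +
    (Rm (z1 + Fe) (sg + complex.Im Ge) - Rm (z1 + Fe) sg) +
    (Rm (z1 + Fe) sg - Rm z1 sg).
    have -> : complex.Re Ge = P (z1 + Fe) + Rm (z1 + Fe) (sg + complex.Im Ge) - (P z1 + Rm z1 sg).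
      by rewrite -HE; ring.
    by ring.
  have -> : En * ((KG + MF + nD * KF + MG + C * S * MF) * eta) =
    eta * KG * En + eta * MF * En + eta * (nD * KF) * En + eta * MG * En + eta * (C * S * MF) * En by ring.
  do 4![apply: le_trans (ler_normD _ _) _; apply: lerD => //].
  by rewrite normrN.
have HL1 : `|complex.Re (weight_part d 0 nu Gc z om) - complex.Re (weight_part d 0 nu Gc z w0)| <= LG * eta.
  rewrite -Re_sub; apply: le_trans (Re_le_normc _) _.
  by apply: le_trans (hLG w0 om nw0 nom) _; rewrite ler_wpM2l.
have HL2 : `|complex.Re (D z * weight_part d d.-1 nu Fc z om) - complex.Re (D z * weight_part d d.-1 nu Fc z w0)| <= nD * LF * eta.
  rewrite -Re_sub -mulrBr; apply: le_trans (Re_le_normc _) _; rewrite normcM -mulrA ler_wpM2l //.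
  by apply: le_trans (hLF w0 om nw0 nom) _; rewrite ler_wpM2l.
have telescope (a b a' b' : R) : a - b = - (a' - a) + (a' - b') + (b' - b) by ring.
rewrite (telescope _ _ (complex.Re (weight_part d 0 nu Gc z om)) (complex.Re (D z * weight_part d d.-1 nu Fc z om))).
have -> : K * eta = LG * eta + (KG + MF + nD * KF + MG + C * S * MF) * eta + nD * LF * eta.
  by rewrite /K; ring.
do 2![apply: le_trans (ler_normD _ _) _; apply: lerD => //].
by rewrite normrN.
Qed.

End LeadingIdentity.

(** * Vanishing of the part of lowest weight *)

Section Apply.
Context {R : realType}.
Variables (d k0 nu : nat) (alpha : nat -> R[i]).
Hypotheses (k0d : (k0 < d)%N) (dk0 : (d <= k0.*2)%N) (d2 : (1 < d)%N).
Hypothesis alphaJ : forall j, (d - k0 <= j <= k0)%N -> alpha j = conjc (alpha (d - j)%N).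
Hypothesis alpha0 : alpha k0 != 0.
Variables (Fc Gc : nat -> nat -> R[i]).
Hypothesis Ford : forall m n, (m + n <= 2)%N -> Fc m n = 0.
Hypothesis Gord : forall m n, (m + n <= 2)%N -> Gc m n = 0.

Notation P := (model_poly d k0 alpha).
Notation D := (model_deriv d k0 alpha).
Let f := weight_coef d d.-1 nu Fc.
Let g := weight_coef d 0 nu Gc.

Hypothesis ident : forall z s, let w := complex.Re (P z) +i* s in
  complex.Re (weight_part d 0 nu Gc z w) = complex.Re (D z * weight_part d d.-1 nu Fc z w).

(** z^nu times the n-th term of twice the real identity, in terms of
    T = z^2 and X = z^d w. *)
Let term (z w : R[i]) n (zz : z * conjc z = 1) :
  z ^+ nu * ((g n * z ^+ (nu - (d * n + 0)) * w ^+ n + conjc (g n * z ^+ (nu - (d * n + 0)) * w ^+ n))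
   - (D z * (f n * z ^+ (nu - (d * n + d.-1)) * w ^+ n) + conjc (D z * (f n * z ^+ (nu - (d * n + d.-1)) * w ^+ n)))) =
  (g n * (z ^+ 2) ^+ (nu - d * n) - f n * ((circle_deriv d k0 alpha).[z ^+ 2] * (z ^+ 2) ^+ (nu - (d * n + d.-1)))) * (z ^+ d * w) ^+ n
  + (conjc (g n) - conjc (f n) * (circle_deriv_conj d k0 alpha).[z ^+ 2]) * (z ^+ d * conjc w) ^+ n.
Proof.
rewrite addn0 -(model_deriv_circle k0d dk0 d2 alphaJ alpha0 zz) -(model_deriv_conj_circle k0d dk0 d2 alphaJ alpha0 zz).
have zc m : z ^+ m * conjc z ^+ m = 1 by rewrite -exprMn zz expr1n.
have Eg : z ^+ nu * (g n * z ^+ (nu - d * n) * w ^+ n + conjc (g n * z ^+ (nu - d * n) * w ^+ n)) =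
   g n * (z ^+ 2) ^+ (nu - d * n) * (z ^+ d * w) ^+ n + conjc (g n) * (z ^+ d * conjc w) ^+ n.
  rewrite /g /weight_coef addn0; case: leqP => h; last by rewrite !mul0r conjc0 !mul0r addr0 mulr0.
  have E : nu = ((nu - d * n) + d * n)%N by rewrite subnK.
  rewrite !rmorphM !rmorphXn /= mulrDr; congr (_ + _).
    by rewrite {1}E exprD exprM (exprMn n (z ^+ d)) (exprAC z 2) expr2; ring.
  rewrite {1}E exprD exprM (exprMn n (z ^+ d)).
  by rewrite -[RHS]mulr1 -(zc (nu - d * n)%N); ring.
have Ef : z ^+ nu * (D z * (f n * z ^+ (nu - (d * n + d.-1)) * w ^+ n) +
      conjc (D z * (f n * z ^+ (nu - (d * n + d.-1)) * w ^+ n))) =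
   f n * (z ^+ d.-1 * D z * (z ^+ 2) ^+ (nu - (d * n + d.-1))) * (z ^+ d * w) ^+ n +
   conjc (f n) * (z ^+ d.-1 * conjc (D z)) * (z ^+ d * conjc w) ^+ n.
  rewrite /f /weight_coef; case: leqP => h; last by rewrite !(mul0r, mulr0, conjc0, addr0).
  set a := (nu - (d * n + d.-1))%N.
  have E : nu = (a + (d * n + d.-1))%N by rewrite subnK.
  rewrite !rmorphM !rmorphXn /= mulrDr; congr (_ + _).
    by rewrite {1}E !exprD exprM (exprMn n (z ^+ d)) (exprAC z 2) expr2; ring.
  rewrite {1}E !exprD exprM (exprMn n (z ^+ d)).
  by rewrite -[RHS]mulr1 -(zc a); ring.
by rewrite mulrBr Eg Ef; ring.
Qed.

Let Q : {poly {poly R[i]}} := \sum_(n < nu.+1)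
  ((g n *: 'X^(nu - d * n) - f n *: (circle_deriv d k0 alpha * 'X^(nu - (d * n + d.-1))))%:P * 'X^n +
   ((conjc (g n))%:P - conjc (f n) *: circle_deriv_conj d k0 alpha)%:P * ((2 *: circle_poly d k0 alpha)%:P - 'X) ^+ n).

Let Q0 : Q = 0.
Proof.
(* the value of z^d w for z = unit_pt k and w = P(z) + i n *)
pose X (k n : nat) : R[i] := (circle_poly d k0 alpha).[unit_pt k ^+ 2] + 'i * n%:R * unit_pt k ^+ d.
have z0 k : unit_pt k != 0 :> R[i].
  by apply/eqP => h; have := unit_pt_norm1 (R := R) k; rewrite h mul0r => /esym/eqP; rewrite oner_eq0.
apply: (polypoly_eq0 (X := X)) => [k m n /addrI|k n].
  move=> /(mulIf (expf_neq0 d (z0 k))) /mulfI h.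
  by have /eqP := h ltac:(by rewrite -normc_gt0 normc_i); rewrite eqr_nat => /eqP.
set z := unit_pt k; have zz := unit_pt_norm1 (R := R) k; rewrite -/z in zz.
pose w := complex.Re (P z) +i* n%:R.
have wE : w = P z + 'i * n%:R.
  by rewrite [w]complexE /= [P z](model_real k0d dk0 d2 alphaJ alpha0) rmorph_nat.
have XE : X k n = z ^+ d * w.
  by rewrite wE mulrDr (model_circle k0d dk0 d2 alpha0 zz) /X -/z; ring.
have XE' : 2 * (circle_poly d k0 alpha).[z ^+ 2] - X k n = z ^+ d * conjc w.
  have -> : conjc w = P z - 'i * n%:R.
    have cE : conjc (P z + 'i * n%:R) = conjc (P z) + conjc 'i * conjc n%:R.
      by rewrite (rmorphD (@conjc R)) (rmorphM (@conjc R)).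
    rewrite wE cE (model_conj k0d dk0 d2 alphaJ alpha0) conjc_nat.
    by have -> : conjc 'i = - 'i :> R[i]; [apply/eqP; rewrite eq_complex /= oppr0 !eqxx|rewrite mulNr].
  by rewrite /X -/z -(model_circle k0d dk0 d2 alpha0 zz); ring.
have -> : (map_poly (fun a : {poly R[i]} => a.[z ^+ 2]) Q).[X k n] = Q.[(X k n)%:P].[z ^+ 2].
  rewrite -[RHS]/(horner_eval (z ^+ 2) Q.[(X k n)%:P]) -horner_map /=.
  by rewrite /horner_eval hornerC.
rewrite /Q !horner_sum.
have E (i : 'I_nu.+1) : true -> ((g i *: 'X^(nu - d * i) - f i *: (circle_deriv d k0 alpha * 'X^(nu - (d * i + d.-1))))%:P * 'X^i +
   ((conjc (g i))%:P - conjc (f i) *: circle_deriv_conj d k0 alpha)%:P * ((2 *: circle_poly d k0 alpha)%:P - 'X) ^+ i).[(X k n)%:P].[z ^+ 2]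
  = z ^+ nu * ((g i * z ^+ (nu - (d * i + 0)) * w ^+ i + conjc (g i * z ^+ (nu - (d * i + 0)) * w ^+ i))
   - (D z * (f i * z ^+ (nu - (d * i + d.-1)) * w ^+ i) + conjc (D z * (f i * z ^+ (nu - (d * i + d.-1)) * w ^+ i)))).
  move=> _; rewrite term // -XE -XE'.
  by rewrite !(hornerD, hornerM, hornerN, hornerC, hornerXn, horner_exp, hornerX, hornerZ).
rewrite (eq_bigr _ E) -mulr_sumr sumrB !big_split /= -!rmorph_sum -mulr_sumr.
have := ident z n%:R; rewrite -/w /weight_part -/f -/g; move: (\sum_(i < nu.+1) _) (D z * _) => a b ab.
have cJ (x : R[i]) : x + conjc x = (2 * complex.Re x)%:C by rewrite addcJ rmorphM rmorph_nat.
by rewrite !cJ ab subrr mulr0.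
Qed.

(** Polynomials that agree for z in an infinite subset of the unit circle and
    s in the natural numbers agree in T and X; the resulting identity
    is the one of [power_identity_coefs_eq0]. *)
Lemma weight_coef_eq0 n : f n = 0 /\ g n = 0.
Proof.
have conj0 (x : R[i]) : (conjc x == 0) = (x == 0) by rewrite conjc_eq0.
apply: (@power_identity_coefs_eq0 _ d nu k0 (2 *: circle_poly d k0 alpha) (circle_deriv d k0 alpha) (circle_deriv_conj d k0 alpha)
   f (fun n => conjc (f n)) g (fun n => conjc (g n))) => //.
- by lia.
- by rewrite size_scale ?pnatr_eq0 // size_circle_poly.
- exact: size_circle_deriv.
- exact: size_circle_deriv_conj.
- exact: circle_deriv_conj_neq0.
- by rewrite hornerZ circle_poly_at0 // mulr0.
- exact: circle_deriv_conj_at0.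
- by move=> m; rewrite /f /weight_coef; case: ifP => //; rewrite eqxx.
- by move=> m; rewrite /g /weight_coef addn0; case: ifP => //; rewrite eqxx.
- move=> m; rewrite /f /weight_coef; case: ifP => _; last by rewrite eqxx.
  by move=> h; rewrite ltnNge; apply: contra h => /Ford ->.
- move=> m; rewrite /g /weight_coef addn0; case: ifP => _; last by rewrite eqxx.
  by move=> h; rewrite ltnNge; apply: contra h => /Gord ->.
Qed.

End Apply.

(** * Vanishing of all coefficients, and the theorem *)

Section Assembly.
Context {R : realType}.
Implicit Types (z w : R[i]) (s : R).

Lemma sum_sub_delta (c : nat -> nat -> R[i]) (a b N : nat) z w : (a < N)%N -> (b < N)%N ->
  \sum_(m < N) \sum_(n < N) (c m n - ((m == a :> nat) && (n == b :> nat))%:R) * z ^+ m * w ^+ n =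
  \sum_(m < N) \sum_(n < N) c m n * z ^+ m * w ^+ n - z ^+ a * w ^+ b.
Proof.
move=> aN bN.
transitivity (\sum_(m < N) \sum_(n < N) c m n * z ^+ m * w ^+ n -
  \sum_(m < N) \sum_(n < N) (if (m == Ordinal aN) && (n == Ordinal bN) then z ^+ m * w ^+ n else 0)).
  rewrite -sumrB; apply: eq_bigr => m _; rewrite -sumrB; apply: eq_bigr => n _.
  rewrite !mulrBl; congr (_ - _); rewrite -!val_eqE /=.
  by case: (_ && _); rewrite ?mul1r ?mul0r.
congr (_ - _); rewrite (bigD1 (Ordinal aN)) //= [X in _ + X]big1 ?addr0; last first.
  by move=> m /negbTE ma; apply: big1 => n _; rewrite ma.
by rewrite (bigD1 (Ordinal bN)) //= big1 ?addr0 ?eqxx // => n /negbTE ->; rewrite andbF.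
Qed.

(** Since its constant does not depend on N, the error term tends to 0 as N
    grows when |z| and |w| are at most s / 2. *)
Lemma expands0_eq0 (Phi : R[i] -> R[i] -> R[i]) (c : nat -> nat -> R[i]) (C0 s0 : R) : 0 < s0 -> 0 <= C0 ->
  expands Phi c C0 s0 ->
  (forall m n, c m n = 0) ->
  forall z w, normc z <= s0 / 2 -> normc w <= s0 / 2 -> Phi z w = 0.
Proof.
move=> s00 C00 HT c0 z w hz hw.
have q0 : 0 <= (2^-1 : R) <= 2^-1 by rewrite lexx invr_ge0 ler0n.
apply: (@eq0_geometric_boundc _ _ _ (C0 * 2) q0) => [|N]; first by rewrite mulr_ge0.
have := HT N.+2 z w isT hz hw; rewrite big1 ?subr0 => [H|m _]; last first.
  by rewrite big1 // => n _; rewrite c0 !mul0r.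
have half t : 0 <= t -> t <= s0 / 2 -> (t / s0) ^+ N.+2 <= 2^-1 ^+ N.
  move=> t0 ht; apply: (@le_trans _ _ (2^-1 ^+ N.+2)).
    by rewrite lerXn2r ?nnegrE ?divr_ge0 ?invr_ge0 ?ler0n ?(ltW s00) // ler_pdivrMr // mulrC.
  by apply: ler_wiXn2l; [rewrite invr_ge0 ler0n | rewrite invf_le1 ?ltr0n // ler1n | exact: leqW].
apply: le_trans H _; rewrite -mulrA ler_wpM2l // mulr_natl mulr2n.
by apply: lerD; apply: half; rewrite ?normc_ge0.
Qed.

(** Induction on the weight: [leading_identity] and [weight_coef_eq0] kill the
    coefficients of weight nu once those of smaller weight are known to
    vanish. *)
Lemma all_coefs_eq0 (d k0 : nat) (alpha : nat -> R[i]) (Rm : R[i] -> R -> R)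
    (F G : R[i] -> R[i] -> R[i]) (Fc Gc : nat -> nat -> R[i]) (C0 s0 : R)
    (P := fun z => complex.Re (model_poly d k0 alpha z)) :
  (k0 < d)%N -> (d <= k0.*2)%N -> (1 < d)%N ->
  (forall j, (d - k0 <= j <= k0)%N -> alpha j = conjc (alpha (d - j)%N)) -> alpha k0 != 0 ->
  small_remainder d (fun z s => (Rm z s)%:C) ->
  Rm 0 0 = 0 -> 0 < s0 -> 0 <= C0 ->
  expands F Fc C0 s0 ->
  expands G Gc C0 s0 ->
  (forall m n, (m + n <= 2)%N -> Fc m n = 0) ->
  (forall m n, (m + n <= 2)%N -> Gc m n = 0) ->
  (exists2 r : R, 0 < r & forall z w, normc z < r -> normc w < r ->
    complex.Re w = P z + Rm z (complex.Im w) ->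
    complex.Re (w + G z w) = P (z + F z w) + Rm (z + F z w) (complex.Im (w + G z w))) ->
  forall m n, Fc m n = 0 /\ Gc m n = 0.
Proof.
move=> k0d dk0 d2 alphaJ alpha0 HR HR0 s00 C00 HTF HTG Ford Gord HM.
have d0 : (0 < d)%N := ltnW d2.
have HPs (e : R) z : P (e%:C * z) = e ^+ d * P z.
  by rewrite /P (model_scale k0d dk0 d2 alpha0) Re_mul /= mul0r subr0.
have HPd z (e : R) (e0 : 0 < e) := model_diff d k0 alpha z e0.
have main nu : forall m n, ((m + (d * n + d.-1) < nu)%N -> Fc m n = 0) /\
                           ((m + (d * n + 0) < nu)%N -> Gc m n = 0).
  elim: nu => [|nu IH] m n; first by split; rewrite ltn0.
  have Fnu m' n' := (IH m' n').1; have Gnu m' n' := (IH m' n').2.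
  have ident z s := leading_identity d0 HPs HPd HR HR0 s00 C00 HTF HTG Ford Gord Fnu Gnu HM z s.
  have [f0 g0] := weight_coef_eq0 k0d dk0 d2 alphaJ alpha0 Ford Gord ident n.
  split; rewrite ltnS leq_eqVlt => /orP[/eqP E|]; try by [exact: Fnu | exact: Gnu].
    by move: f0; rewrite /weight_coef -E leq_addl addnK.
  by move: g0; rewrite /weight_coef -E leq_addl addnK.
by move=> m n; split; [have [h _] := main (m + (d * n + d.-1)).+1 m n; apply: h
                      |have [_ h] := main (m + (d * n + 0)).+1 m n; apply: h].
Qed.

End Assembly.

Theorem theorem5p3 (R : realType) (d k0 : nat)
    (d_even : ~~ odd d) (hk0 : (d./2 <= k0)%N) (hk0d : (k0 < d)%N)
    (U : set (C2 R)) (hU : open_nbhs (0 : C2 R) U)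
    (r : C2 R -> R)
    (r_smooth : class_C_C2 (d./2 + k0 + 5)%N U r)
    (r_adm : admissible d k0 r)
    (H : C2 R -> C2 R)
    (H_bihol : local_biholomorphism H 0)
    (H0 : H 0 = 0)
    (HM : let M := [set p | U p /\ r p = 0] in
          \forall p \near (0 : C2 R), M p -> M (H p))
    (H_tangent : tangent_to_id (k0 - d./2 + 2)%N H) :
  \forall p \near (0 : C2 R), H p = p.
Proof.
have [alpha [r0 [rl [theta1 [[alphaJ alpha0 _ _] [h0 hl ht hO hr]]]]]] := r_adm.
have d2 : (1 < d)%N by move: d_even hk0d; clear; case: d => [|[|]].
have dk0 : (d <= k0.*2)%N by rewrite -(even_halfK d_even) leq_double.
have [A [_ [_ [A0 _ _ _ [hH _]]]]] := H_bihol.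
rewrite addnS in h0 hl ht.
have [/small_remainder_Re HR HR0] := defining_remainder_small (ltnW d2) h0 hl ht hO.
have [s [M [s0 M0 boxA boxM]]] := local_box A0 hH.
pose Rm z (t : R) : R := complex.Re (defining_remainder d r0 rl theta1 z t).
pose F z w := coordfun H true z w - z; pose G z w := coordfun H false z w - w.
pose Fc m n := jet_coef H s true m n - ((m == 1%N) && (n == 0%N))%:R.
pose Gc m n := jet_coef H s false m n - ((m == 0%N) && (n == 1%N))%:R.
have HT b N z w := @coordfun_taylor _ _ _ hH _ _ s0 M0 boxA boxM b z w N.
have C00 : 0 <= 64 * M by rewrite mulr_ge0 // ler0n.
have HTF : expands F Fc (64 * M) s.
  move=> N z w N1 hz hw; rewrite /Fc sum_sub_delta ?(ltnW N1) // expr1 expr0 mulr1 /F.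
  by rewrite opprB addrA subrK; exact: HT.
have HTG : expands G Gc (64 * M) s.
  move=> N z w N1 hz hw; rewrite /Gc sum_sub_delta ?(ltnW N1) // expr1 expr0 mul1r /G.
  by rewrite opprB addrA subrK; exact: HT.
have tan2 : tangent_to_id 2 H by move=> a b ab; apply: H_tangent; rewrite (leq_trans ab) // leq_addl.
have tc := tangent_coefs hH s0 M0 boxA boxM H0 tan2.
have Ford m n : (m + n <= 2)%N -> Fc m n = 0 by move=> /tc[E _]; rewrite /Fc E subrr.
have Gord m n : (m + n <= 2)%N -> Gc m n = 0 by move=> /tc[_ E]; rewrite /Gc E subrr.
have HRe z w : complex.Re (admissible_expr d k0 alpha r0 rl theta1 z w) =
    - complex.Re w + complex.Re (model_poly d k0 alpha z) + Rm z (complex.Im w).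
  rewrite /admissible_expr /Rm /defining_remainder -!addrA Re_add Re_opp; congr (_ + _).
  by rewrite Re_add.
have A00 : A 0 by case: A0.
have cH : {for 0, continuous H} by apply: differentiable_continuous; exact: hH.
have nU : \forall p \near (0 : C2 R), U p by exact: open_nbhs_nbhs.
have pull (Q : C2 R -> Prop) : (\forall p \near (0 : C2 R), Q p) -> \forall p \near (0 : C2 R), Q (H p).
  by move=> hQ; apply: cH; rewrite H0.
have E : exists2 e : R, 0 < e & forall z w, normc z < e -> normc w < e ->
    complex.Re w = complex.Re (model_poly d k0 alpha z) + Rm z (complex.Im w) ->
    complex.Re (w + G z w) = complex.Re (model_poly d k0 alpha (z + F z w)) +
       Rm (z + F z w) (complex.Im (w + G z w)).
  have /near_C2[e e0 he] : \forall p \near (0 : C2 R),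
      [/\ (U p /\ r p = 0 -> U (H p) /\ r (H p) = 0), U p,
        r p = - complex.Re p.2 + complex.Re (model_poly d k0 alpha p.1) + Rm p.1 (complex.Im p.2) &
        r (H p) = - complex.Re (H p).2 + complex.Re (model_poly d k0 alpha (H p).1) + Rm (H p).1 (complex.Im (H p).2)].
    have hr' : \forall p \near (0 : C2 R), r p = - complex.Re p.2 + complex.Re (model_poly d k0 alpha p.1) + Rm p.1 (complex.Im p.2).
      by apply: filterS hr => p hp; rewrite -HRe -hp.
    by near=> p; split; near: p => //; exact: pull hr'.
  exists e => // z w hz hw Ew; have := he z w hz hw; rewrite !add0r => -[hM Up rp rHp].
  have r0p : r (z, w) = 0 by rewrite rp /= Ew; ring.
  have [_] := hM (conj Up r0p); rewrite rHp => /eqP.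
  have -> : w + G z w = (H (z, w)).2 by rewrite /G /coordfun /= addrC subrK.
  have -> : z + F z w = (H (z, w)).1 by rewrite /F /coordfun /= addrC subrK.
  by rewrite -addrA addrC subr_eq0 => /eqP.
have Rm0 : Rm 0 0 = 0 by rewrite /Rm HR0.
have c0 := all_coefs_eq0 hk0d dk0 d2 alphaJ alpha0 HR Rm0 s0 C00 HTF HTG Ford Gord E.
have F0 := expands0_eq0 s0 C00 HTF (fun m n => (c0 m n).1).
have G0 := expands0_eq0 s0 C00 HTG (fun m n => (c0 m n).2).
apply/near_C2; exists (s / 2) => [|z w hz hw]; first by rewrite divr_gt0.
rewrite !add0r.
have /eqP := F0 z w (ltW hz) (ltW hw); have /eqP := G0 z w (ltW hz) (ltW hw).
rewrite !subr_eq0 => /eqP hG /eqP hF.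
by rewrite [LHS]surjective_pairing; congr pair.
Unshelve. all: by end_near. Qed.
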